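(* Let $n\ge2$, $\alpha\ge 0$ and $0<\lambda\le\Lambda$. There exists a constant $C=C(n,\lambda,\Lambda,\alpha)>0$ such that the following holds. Let $F$ be uniformly elliptic with constants $(\lambda,\Lambda)$ and $F(0)=0$, let $u\in C(B_1)$, put $B_1^+(u):=\{u>0\}\cap B_1$ and $\mathcal F(u):=\partial\{u>0\}\cap B_1$, let $f\in C(B_1)\cap L^\infty(B_1)$ and $h\in C(\mathcal F(u))\cap L^\infty(\mathcal F(u))$, and assume that $u$ is a viscosity solution of $$\begin{cases}|\nabla u|^{\alpha}F(D^2u)=f&\text{in }B_1^+(u),\\ |\nabla u^+|\le h&\text{on }\mathcal F(u).\end{cases}$$ Then $u^+=\max\{u,0\}\in C^{0,1}(B_{1/2})$ and $$\|\nabla u^+\|_{L^\infty(B_{1/2})}\ \le\ C\Big(\|h\|_{L^\infty(\mathcal F(u))}+\|u\|_{L^\infty(B_1^+(u))}+\|f\|_{L^\infty(B_1)}^{\frac1{1+\alpha}}\Big).$$ Moreover, if $0\in\mathcal F(u)$, the estimate holds without the term $\|u\|_{L^\infty(B_1^+(u))}$.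
   Context: $B_r(x)$ is the open ball of $\mathbb R^n$, $B_r=B_r(0)$. $\mathcal S^n$ is the set of real symmetric $n\times n$ matrices. Pucci operators: $\mathcal M^+_{\lambda,\Lambda}(X)=\Lambda\operatorname{Tr}(X^+)-\lambda\operatorname{Tr}(X^-)$, $\mathcal M^-_{\lambda,\Lambda}(X)=\lambda\operatorname{Tr}(X^+)-\Lambda\operatorname{Tr}(X^-)$, where $X=X^+-X^-$ is the decomposition into positive and negative parts. A continuous $F:\mathcal S^n\to\mathbb R$ is uniformly elliptic with constants $(\lambda,\Lambda)$ if $\mathcal M^-_{\lambda,\Lambda}(X-Y)\le F(X)-F(Y)\le\mathcal M^+_{\lambda,\Lambda}(X-Y)$ for all $X,Y\in\mathcal S^n$. Equation in the viscosity sense (Birindelli–Demengel): on an open set $\Omega$, $u\in C(\Omega)$ is a viscosity supersolution (resp. subsolution) of $|\nabla u|^\alpha F(D^2u)=f$ if for every $x_0\in\Omega$ one of the following holds: (i) there are $\delta>0$, $c\in\mathbb R$ with $u\equiv c$ in $B_\delta(x_0)\subset\Omega$ and $0\le f$ (resp. $0\ge f$) in $B_\delta(x_0)$; (ii) for every $\varphi\in C^2(\Omega)$ such that $u-\varphi$ has a local minimum (resp. maximum) at $x_0$ and $\nabla\varphi(x_0)\neq0$, one has $|\nabla\varphi(x_0)|^\alpha F(D^2\varphi(x_0))\le f(x_0)$ (resp. $\ge f(x_0)$). A solution is both a sub- and a supersolution. Here $\Omega=B_1^+(u)$. Free boundary condition: ''$|\nabla u^+|\le h$ on $\mathcal F(u)$''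 means the following. Let $y_0\in\mathcal F(u)$, $0<\delta<\operatorname{dist}(y_0,\partial B_1)$, and let $0\le\varphi\in C(B_\delta(y_0))$ be such that $y_0\in\mathcal F(\varphi):=\partial\{\varphi>0\}\cap B_\delta(y_0)$, $\mathcal F(\varphi)$ is of class $C^1$ near $y_0$, $\varphi$ is $C^1$ in $\{\varphi>0\}$ up to $\mathcal F(\varphi)$ (in the ball of radius $\delta$ around $y_0$), and $\varphi$ touches $u^+$ from below at $y_0$ (i.e. $\varphi\le u^+$ near $y_0$ and $\varphi(y_0)=u^+(y_0)$). Then $\frac{\partial\varphi}{\partial\nu}(y_0)\le h(y_0)$, where $\nu$ is the unit normal at $y_0$ to $\mathcal F(\varphi)$ pointing towards the interior of $\{\varphi>0\}$. *)

(* Defs.v *)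
From HB Require Import structures.
From mathcomp Require Import all_boot all_order all_algebra.
From mathcomp Require Import all_classical all_reals all_analysis.

Set Implicit Arguments.
Unset Strict Implicit.
Unset Printing Implicit Defensive.

Import Order.TTheory GRing.Theory Num.Theory.
Import numFieldNormedType.Exports.

Local Open Scope classical_set_scope.
Local Open Scope ring_scope.

(* R^n is 'rV[R]_n. The library norm on 'rV[R]_n is the sup norm: it is only
   used through the topology it induces, and every metric notion below is
   Euclidean. Functions given on a subset of R^n are represented by total
   functions whose values outside that subset are never used. *)

Section Euclidean.
Context {R : realType} {n : nat}.
Implicit Types (x y v : 'rV[R]_n) (A : set 'rV[R]_n).

Definition dot x y : R := (x *m y^T) 0 0.

Definition enorm x : R := Num.sqrt (dot x x).

Definition eball x (r : R) : set 'rV[R]_n := [set y | enorm (y - x) < r].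

Definition edistance x A : R := inf [set enorm (x - z) | z in A].

Definition boundary A : set 'rV[R]_n := closure A `\` interior A.

(* {g > 0} and its boundary, for a function g defined on the open set B *)
Definition positivity_set B (g : 'rV[R]_n -> R) : set 'rV[R]_n :=
  [set x | B x /\ 0 < g x].

Definition free_boundary B (g : 'rV[R]_n -> R) : set 'rV[R]_n :=
  boundary (positivity_set B g) `&` B.

Definition lipschitz_in A (g : 'rV[R]_n -> R) : Prop :=
  exists L : R, forall x y, A x -> A y -> `|g x - g y| <= L * enorm (x - y).

End Euclidean.

Section Norms.
Context {R : realType} {n : nat}.
Implicit Types (A : set 'rV[R]_n) (g : 'rV[R]_n -> R).

Definition lebesgue_null A : Prop :=
  forall e : R, 0 < e -> exists a b : nat -> 'rV[R]_n,
    [/\ forall k i, a k 0 i <= b k 0 i,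
        A `<=` \bigcup_k [set x | forall i, a k 0 i <= x 0 i <= b k 0 i] &
        (\sum_(0 <= k <oo) (\prod_i (b k 0 i - a k 0 i))%:E <= e%:E)%E].

(* L^oo norm with respect to the Lebesgue measure of R^n *)
Definition Linfty_norm A g : \bar R :=
  ereal_inf [set M%:E | M in [set M : R |
    0 <= M /\ lebesgue_null [set x | A x /\ M < `|g x|]]].

(* supremum of |g| over A, equal to 0 if A is empty: a free boundary may be
   Lebesgue-null, so this is the norm to use there *)
Definition sup_norm A g : \bar R :=
  ereal_inf [set M%:E | M in [set M : R |
    0 <= M /\ forall x, A x -> `|g x| <= M]].

End Norms.

Section Differentiability.
Context {R : realType} {n : nat}.
Implicit Types (g : 'rV[R]_n -> R) (x : 'rV[R]_n).

Definition evec (i : 'I_n) : 'rV[R]_n := delta_mx 0 i.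

Definition partial (i : 'I_n) g : 'rV[R]_n -> R := 'D_(evec i) g.

Definition grad g x : 'rV[R]_n := \row_i partial i g x.

Definition hess g x : 'M[R]_n := \matrix_(i, j) partial i (partial j g) x.

(* the two predicates below are meant for open sets O *)
Definition C1_in (O : set 'rV[R]_n) g : Prop :=
  forall x, O x -> forall i,
    derivable g x (evec i) /\ {for x, continuous (partial i g)}.

Definition C2_in (O : set 'rV[R]_n) g : Prop :=
  C1_in O g /\ forall i, C1_in O (partial i g).

End Differentiability.

Section Ellipticity.
Context {R : realType} {n : nat}.
Implicit Types (X P N : 'M[R]_n) (F : 'M[R]_n -> R).

Definition psd X : Prop :=
  X \is symmetricmx /\ forall v : 'rV[R]_n, 0 <= dot (v *m X) v.

(* (P, N) = (X^+, X^-): this pair exists and is unique when X is symmetric *)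
Definition is_pos_neg_parts X (PN : 'M[R]_n * 'M[R]_n) : Prop :=
  [/\ psd PN.1, psd PN.2, PN.1 *m PN.2 = 0 & X = PN.1 - PN.2].

Definition pos_neg_parts X : 'M[R]_n * 'M[R]_n :=
  xget (0, 0) (is_pos_neg_parts X).

Definition mxpos X : 'M[R]_n := (pos_neg_parts X).1.
Definition mxneg X : 'M[R]_n := (pos_neg_parts X).2.

Definition pucci_max (lam Lam : R) X : R :=
  Lam * \tr (mxpos X) - lam * \tr (mxneg X).

Definition pucci_min (lam Lam : R) X : R :=
  lam * \tr (mxpos X) - Lam * \tr (mxneg X).

(* F is an operator on symmetric matrices: its values elsewhere are ignored *)
Definition uniformly_elliptic (lam Lam : R) F : Prop :=
  {within [set X | X \is symmetricmx], continuous F} /\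
  forall X Y, X \is symmetricmx -> Y \is symmetricmx ->
    pucci_min lam Lam (X - Y) <= F X - F Y <= pucci_max lam Lam (X - Y).

End Ellipticity.

Section Viscosity.
Context {R : realType} {n : nat}.
Implicit Types (O : set 'rV[R]_n) (F : 'M[R]_n -> R) (u f : 'rV[R]_n -> R).

Definition visc_supersolution O (alpha : R) F f u : Prop :=
  {within O, continuous u} /\
  forall x0, O x0 ->
    (exists d c : R, [/\ 0 < d, eball x0 d `<=` O &
       forall x, eball x0 d x -> u x = c /\ 0 <= f x]) \/
    (forall phi : 'rV[R]_n -> R, C2_in O phi ->
       (\forall x \near x0, u x0 - phi x0 <= u x - phi x) ->
       grad phi x0 != 0 ->
       enorm (grad phi x0) `^ alpha * F (hess phi x0) <= f x0).

Definition visc_subsolution O (alpha : R) F f u : Prop :=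
  {within O, continuous u} /\
  forall x0, O x0 ->
    (exists d c : R, [/\ 0 < d, eball x0 d `<=` O &
       forall x, eball x0 d x -> u x = c /\ f x <= 0]) \/
    (forall phi : 'rV[R]_n -> R, C2_in O phi ->
       (\forall x \near x0, u x - phi x <= u x0 - phi x0) ->
       grad phi x0 != 0 ->
       f x0 <= enorm (grad phi x0) `^ alpha * F (hess phi x0)).

Definition visc_solution O (alpha : R) F f u : Prop :=
  visc_subsolution O alpha F f u /\ visc_supersolution O alpha F f u.

End Viscosity.

Section FreeBoundaryCondition.
Context {R : realType} {n : nat}.
Implicit Types (u h phi psi : 'rV[R]_n -> R) (y nu : 'rV[R]_n).

(* near y, S is the regular zero set of the C^1 function psi *)
Definition C1_defining_function (S : set 'rV[R]_n) y psi : Prop :=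
  exists r : R, [/\ 0 < r, C1_in (eball y r) psi,
    forall x, eball y r x -> grad psi x != 0 &
    S `&` eball y r = [set x | psi x = 0] `&` eball y r].

Definition C1_hypersurface_near (S : set 'rV[R]_n) y : Prop :=
  exists psi, C1_defining_function S y psi.

Definition unit_normal (S : set 'rV[R]_n) y nu : Prop :=
  enorm nu = 1 /\
  exists psi, C1_defining_function S y psi /\ exists c : R, nu = c *: grad psi y.

Definition points_into (P : set 'rV[R]_n) y nu : Prop :=
  \forall t \near 0^'+, interior P (y + t *: nu).

(* phi is C^1 in the open set P up to S, and G is the continuous extension
   of its gradient to P `|` S *)
Definition C1_up_to (P S : set 'rV[R]_n) phi (G : 'rV[R]_n -> 'rV[R]_n) : Prop :=
  [/\ C1_in P phi, forall x, P x -> G x = grad phi x &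
      {within P `|` S, continuous G}].

(* |grad u^+| <= h on the free boundary, for u given on the unit ball;
   dot (G y0) nu is the derivative of phi at y0 along nu, taken from the
   inside of {phi > 0} *)
Definition visc_free_boundary_le u h : Prop :=
  forall (y0 : 'rV[R]_n) (d : R) phi G nu,
    let B := eball y0 d in
    free_boundary (eball 0 1) u y0 ->
    0 < d < edistance y0 (boundary (eball 0 1)) ->
    (forall x, B x -> 0 <= phi x) ->
    {within B, continuous phi} ->
    free_boundary B phi y0 ->
    C1_hypersurface_near (free_boundary B phi) y0 ->
    C1_up_to (positivity_set B phi) (free_boundary B phi) phi G ->
    (\forall x \near y0, phi x <= u^\+ x) ->
    phi y0 = u^\+ y0 ->
    unit_normal (free_boundary B phi) y0 nu ->
    points_into (positivity_set B phi) y0 nu ->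
    dot (G y0) nu <= h y0.

End FreeBoundaryCondition.

(* Main.v *)
Require Import Defs.
From HB Require Import structures.
From mathcomp Require Import all_boot all_order all_algebra.
From mathcomp Require Import all_classical all_reals all_analysis.
From mathcomp Require Import measurable_realfun.
From mathcomp Require Import ring lra.

(* Everything rests on a one-sided bound [u^+(x0) - u^+(y) <= L |x0 - y|] for
   [y] near a given [x0], which controls the partial derivatives at [x0].

   It is obtained by the Ishii-Lions doubling of variables. Maximize
   [u^+(x) - u^+(y) - L (|x - y| - |x - y|^2 / (8 rho)) - K |x - x0|^2] over
   [B_rho(x0)^2]. If the maximum is positive, it is reached at [x != y] with
   [u(x) > 0]. Either [u(y) <= 0], and then [u^+] lies above a truncated
   paraboloid of slope at least [L / 2] at a free boundary point, so that
   [L <= 2 h]; or both points lie in [{u > 0}], where the test gradients have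
   size comparable to [L], so that the weight [|p|^alpha] is harmless and the
   concavity of the penalization in the direction [x - y] contradicts
   ellipticity as soon as [L] exceeds a multiple of
   [sup u / rho + |f|^(1/(1+alpha))].

   The theorem on sums used there is only needed up to an error [eta], and this
   avoids Alexandrov's theorem. After sup-convolution the sum of the two
   functions is semiconvex. Among the paraboloids touching a semiconvex
   function [w] from above near a point, take one whose Hessian [A <= A0 + t I]
   nearly minimizes [tr A + m t]; comparison with the explicit barriers
   [(T - |x|^2)^q] shows that [w] is almost equal to that paraboloid in a small
   ball. For [w(x, y) = u(x) + v(y)] this yields touching paraboloids for [u]
   and [v] separately.

   When [0] is a free boundary point, [sup u] is replaced by
   [C d (|h| + |f|^(1/(1+alpha)))] with [d] the distance from [x0] to
   [{u <= 0}]: a Harnack inequality bounds [u] from below in a smaller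
   concentric ball, a barrier propagates that bound up to the nearest point of
   [{u <= 0}], and its slope there is at most [h].

   The essential suprema are suprema since a ball is not a null set. *)

Set Implicit Arguments.
Unset Strict Implicit.
Unset Printing Implicit Defensive.

Import Order.TTheory GRing.Theory Num.Theory.
Import numFieldNormedType.Exports.

Local Open Scope classical_set_scope.
Local Open Scope ring_scope.

(** * Euclidean space *)

Section Dot.
Context {R : realType} {n : nat}.
Implicit Types (x y z v : 'rV[R]_n) (a b c e r s : R) (A K : set 'rV[R]_n).

(** All quantities are compared as slopes: [f] enters through a number [Ph] with
    [|f| <= Ph^(1+alpha)], which is of the same nature as [h], [L] and [sup u / rho]. Since the
    equation says nothing at vanishing gradients, every test paraboloid used against it comes with a
    lower bound on its slope. A single local estimate, [lipschitz_at_center], is used in three ways: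
    with radius [1/4] for the bound involving [sup u]; inside balls where [u > 0], where the free
    boundary condition is void, to prove the Harnack inequality; and in a ball of radius
    proportional to [d]. In the last use the radius shrinks near the free boundary, which is
    harmless for gradients; the Lipschitz property on the half ball is obtained separately.
    One-sided bounds are enough because a difference quotient may be taken in either direction, and
    because [u^+] is minimal wherever [u <= 0]. Ellipticity is applied to nonnegative increments
    only, so that no eigenvalue and no spectral decomposition ever occurs. *)

Lemma dotE x y : dot x y = \sum_i x 0 i * y 0 i.
Proof. by rewrite /dot mxE; apply: eq_bigr => i _; rewrite mxE. Qed.

Lemma dotC x y : dot x y = dot y x.
Proof. by rewrite !dotE; apply: eq_bigr => i _; rewrite mulrC. Qed.

Lemma dotDl x y z : dot (x + y) z = dot x z + dot y z.
Proof. by rewrite /dot mulmxDl mxE. Qed.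

Lemma dotDr x y z : dot x (y + z) = dot x y + dot x z.
Proof. by rewrite dotC dotDl !(dotC x). Qed.

Lemma dotZl a x y : dot (a *: x) y = a * dot x y.
Proof. by rewrite /dot -scalemxAl mxE. Qed.

Lemma dotZr a x y : dot x (a *: y) = a * dot x y.
Proof. by rewrite dotC dotZl dotC. Qed.

Lemma dotNl x y : dot (- x) y = - dot x y.
Proof. by rewrite -scaleN1r dotZl mulN1r. Qed.

Lemma dotNr x y : dot x (- y) = - dot x y.
Proof. by rewrite dotC dotNl dotC. Qed.

Lemma dotBl x y z : dot (x - y) z = dot x z - dot y z.
Proof. by rewrite dotDl dotNl. Qed.

Lemma dotBr x y z : dot x (y - z) = dot x y - dot x z.
Proof. by rewrite dotDr dotNr. Qed.

Lemma dot0l x : dot 0 x = 0.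
Proof. by rewrite -(scale0r 0) dotZl mul0r. Qed.

Lemma dot0r x : dot x 0 = 0.
Proof. by rewrite dotC dot0l. Qed.

Definition dotS := (dotDl, dotDr, dotBl, dotBr, dotNl, dotNr, dotZl, dotZr,
  dot0l, dot0r).

Lemma dot_ge0 x : 0 <= dot x x.
Proof. by rewrite dotE; apply: sumr_ge0 => i _; rewrite -expr2 sqr_ge0. Qed.

Lemma sqr_coord_le_dot x i : x 0 i ^+ 2 <= dot x x.
Proof.
rewrite dotE (bigD1 i)//= -expr2 lerDl; apply: sumr_ge0 => j _.
by rewrite -expr2 sqr_ge0.
Qed.

Lemma dot_eq0 x : (dot x x == 0) = (x == 0).
Proof.
apply/eqP/eqP => [x0|->]; last by rewrite dot0l.
apply/rowP => i; rewrite mxE; apply/eqP; rewrite -sqrf_eq0.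
by rewrite eq_le sqr_ge0 -x0 sqr_coord_le_dot.
Qed.

Lemma dot_gt0 x : (0 < dot x x) = (x != 0).
Proof. by rewrite lt0r dot_eq0 dot_ge0 andbT. Qed.

Lemma dot_mulmxl x (M : 'M[R]_n) y : dot (x *m M) y = dot x (y *m M^T).
Proof. by rewrite /dot trmx_mul trmxK mulmxA. Qed.

Lemma symmetricP (M : 'M[R]_n) : M \is symmetricmx <-> M^T = M.
Proof.
by rewrite is_hermitianmxE expr0 scale1r map_mx_id; split=> [/eqP|->].
Qed.

Lemma dot_sym (M : 'M[R]_n) x y : M \is symmetricmx ->
  dot (x *m M) y = dot (y *m M) x.
Proof. by move=> /symmetricP MT; rewrite dot_mulmxl MT dotC. Qed.

Lemma enorm_ge0 x : 0 <= enorm x.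
Proof. exact: sqrtr_ge0. Qed.

Lemma sqr_enorm x : enorm x ^+ 2 = dot x x.
Proof. by rewrite sqr_sqrtr// dot_ge0. Qed.

Lemma enorm0 : enorm (0 : 'rV[R]_n) = 0.
Proof. by rewrite /enorm dot0l sqrtr0. Qed.

Lemma enorm_eq0 x : (enorm x == 0) = (x == 0).
Proof. by rewrite -dot_eq0 -sqr_enorm sqrf_eq0. Qed.

Lemma enorm_gt0 x : (0 < enorm x) = (x != 0).
Proof. by rewrite lt0r enorm_eq0 enorm_ge0 andbT. Qed.

Lemma enormN x : enorm (- x) = enorm x.
Proof. by rewrite /enorm dotNl dotNr opprK. Qed.

Lemma enormB x y : enorm (x - y) = enorm (y - x).
Proof. by rewrite -enormN opprB. Qed.

Lemma enormZ a x : enorm (a *: x) = `|a| * enorm x.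
Proof.
by rewrite /enorm dotZl dotZr mulrA -expr2 sqrtrM ?sqr_ge0// sqrtr_sqr.
Qed.

Lemma cauchy_schwarz x y : dot x y <= enorm x * enorm y.
Proof.
have [->|x0] := eqVneq x 0; first by rewrite dot0l enorm0 mul0r.
have [->|y0] := eqVneq y 0; first by rewrite dot0r enorm0 mulr0.
have nx : 0 < enorm x by rewrite enorm_gt0.
have ny : 0 < enorm y by rewrite enorm_gt0.
have := dot_ge0 (enorm y *: x - enorm x *: y).
rewrite !dotS -!sqr_enorm (dotC y x) => h.
have : 0 <= 2 * (enorm x * enorm y) * (enorm x * enorm y - dot x y).
  by apply: le_trans h _; rewrite le_eqVlt; apply/orP; left; apply/eqP; ring.
by rewrite pmulr_rge0 ?subr_ge0// !mulr_gt0.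
Qed.

Lemma cauchy_schwarzN x y : - dot x y <= enorm x * enorm y.
Proof. by rewrite -dotNl -(enormN x) cauchy_schwarz. Qed.

Lemma enormD x y : enorm (x + y) <= enorm x + enorm y.
Proof.
rewrite -ler_sqr ?nnegrE ?addr_ge0 ?enorm_ge0// sqr_enorm !dotS (dotC y x).
have := cauchy_schwarz x y; rewrite sqrrD !sqr_enorm; lra.
Qed.

Lemma enormD3 x y z : enorm (x - z) <= enorm (x - y) + enorm (y - z).
Proof. by rewrite -[x - z](subrKA y) enormD. Qed.

Lemma enorm_ler_sqr x r : 0 <= r -> (enorm x <= r) = (dot x x <= r ^+ 2).
Proof. by move=> r0; rewrite -sqr_enorm ler_sqr// nnegrE ?enorm_ge0. Qed.

Lemma enorm_ltr_sqr x r : 0 <= r -> (enorm x < r) = (dot x x < r ^+ 2).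
Proof. by move=> r0; rewrite -sqr_enorm ltr_sqr// nnegrE ?enorm_ge0. Qed.

Lemma coord_le_enorm x i : `|x 0 i| <= enorm x.
Proof.
by rewrite -ler_sqr ?nnegrE ?enorm_ge0 ?normr_ge0// sqr_enorm real_normK
  ?num_real// sqr_coord_le_dot.
Qed.

Lemma enorm_le_coord x s : 0 <= s -> (forall i, `|x 0 i| <= s) ->
  enorm x <= n%:R * s.
Proof.
move=> s0 xs; rewrite enorm_ler_sqr ?mulr_ge0// dotE.
apply: (@le_trans _ _ (\sum_(i < n) s ^+ 2)).
  apply: ler_sum => i _; rewrite -expr2 -real_normK ?num_real//.
  by rewrite ler_sqr ?nnegrE.
rewrite sumr_const card_ord -[leLHS]mulr_natl exprMn -natrX.
apply: ler_wpM2r; first exact: sqr_ge0.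
by rewrite ler_nat; case: (n) => // k; rewrite -{1}[k.+1]expn1 leq_pexp2l.
Qed.

Lemma mx_norm_le_enorm x : `|x| <= enorm x.
Proof.
rewrite {1}/Num.norm /= mx_normrE; apply/bigmax_leP; split=> [|[i j] _ /=].
  exact: enorm_ge0.
by rewrite ord1 coord_le_enorm.
Qed.

Lemma enorm_le_mx_norm x : enorm x <= n%:R * `|x|.
Proof.
apply: enorm_le_coord => // i.
rewrite [leRHS]/Num.norm /= mx_normrE; apply/bigmax_geP; right => /=.
by exists (0, i).
Qed.

Lemma nbhs_eball x A : nbhs x A <-> exists2 e, 0 < e & eball x e `<=` A.
Proof.
split=> [/nbhs_ballP[e /= e0 eA]|[e e0 eA]].
  exists e => // y xy; apply: eA; rewrite mx_norm_ball /ball_ /= distrC.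
  exact: le_lt_trans (mx_norm_le_enorm _) xy.
(* [n%:R + 1] instead of [n%:R] keeps the radius positive when [n = 0]. *)
apply/nbhs_ballP; exists (e / (n%:R + 1)) => /=.
  by rewrite divr_gt0// ltr_wpDl.
move=> y; rewrite mx_norm_ball /ball_ /= distrC => yx; apply: eA.
rewrite /eball /=; apply: le_lt_trans (enorm_le_mx_norm _) _.
move: yx; rewrite ltr_pdivlMr ?ltr_wpDl//; apply: le_lt_trans.
by rewrite mulrC ler_wpM2l// lerDl.
Qed.

Lemma near_eball x (P : 'rV[R]_n -> Prop) :
  (\forall y \near x, P y) <-> exists2 e, 0 < e & forall y, eball x e y -> P y.
Proof. exact: nbhs_eball. Qed.

Lemma interior_eball A x : interior A x <-> exists2 e, 0 < e & eball x e `<=` A.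
Proof. exact: nbhs_eball. Qed.

Lemma closure_eball A x :
  closure A x <-> forall e : R, 0 < e -> exists2 y, A y & enorm (y - x) < e.
Proof.
split=> [cA e e0|cA B /nbhs_eball[e e0 eB]].
  have /cA[y [Ay xy]] : nbhs x (eball x e) by apply/nbhs_eball; exists e.
  by exists y.
by have [y Ay yx] := cA _ e0; exists y; split=> //; exact: eB.
Qed.

Lemma enorm_center x : enorm (x - x) = 0.
Proof. by rewrite subrr enorm0. Qed.

Definition cont_on K (g : 'rV[R]_n -> R) := forall x, K x -> forall e, 0 < e ->
  exists2 d : R, 0 < d & forall y, K y -> enorm (y - x) < d -> `|g y - g x| < e.

Lemma cont_onP K g : {within K, continuous g} <-> cont_on K g.
Proof.
split=> [/subspace_continuousP cg x Kx e e0|cg].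
  have /cvgrPdist_lt/(_ _ e0) := cg _ Kx.
  rewrite near_withinE => /near_eball[d d0 dK]; exists d => // y Ky yx.
  by rewrite distrC; exact: dK.
apply/subspace_continuousP => x Kx; apply/cvgrPdist_lt => e e0.
have [d d0 dK] := cg x Kx e e0.
rewrite near_withinE; apply/near_eball; exists d => // y yx Ky.
by rewrite distrC; exact: dK.
Qed.

Lemma cont_onW K K' g : K' `<=` K -> cont_on K g -> cont_on K' g.
Proof.
move=> KK cg x Kx e e0; have [d d0 dK] := cg x (KK _ Kx) e e0.
by exists d => // y /KK; exact: dK.
Qed.

Lemma cont_onD K g h : cont_on K g -> cont_on K h ->
  cont_on K (fun x => g x + h x).
Proof.
move=> cg ch x Kx e e0; have e2 : 0 < e / 2 by lra.
have [d d0 dg] := cg x Kx _ e2; have [d' d'0 dh] := ch x Kx _ e2.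
exists (Num.min d d') => [|y Ky]; first by rewrite lt_min d0.
rewrite lt_min => /andP[yd yd'].
have := ler_normD (g y - g x) (h y - h x); have := dg y Ky yd.
by have := dh y Ky yd'; rewrite opprD addrACA; lra.
Qed.

Lemma cont_onN K g : cont_on K g -> cont_on K (fun x => - g x).
Proof.
move=> cg x Kx e e0; have [d d0 dg] := cg x Kx _ e0; exists d => // y Ky yx.
by rewrite -opprD normrN; exact: dg.
Qed.

Lemma cont_onB K g h : cont_on K g -> cont_on K h ->
  cont_on K (fun x => g x - h x).
Proof. by move=> cg ch; apply: cont_onD => //; exact: cont_onN. Qed.

Lemma cont_on_max0 K g : cont_on K g -> cont_on K g^\+.
Proof.
move=> cg x Kx e e0; have [d d0 dg] := cg x Kx _ e0; exists d => // y Ky yx.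
apply: le_lt_trans (dg y Ky yx); rewrite /funrpos.
by case: (leP (g y) 0); case: (leP (g x) 0) => gx gy; rewrite ?subrr;
  [rewrite normr0|rewrite !ler0_norm; lra|rewrite !ger0_norm; lra|].
Qed.

Lemma lipschitz_cont_on K g c :
  (forall x y, K x -> K y -> g y - g x <= c * enorm (y - x)) -> cont_on K g.
Proof.
move=> lg x Kx e e0; exists (e / (`|c| + 1)).
  by rewrite divr_gt0// ltr_wpDl.
move=> y Ky; rewrite ltr_pdivlMr ?ltr_wpDl// => yx.
have cn : c * enorm (y - x) <= enorm (y - x) * (`|c| + 1).
  rewrite mulrC ler_wpM2l ?enorm_ge0//.
  by have := ler_norm c; lra.
rewrite ltr_norml; have := lg _ _ Kx Ky; have := lg _ _ Ky Kx.
by rewrite enormB => *; apply/andP; split; lra.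
Qed.

Definition cball x r : set 'rV[R]_n := [set y | enorm (y - x) <= r].

Lemma cball_compact x r : compact (cball x r).
Proof.
apply: bounded_closed_compact.
  exists (enorm x + r); split; first by rewrite num_real.
  move=> M xM y /= yx; apply: (le_trans (mx_norm_le_enorm y)).
  by have := enormD (y - x) x; rewrite subrK; move: yx; rewrite /cball /=; lra.
move=> y /closure_eball cy; rewrite /cball /= leNgt; apply/negP => yr.
have [|z zr] := cy (enorm (y - x) - r); first by rewrite subr_gt0.
have := enormD3 y z x; rewrite (enormB y z); move: zr; rewrite /cball /=; lra.
Qed.

Lemma evt_max K g x r : K !=set0 -> closed K -> K `<=` cball x r ->
  cont_on K g -> exists2 m, K m & forall y, K y -> g y <= g m.
Proof.
move=> K0 cK Kx /cont_onP cg.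
have cpK : compact K by apply: subclosed_compact Kx => //; exact: cball_compact.
have [m /set_mem Km mK] := EVT_max_rV K0 cpK cg.
by exists m => // y Ky; apply: mK; rewrite inE.
Qed.

Lemma cont_on_enormB K z : cont_on K (fun x => enorm (x - z)).
Proof.
apply: (@lipschitz_cont_on _ _ 1) => x y _ _; rewrite mul1r.
by have := enormD3 y x z; lra.
Qed.

Lemma closed_superlevel K g s : closed K -> cont_on K g ->
  closed (K `&` [set x | s <= g x]).
Proof.
move=> cK cg y cy.
have Ky : K y by apply: cK; apply: closure_subset cy; exact: subIsetl.
split=> //=; rewrite leNgt; apply/negP => ys.
have [|d d0 dg] := cg y Ky (s - g y); first by rewrite subr_gt0.
have /closure_eball/(_ _ d0)[z [Kz zs] zy] := cy.
by have := dg z Kz zy; rewrite ltr_norml; move: zs => /= zs /andP[]; lra.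
Qed.

Lemma closed_cball x r : closed (cball x r).
Proof. by apply: compact_closed; [exact: norm_hausdorff|exact: cball_compact]. Qed.

Lemma evt_cball x r g : 0 <= r -> cont_on (cball x r) g ->
  exists2 m, cball x r m & forall y, cball x r y -> g y <= g m.
Proof.
move=> r0 cg; apply: (@evt_max _ _ x r) => //; last exact: closed_cball.
by exists x; rewrite /cball /= subrr enorm0.
Qed.

End Dot.

(** * Ellipticity and quadratic test functions *)

Section QuadraticForm.
Context {R : realType} {n : nat}.
Implicit Types (x y v w p : 'rV[R]_n) (a c r s t : R) (M X Y Z : 'M[R]_n).

Definition qf M v : R := dot (v *m M) v.

Lemma qfD M X v : qf (M + X) v = qf M v + qf X v.
Proof. by rewrite /qf mulmxDr dotDl. Qed.

Lemma qfZ a M v : qf (a *: M) v = a * qf M v.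
Proof. by rewrite /qf -scalemxAr dotZl. Qed.

Lemma qfN M v : qf (- M) v = - qf M v.
Proof. by rewrite -scaleN1r qfZ mulN1r. Qed.

Lemma qf_scalar a v : qf a%:M v = a * dot v v.
Proof. by rewrite /qf mul_mx_scalar dotZl. Qed.

Lemma qf_outer x v : qf (x^T *m x) v = dot x v ^+ 2.
Proof.
rewrite /qf mulmxA -/(dot v x) (_ : v *m x^T = (dot v x)%:M).
  by rewrite mul_scalar_mx dotZl (dotC v) expr2.
by apply/rowP => i; rewrite ord1 [RHS]mxE mulr1n.
Qed.

Lemma qfvZ M a v : qf M (a *: v) = a ^+ 2 * qf M v.
Proof. by rewrite /qf -scalemxAl dotZl dotZr; ring. Qed.

Lemma qfvN M v : qf M (- v) = qf M v.
Proof. by rewrite -scaleN1r qfvZ sqrrN expr1n mul1r. Qed.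

Lemma qfvD M v w : M \is symmetricmx ->
  qf M (v + w) = qf M v + qf M w + 2 * dot (v *m M) w.
Proof. by move=> sM; rewrite /qf mulmxDl !dotS (dot_sym w v sM); ring. Qed.

Lemma qf_delta M i : qf M (delta_mx 0 i) = M i i.
Proof.
rewrite /qf -rowE dotE (bigD1 i)//= big1 ?addr0.
  by rewrite !mxE !eqxx mulr1.
by move=> j ji; rewrite !mxE (negPf ji) andbF mulr0.
Qed.

Lemma dot_delta v i : dot v (delta_mx 0 i) = v 0 i.
Proof.
rewrite dotE (bigD1 i)//= big1 ?addr0; first by rewrite mxE !eqxx mulr1.
by move=> j ji; rewrite !mxE (negPf ji) andbF mulr0.
Qed.

Lemma symmetricD X Y : X \is symmetricmx -> Y \is symmetricmx ->
  X + Y \is symmetricmx.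
Proof. by rewrite !symmetricP raddfD/= => -> ->. Qed.

Lemma symmetricZ a X : X \is symmetricmx -> a *: X \is symmetricmx.
Proof. by rewrite !symmetricP linearZ/= => ->. Qed.

Lemma symmetricN X : X \is symmetricmx -> - X \is symmetricmx.
Proof. by rewrite !symmetricP raddfN/= => ->. Qed.

Lemma symmetric_scalar a : (a%:M : 'M[R]_n) \is symmetricmx.
Proof. by rewrite symmetricP tr_scalar_mx. Qed.

Lemma symmetric_outer x : x^T *m x \is symmetricmx.
Proof. by rewrite symmetricP trmx_mul trmxK. Qed.

Lemma mxtrace_outer x : \tr (x^T *m x) = dot x x.
Proof. by rewrite mxtrace_mulC /mxtrace big_ord1. Qed.

(** With [w = v *m X], the polynomial [t |-> qf X (v + t *: w)] is nonnegative and has no constant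
    term, so its linear coefficient [2 * dot w w] must vanish. *)
Lemma psd_qf0 X v : psd X -> qf X v = 0 -> v *m X = 0.
Proof.
move=> [sX X0] v0; apply/eqP; rewrite -dot_eq0; apply/eqP; set w := v *m X.
have h t : 0 <= 2 * t * dot w w + t ^+ 2 * qf X w.
  have := X0 (v + t *: w); rewrite -/(qf X _) qfvD// v0 add0r qfvZ dotZr -/w.
  by rewrite addrC mulrA.
apply/eqP; rewrite eq_le dot_ge0 andbT leNgt; apply/negP => w0.
have q0 : 0 <= qf X w by exact: X0.
have := h (- (dot w w / (qf X w + 1))); apply/negP; rewrite -ltNge.
rewrite (_ : _ + _ = (dot w w)^+2 / (qf X w + 1) *
  (qf X w / (qf X w + 1) - 2)); last by field; lra.
rewrite pmulr_rlt0 ?subr_lt0 ?ltr_pdivrMr; try lra.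
by rewrite divr_gt0 ?exprn_gt0//; lra.
Qed.

(** On the range of [N] the form of [P] vanishes, because [N *m P = 0]. Testing [X >= 0] there makes
    the form of [N] vanish too, and [psd_qf0] turns this into [N = 0]. *)
Lemma psd_pos_neg_parts X PN : psd X -> is_pos_neg_parts X PN -> PN = (X, 0).
Proof.
case: PN => P N pX [/= [sP P0] pN PN0 XE]; have [sN N0] := pN.
suff N00 : N = 0 by rewrite XE N00 subr0.
have NP0 : N *m P = 0.
  by move/symmetricP: sP sN => <- /symmetricP <-; rewrite -trmx_mul PN0 trmx0.
apply/row_matrixP => i; rewrite row0; set v := delta_mx 0 i : 'rV[R]_n.
suff w0 : (v *m N) *m N = 0.
  apply/eqP; rewrite rowE -/v -dot_eq0 dot_mulmxl; move/symmetricP: sN => ->.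
  by rewrite w0 dot0r.
apply: psd_qf0 => //; apply/eqP; rewrite eq_le.
apply/andP; split; last exact: N0.
have [_ /(_ (v *m N))] := pX; rewrite XE -/(qf _ _) qfD qfN.
by rewrite {1}/qf -mulmxA NP0 mulmx0 dot0l add0r oppr_ge0.
Qed.

Lemma psd_pos_neg_partsE X : psd X -> pos_neg_parts X = (X, 0).
Proof.
move=> pX; apply: psd_pos_neg_parts => //; rewrite /pos_neg_parts.
apply: (@xgetPex _ (0, 0) (is_pos_neg_parts X)).
exists (X, 0); split => //=; rewrite ?mulmx0 ?subr0//.
split; first by rewrite symmetricP trmx0.
by move=> v; rewrite mulmx0 dot0l.
Qed.

(** For a nonnegative increment both Pucci operators are multiples of the trace. Every later use of
    ellipticity goes through this case. *)
Lemma elliptic_psd lam Lam (F : 'M[R]_n -> R) X Z : uniformly_elliptic lam Lam F ->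
  X \is symmetricmx -> psd Z ->
  lam * \tr Z <= F (X + Z) - F X <= Lam * \tr Z.
Proof.
move=> [_ eF] sX pZ; have [sZ _] := pZ.
have := eF _ _ (symmetricD sX sZ) sX; rewrite addrAC subrr add0r.
by rewrite /pucci_min /pucci_max /mxpos /mxneg psd_pos_neg_partsE//=
  mxtrace0 !mulr0 !subr0.
Qed.

(** Testing [X] on the vectors [e_j delta_i - e_i delta_j] bounds each term of [qf X e] by diagonal
    entries; summing over [i] and [j] produces the trace because [|e| = 1]. *)
Lemma psd_qf_le_mxtrace X e : psd X -> dot e e = 1 -> qf X e <= \tr X.
Proof.
move=> [sX X0] e1.
have entry i j : 2 * (e 0 i * e 0 j * X i j) <=
    X i i * e 0 j ^+ 2 + X j j * e 0 i ^+ 2.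
  have := X0 (e 0 j *: delta_mx 0 i - e 0 i *: delta_mx 0 j).
  rewrite -/(qf _ _) qfvD// qfvN !qfvZ !qf_delta -scalemxAl !dotS dot_delta.
  by rewrite -rowE mxE; lra.
have : \sum_i \sum_j 2 * (e 0 i * e 0 j * X i j) <=
    \sum_i \sum_j (X i i * e 0 j ^+ 2 + X j j * e 0 i ^+ 2).
  by apply: ler_sum => i _; apply: ler_sum.
have -> : \sum_i \sum_j 2 * (e 0 i * e 0 j * X i j) = 2 * qf X e.
  rewrite /qf dotE mulr_sumr exchange_big; apply: eq_bigr => j _ /=.
  rewrite mxE mulr_suml mulr_sumr; apply: eq_bigr => i _; ring.
have E2 : \sum_i e 0 i ^+ 2 = 1.
  by rewrite -e1 dotE; apply: eq_bigr => i _; rewrite expr2.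
have -> : \sum_i \sum_j (X i i * e 0 j ^+ 2 + X j j * e 0 i ^+ 2) = 2 * \tr X.
  under eq_bigr => i _.
    rewrite big_split /= -mulr_sumr E2 mulr1 -mulr_suml -/(\tr X).
  over.
  by rewrite big_split /= -mulr_sumr E2 mulr1 -/(\tr X); ring.
by rewrite ler_pM2l.
Qed.

(** [X] and [Y] are joined by nonnegative increments to the common matrix [X + W = Y + k I]. The
    trace of [W] is at least its value at [e], which is large when [X - Y] is very negative in the
    direction [e]. *)
Lemma elliptic_diff lam Lam (F : 'M[R]_n -> R) X Y k e :
  uniformly_elliptic lam Lam F -> 0 <= lam ->
  X \is symmetricmx -> Y \is symmetricmx -> 0 <= k ->
  (forall v, qf X v - qf Y v <= k * dot v v) -> dot e e = 1 ->
  F X - F Y <= n%:R * Lam * k - lam * (k - (qf X e - qf Y e)).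
Proof.
move=> eF lam0 sX sY k0 XYk e1; set W := k%:M - (X - Y).
have pW : psd W.
  split; first by rewrite symmetricD// ?symmetric_scalar// symmetricN//
    symmetricD// symmetricN.
  move=> v; rewrite -/(qf W v) /W qfD qf_scalar qfN qfD qfN.
  by have := XYk v; lra.
have pk : psd (k%:M : 'M[R]_n).
  split; first exact: symmetric_scalar.
  by move=> v; rewrite -/(qf _ v) qf_scalar mulr_ge0// dot_ge0.
have /andP[+ _] := elliptic_psd eF sX pW.
have /andP[_ +] := elliptic_psd eF sY pk.
have -> : X + W = Y + k%:M by rewrite /W opprB addrCA [X + _]addrC addrNK addrC.
rewrite mxtrace_scalar => h1 h2.
have h3 : lam * qf W e <= lam * \tr W.
  by rewrite ler_wpM2l//; exact: psd_qf_le_mxtrace.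
have WE : qf W e = k - (qf X e - qf Y e).
  by rewrite /W qfD qf_scalar qfN qfD qfN e1 mulr1.
by move: h1 h2 h3; rewrite WE -[k *+ n]mulr_natl; lra.
Qed.

Lemma elliptic_rank_one lam Lam (F : 'M[R]_n -> R) x c1 c2 :
  uniformly_elliptic lam Lam F -> F 0 = 0 -> 0 <= c1 -> 0 <= c2 ->
  lam * (c2 * dot x x) - n%:R * Lam * c1 <= F (c2 *: (x^T *m x) - c1%:M).
Proof.
move=> eF F0 c10 c20.
have p1 : psd (c1%:M : 'M[R]_n).
  split; first exact: symmetric_scalar.
  by move=> v; rewrite -/(qf _ v) qf_scalar mulr_ge0// dot_ge0.
have p2 : psd (c2 *: (x^T *m x)).
  split; first by rewrite symmetricZ// symmetric_outer.
  by move=> v; rewrite -/(qf _ v) qfZ qf_outer mulr_ge0// sqr_ge0.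
have s1 : - (c1%:M : 'M[R]_n) \is symmetricmx by rewrite symmetricN// symmetric_scalar.
have /andP[+ _] := elliptic_psd eF s1 p2.
have /andP[_ +] := elliptic_psd eF s1 p1.
rewrite addNr F0 mxtrace_scalar mxtraceZ mxtrace_outer.
by rewrite [- _ + _]addrC -[c1 *+ n]mulr_natl; lra.
Qed.

End QuadraticForm.

Section QuadraticTest.
Context {R : realType} {n : nat}.
Implicit Types (x y v p : 'rV[R]_n) (X : 'M[R]_n) (g u f : 'rV[R]_n -> R).

Lemma is_derive_quadratic g y v (l m : R) :
  (forall t, g (y + t *: v) = g y + t * l + t ^+ 2 * m) -> is_derive y v g l.
Proof.
move=> gE.
suff cv : (fun h => h^-1 *: ((g \o shift y) (h *: v) - g y)) @ 0^' --> l.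
  by split; [exact: cvgP cv|exact: cvg_lim cv].
apply/cvgrPdist_lt => e e0.
have m0 : 0 < `|m| + 1 by rewrite ltr_wpDl.
near=> t.
have t0 : t != 0 by near: t; exact: nbhs_dnbhs_neq.
rewrite /= [t *: v + y]addrC gE (_ : _ - g y = t * l + t ^+ 2 * m); last by ring.
rewrite /GRing.scale/= (_ : l - _ = - (t * m)); last by field.
rewrite normrN normrM.
have te : `|t| < e / (`|m| + 1).
  near: t; apply: dnbhs0_lt; exact: divr_gt0.
move: te; rewrite ltr_pdivlMr// mulrDr mulr1; apply: le_lt_trans.
by rewrite lerDl.
Unshelve. all: by end_near.
Qed.

Definition quadratic x p X y : R := dot p (y - x) + qf X (y - x) / 2.

Lemma partial_quadratic x p X i y : X \is symmetricmx ->
  is_derive y (evec i) (quadratic x p X) ((p + (y - x) *m X) 0 i).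
Proof.
move=> sX; apply: (@is_derive_quadratic _ _ _ _ (X i i / 2)) => t.
rewrite /quadratic (addrAC y) mxE; move: (y - x) => w.
rewrite qfvD// qfvZ dotDr !dotZr /evec qf_delta !dot_delta.
by field.
Qed.

Lemma partial_quadraticE x p X i : X \is symmetricmx ->
  partial i (quadratic x p X) = fun y => (p + (y - x) *m X) 0 i.
Proof.
move=> sX; apply/funext => y; rewrite /partial.
by have [] := partial_quadratic x p i y sX.
Qed.

Lemma partial2_quadratic x p X i j y :
  is_derive y (evec j) (fun y => (p + (y - x) *m X) 0 i) (X j i).
Proof.
apply: (@is_derive_quadratic _ _ _ _ 0) => t.
rewrite (addrAC y) mulmxDl -scalemxAl -rowE addrA !mxE mulr0 addr0.
by [].
Qed.

Lemma continuous_affine_coord x p X i :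
  continuous (fun y => (p + (y - x) *m X) 0 i : R).
Proof.
suff c : cont_on setT (fun y => (p + (y - x) *m X) 0 i : R).
  by move/cont_onP: c => c y; move: (c y); rewrite /continuous_at
    nbhs_subspaceT.
apply: (@lipschitz_cont_on _ _ _ _ (enorm (row i X^T))) => y z _ _.
rewrite !mxE [p 0 i + _]addrC addrKA -[leLHS]/(_ - _).
have E w : \sum_j (w - x) 0 j * X j i = dot (row i X^T) (w - x).
  by rewrite dotE; apply: eq_bigr => j _; rewrite !mxE mulrC.
rewrite !E -dotBr (_ : z - x - (y - x) = z - y).
  exact: cauchy_schwarz.
by rewrite opprB addrA subrK.
Qed.

Lemma C2_quadratic O x p X : X \is symmetricmx -> C2_in O (quadratic x p X).
Proof.
move=> sX; split=> [y _ i|i].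
  split; first by have [] := partial_quadratic x p i y sX.
  by rewrite partial_quadraticE//; exact: continuous_affine_coord.
move=> y _ j; rewrite partial_quadraticE//; split.
  by have [] := partial2_quadratic x p X i j y.
have -> : partial j (fun y => (p + (y - x) *m X) 0 i) = cst (X j i).
  by apply/funext => z; rewrite /partial; have [] := partial2_quadratic x p X i j z.
exact: cst_continuous.
Qed.

Lemma grad_quadratic x p X : X \is symmetricmx -> grad (quadratic x p X) x = p.
Proof.
move=> sX; apply/rowP => i; rewrite mxE partial_quadraticE//.
by rewrite subrr mul0mx addr0.
Qed.

Lemma hess_quadratic x p X : X \is symmetricmx -> hess (quadratic x p X) x = X.
Proof.
move=> sX; apply/matrixP => i j; rewrite mxE partial_quadraticE// /partial.
by have [] := partial2_quadratic x p X j i x.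
Qed.

Lemma quadratic_center x p X : quadratic x p X x = 0.
Proof. by rewrite /quadratic subrr dot0r /qf mul0mx dot0l mul0r addr0. Qed.

Lemma exists_small_descent (a b r : R) : 0 < a -> 0 < r ->
  exists s, [/\ 0 < s, s <= r & - (s * a) + s ^+ 2 * b < 0].
Proof.
move=> a0 r0; have b0 : 0 < `|b| + 1 by rewrite ltr_wpDl.
exists (Num.min r (a / (`|b| + 1) / 2)); split; last 1 first.
- set s := Num.min _ _.
  have s0 : 0 < s by rewrite lt_min r0/= !divr_gt0.
  have : s <= a / (`|b| + 1) / 2 by rewrite ge_min lexx orbT.
  rewrite !ler_pdivlMr// => sa; have sb : s * b <= s * (`|b| + 1).
    by rewrite ler_wpM2l ?ltW//; have := ler_norm b; lra.
  by rewrite (_ : _ + _ = s * (s * b - a)) ?pmulr_rlt0//; [lra|ring].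
- by rewrite lt_min r0/= !divr_gt0.
- by rewrite ge_min lexx.
Qed.

(** The alternative of a locally constant [u] is impossible here: a short step against [p] makes the
    paraboloid strictly smaller than that constant. For supersolutions the step is taken along
    [p]. *)
Lemma visc_sub_quadratic O alpha F f u x p X r :
  visc_subsolution O alpha F f u -> O x -> X \is symmetricmx -> p != 0 ->
  0 < r ->
  (forall v, enorm v <= r -> u (x + v) <= u x + dot p v + qf X v / 2) ->
  f x <= enorm p `^ alpha * F X.
Proof.
move=> [_ su] Ox sX p0 r0 touch; have [[d [c [d0 dO uc]]]|sub] := su x Ox.
  have p_gt0 : 0 < enorm p by rewrite enorm_gt0.
  have pp0 : 0 < dot p p by rewrite dot_gt0.
  have [s [s0 sr]] := @exists_small_descent (dot p p) (qf X p / 2)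
    (Num.min r (d / 2) / enorm p) pp0 ltac:(by rewrite divr_gt0 ?lt_min ?r0/= ?divr_gt0).
  rewrite mulrA => neg.
  have sE : enorm (- s *: p) = s * enorm p by rewrite enormZ normrN gtr0_norm.
  move: sr; rewrite ler_pdivlMr// le_min => /andP[sr sd].
  have := touch (- s *: p); rewrite sE => /(_ sr).
  have [-> _] : u (x + - s *: p) = c /\ 0 <= 0 :> R.
    split=> //; have [] // := uc (x + - s *: p).
    by rewrite /eball /= addrAC subrr add0r sE; lra.
  have [-> _] := uc x ltac:(by rewrite /eball /= subrr enorm0).
  rewrite dotZr qfvZ sqrrN; lra.
rewrite -{1}(grad_quadratic x p sX) -[X in F X](hess_quadratic x p sX).
apply: sub; first exact: C2_quadratic; last by rewrite grad_quadratic.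
apply/near_eball; exists r => // y yx.
have := touch (y - x) (ltW yx); rewrite (addrC x) subrK quadratic_center /quadratic.
by lra.
Qed.

Lemma visc_super_quadratic O alpha F f u x p X r :
  visc_supersolution O alpha F f u -> O x -> X \is symmetricmx -> p != 0 ->
  0 < r ->
  (forall v, enorm v <= r -> u x + dot p v + qf X v / 2 <= u (x + v)) ->
  enorm p `^ alpha * F X <= f x.
Proof.
move=> [_ su] Ox sX p0 r0 touch; have [[d [c [d0 dO uc]]]|super] := su x Ox.
  have p_gt0 : 0 < enorm p by rewrite enorm_gt0.
  have pp0 : 0 < dot p p by rewrite dot_gt0.
  have [s [s0 sr]] := @exists_small_descent (dot p p) (- (qf X p / 2))
    (Num.min r (d / 2) / enorm p) pp0 ltac:(by rewrite divr_gt0 ?lt_min ?r0/= ?divr_gt0).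
  rewrite mulrN mulrA => neg.
  have sE : enorm (s *: p) = s * enorm p by rewrite enormZ gtr0_norm.
  move: sr; rewrite ler_pdivlMr// le_min => /andP[sr sd].
  have := touch (s *: p); rewrite sE => /(_ sr).
  have [-> _] : u (x + s *: p) = c /\ 0 <= 0 :> R.
    split=> //; have [] // := uc (x + s *: p).
    by rewrite /eball /= addrAC subrr add0r sE; lra.
  have [-> _] := uc x ltac:(by rewrite /eball /= subrr enorm0).
  rewrite dotZr qfvZ; lra.
rewrite -{1}(grad_quadratic x p sX) -[X in F X](hess_quadratic x p sX).
apply: super; first exact: C2_quadratic; last by rewrite grad_quadratic.
apply/near_eball; exists r => // y yx.
have := touch (y - x) (ltW yx); rewrite (addrC x) subrK quadratic_center /quadratic.
by lra.
Qed.

End QuadraticTest.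

(** * Semiconvex functions *)

Section Barrier.
Context {R : realType} {n : nat}.
Implicit Types (x y z v p : 'rV[R]_n) (A B M : 'M[R]_n) (w : 'rV[R]_n -> R)
  (r s t d e k : R).

(** Half of the exact second order coefficient [q (q - 1) / 2] survives on the whole half-line
    [q y <= 1], negative [y] included; giving up the other half makes the induction close. *)
Lemma bernoulli2 (q : nat) (y : R) : q%:R * y <= 1 ->
  1 - q%:R * y + q%:R * (q%:R - 1) / 4 * y ^+ 2 <= (1 - y) ^+ q.
Proof.
elim: q => [|q IH]; first by rewrite expr0 !mul0r; lra.
rewrite -natr1 => qy; have q0 : 0 <= q%:R :> R by [].
have y1 : 0 <= 1 - y by case: (lerP 0 y) => y0; nra.
have {}IH := ler_wpM2l y1 (IH ltac:(case: (lerP 0 y) => y0; nra)).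
rewrite [leRHS]exprS; apply: le_trans IH; rewrite -subr_ge0.
rewrite (_ : _ - _ = y ^+ 2 * (q%:R / 4 * (2 - (q%:R - 1) * y))); last by field.
rewrite mulr_ge0 ?sqr_ge0//; case: q => [|q] in q0 qy *; first by rewrite !mul0r.
rewrite mulr_ge0 ?divr_ge0//; move: qy; rewrite -natr1.
have : 0 <= q%:R :> R by []; by case: (lerP 0 y) => y0; nra.
Qed.

(** The exact gradient of [y |-> (T - |y|^2)^(q+2)]. The exponent is shifted by two so that second
    derivatives carry the power [q], without truncated subtraction. *)
Definition barrier_grad (q : nat) (T : R) x : 'rV[R]_n :=
  (- (2 * q.+2%:R * (T - dot x x) ^+ q.+1)) *: x.

Definition barrier_hess (q : nat) (T : R) x : 'M[R]_n :=
  (q.+2%:R * (T - dot x x) ^+ q) *: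
    (q.+1%:R *: (x^T *m x) - (4 * (T - dot x x))%:M).

Lemma barrier_hess_sym q T x : barrier_hess q T x \is symmetricmx.
Proof.
by rewrite symmetricZ// symmetricD ?symmetricN ?symmetric_scalar//
  symmetricZ// symmetric_outer.
Qed.

Lemma qf_barrier_hess q T x v : qf (barrier_hess q T x) v =
  q.+2%:R * (T - dot x x) ^+ q *
    (q.+1%:R * dot x v ^+ 2 - 4 * (T - dot x x) * dot v v).
Proof. by rewrite qfZ qfD qfN qfZ qf_outer qf_scalar. Qed.

Lemma mxtrace_barrier_hess q T x : \tr (barrier_hess q T x) =
  q.+2%:R * (T - dot x x) ^+ q *
    (q.+1%:R * dot x x - 4 * (T - dot x x) * n%:R).
Proof.
rewrite mxtraceZ raddfB/= mxtraceZ mxtrace_outer mxtrace_scalar.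
by rewrite -[_ *+ n]mulr_natr.
Qed.

(* The Hessian of [y |-> (T - |y|^2)^(q+2)] is
   [(q+2) tau^q (4 (q+1) x^T x - 2 tau I)]; [barrier_hess] is a smaller matrix,
   so that its second order expansion is a strict lower bound near [x]. *)
Lemma barrier_taylor q T x : dot x x < T ->
  exists2 r : R, 0 < r & forall v, enorm v <= r ->
    (T - dot x x) ^+ q.+2 + dot (barrier_grad q T x) v +
      qf (barrier_hess q T x) v / 2 <= (T - dot (x + v) (x + v)) ^+ q.+2.
Proof.
move=> xT; set t := T - dot x x; have t0 : 0 < t by rewrite subr_gt0.
have [Q [Q0 Q1 Q2]] : exists Q : R, [/\ 0 < Q, q.+1%:R = Q & q.+2%:R = Q + 1].
  by exists q.+1%:R; split=> //; rewrite natr1.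
have e0 := enorm_ge0 x; have d0 : 0 < (Q + 1) * (2 * enorm x + 1).
  by rewrite mulr_gt0//; lra.
(* For [|v| <= 1] the increment [s] of [|x|^2] is at most [(2 |x| + 1) |v|], so this radius gives
   [(q + 2) s <= t], the condition of [bernoulli2] at [s / t]. *)
exists (Num.min 1 (t / ((Q + 1) * (2 * enorm x + 1)))).
  by rewrite lt_min ltr01 divr_gt0.
move=> v; rewrite le_min ler_pdivlMr// => /andP[v1 vt].
have v0 := enorm_ge0 v; have vv := sqr_enorm v.
have cs := cauchy_schwarz x v.
have vv1 : dot v v <= enorm v by rewrite -vv expr2 ler_piMr.
set s := 2 * dot x v + dot v v.
have sq : (Q + 1) * s <= t.
  by apply: le_trans vt; rewrite [leRHS]mulrCA ler_pM2l /s; lra.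
have -> : T - dot (x + v) (x + v) = t * (1 - s / t).
  by rewrite !dotS (dotC v x) /s /t; field; rewrite -/t; lra.
have st : q.+2%:R * (s / t) <= 1 by rewrite Q2 mulrA ler_pdivrMr// mul1r.
have := ler_wpM2l (ltW (exprn_gt0 q.+2 t0)) (bernoulli2 st).
rewrite -exprMn; apply: le_trans.
rewrite /barrier_grad dotZl qf_barrier_hess -/t -subr_ge0.
rewrite Q1 Q2 !exprS; set u := t ^+ q.
have u0 : 0 < u by exact: exprn_gt0.
rewrite [leRHS](_ : _ =
    (Q + 1) * u * (Q * (s ^+ 2 / 4 - dot x v ^+ 2 / 2) + t * dot v v)); last first.
  by rewrite /s; field; lra.
apply: mulr_ge0; first by apply: mulr_ge0; lra.
(* The rank-one part loses at most a fourth power of [|v|], which the surplus [t |v|^2] left by the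
   enlarged identity part absorbs. *)
have s2 : - (dot v v ^+ 2 / 4) <= s ^+ 2 / 4 - dot x v ^+ 2 / 2.
  rewrite -subr_ge0 /s.
  rewrite (_ : _ - _ = (dot x v + dot v v) ^+ 2 / 2); last by field.
  by rewrite divr_ge0// sqr_ge0.
have := ler_wpM2l (ltW Q0) s2; have := dot_ge0 v => vv0.
suff : Q * dot v v ^+ 2 / 4 <= t * dot v v by lra.
have Qt : Q * dot v v <= t.
  apply: le_trans (ler_wpM2l (ltW Q0) vv1) _; apply: le_trans vt.
  rewrite mulrC; apply: ler_wpM2l => //.
  by have := mulr_ge0 (ltW Q0) e0; lra.
by rewrite expr2; nra.
Qed.

End Barrier.

Section Descent.
Context {R : realType} {n : nat}.
Implicit Types (x y z v p : 'rV[R]_n) (A B M : 'M[R]_n) (w : 'rV[R]_n -> R)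
  (r s t d e k : R).

Lemma cont_on_comp (K : set 'rV[R]_n) g (h : R -> R) :
  continuous h -> cont_on K g -> cont_on K (fun x => h (g x)).
Proof.
move=> ch cg x Kx e e0.
have /cvgrPdist_lt/(_ e e0)/nbhs_ballP[d /= d0 dh] := ch (g x).
have [d' d'0 dg] := cg x Kx d d0; exists d' => // y Ky yx.
by rewrite distrC; apply: dh; rewrite /ball /= distrC; exact: dg.
Qed.

(** Equivalent to the convexity of [x |-> w x + C / 2 * dot x x]. *)
Definition semiconvex (C : R) w := forall x y s, 0 <= s <= 1 ->
  w ((1 - s) *: x + s *: y) <=
    (1 - s) * w x + s * w y + C / 2 * s * (1 - s) * dot (x - y) (x - y).

Definition touches_above w z p A (r : R) := [/\ A \is symmetricmx, 0 < r &
  forall v, enorm v <= r -> w (z + v) <= w z + dot p v + qf A v / 2].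

(** A point [y] near [z] lies on a segment of length [1/2] starting at [z], at the small parameter
    [s = 2 |y - z|]. As [w <= 0] at the far end, [w y] stays close to [w z] from above, with a
    radius depending on [C] and [e] only. *)
Lemma semiconvex_below (C e : R) w z :
  0 <= C -> 0 < e -> semiconvex C w -> (forall y, enorm y <= 1 -> w y <= 0) ->
  enorm z <= 1 / 4 -> w z < - e ->
  forall y, enorm (y - z) <= Num.min (1 / 4) (2 * e / (C + 1)) / 2 ->
    w y <= - (e / 2).
Proof.
move=> C0 e0 scw w0 z4 we y; set s0 := Num.min _ _.
have C1 : 0 < C + 1 by lra.
have s00 : 0 < s0 by rewrite lt_min !divr_gt0//; lra.
have [->|yz] := eqVneq y z; first by move=> _; lra.
have yz0 : 0 < enorm (y - z) by rewrite enorm_gt0 subr_eq0.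
set s := 2 * enorm (y - z) => ys; have ss0 : s <= s0 by rewrite /s; lra.
have [s4 se] : s <= 1 / 4 /\ s * (C + 1) <= 2 * e.
  by move: ss0; rewrite le_min => /andP[s4]; rewrite ler_pdivlMr.
have s_gt0 : 0 < s by rewrite mulr_gt0.
pose v := s^-1 *: (y - z).
have v2 : dot v v = 1 / 4.
  by rewrite -sqr_enorm enormZ gtr0_norm ?invr_gt0// /s; field; lra.
have v12 : enorm v <= 1 / 2 by rewrite enorm_ler_sqr// v2; lra.
have := scw z (z + v) s; rewrite (_ : (1 - s) *: z + s *: (z + v) = y); last first.
  rewrite scalerDr addrA -scalerDl subrK scale1r /v scalerA divff ?gt_eqF//.
  by rewrite scale1r addrC subrK.
rewrite opprD addrA subrr sub0r dotNl dotNr opprK v2 => /(_ ltac:(lra)).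
have := w0 (z + v) ltac:(by have := enormD z v; lra); nra.
Qed.

(** Add to [w] a barrier centered at [z] on the annulus [s <= |y - z| <= 1/2]. The sum is positive
    at [0] but not on the two spheres: the barrier vanishes on the outer one, and on the inner one
    [w <= - e / 2] outweighs it. At an interior maximum [w] is touched from above by the opposite of
    the barrier, whose trace is negative enough to pay for [M] times the bound [t]. The gain [eta]
    does not depend on [w], as an iteration requires. *)
Lemma barrier_descent (C M e : R) : 0 <= C -> 0 <= M -> 0 < e ->
  exists2 eta : R, 0 < eta & forall w, semiconvex C w -> cont_on setT w ->
    w 0 = 0 -> (forall y, enorm y <= 1 -> w y <= 0) ->
    (exists2 z, enorm z <= 1 / 4 & w z < - e) ->
    exists z p B (t r : R), [/\ enorm z <= 1, touches_above w z p B r,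
      0 <= t, forall v, qf B v <= t * dot v v & \tr B + M * t <= - eta].
Proof.
move=> C0 M0 e0.
pose s : R := Num.min (1 / 4) (2 * e / (C + 1)) / 2.
have s_gt0 : 0 < s by rewrite divr_gt0// lt_min !divr_gt0//; lra.
have s8 : s <= 1 / 8.
  have : Num.min (1 / 4) (2 * e / (C + 1)) <= 1 / 4 by rewrite ge_min lexx.
  by rewrite /s; lra.
(* Outside the ball of radius [s] the rank-one part of the Hessian, of weight [q + 1], then exceeds
   the identity part and the term [M t] by a margin of [1]. *)
have [q qs] : exists q : nat, 4 * (n%:R + M) + 1 <= q.+1%:R * s ^+ 2.
  exists (Num.truncn ((4 * (n%:R + M) + 1) / s ^+ 2)).
  have := ltW (truncnS_gt ((4 * (n%:R + M) + 1) / s ^+ 2)).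
  by rewrite ler_pdivrMr ?exprn_gt0.
pose c := e / 2; have c0 : 0 < c by rewrite divr_gt0.
(* [1 - |y - z|^2 >= 3/4] on the annulus, which bounds the power [q] in the Hessian from below. *)
exists (c * (3 / 4) ^+ q); first by rewrite mulr_gt0// exprn_gt0.
move=> w scw cw w0 wneg [z z4 wz].
have below := semiconvex_below C0 e0 scw wneg z4 wz.
pose b (t : R) := c * ((1 - t ^+ 2) ^+ q.+2 - (3 / 4) ^+ q.+2).
have cb : continuous b.
  move=> t; apply: cvgM; first exact: cvg_cst.
  apply: cvgB; last exact: cvg_cst.
  apply: (@continuous_comp _ _ _ (fun t : R => 1 - t ^+ 2) (@GRing.exp R ^~ q.+2)).
    by apply: cvgB; [exact: cvg_cst|exact: exprn_continuous].
  exact: exprn_continuous.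
pose K : set 'rV[R]_n := cball z (1 / 2) `&` [set y | s <= enorm (y - z)].
have cG : cont_on K (fun y => w y + b (enorm (y - z))).
  apply: cont_onD; first exact: cont_onW cw.
  by apply: (@cont_on_comp K (fun y => enorm (y - z)) b cb); exact: cont_on_enormB.
have cK : closed K.
  by apply: closed_superlevel; [exact: closed_cball|exact: cont_on_enormB].
have K00 : K 0.
  split; first by rewrite /cball /= sub0r enormN; lra.
  rewrite /= leNgt; apply/negP => zs.
  by have := below 0 (ltW zs); rewrite w0; lra.
have [m [mz ms] mmax] := evt_max (ex_intro _ 0 K00) cK (@subIsetl _ _ _) cG.
have pw (t u : R) : 0 <= t -> t < u -> u <= 1 ->
    (1 - u ^+ 2) ^+ q.+2 < (1 - t ^+ 2) ^+ q.+2.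
  move=> t0 tu u1; rewrite ltrXn2r//; [by rewrite subr_ge0; nra|nra].
have P34 : (3 / 4 : R) = 1 - (1 / 2) ^+ 2 by field.
have G0 : 0 < w m + b (enorm (m - z)).
  apply: lt_le_trans (mmax _ K00); rewrite w0 add0r sub0r enormN /b.
  rewrite mulr_gt0// subr_gt0 P34 pw ?enorm_ge0//; lra.
have mz_lt : enorm (m - z) < 1 / 2.
  rewrite lt_neqAle mz andbT; apply/eqP => mzE; move: G0.
  rewrite mzE /b P34 subrr mulr0 addr0.
  have := wneg m; have := enormD (m - z) z; rewrite subrK mzE; lra.
have ms_lt : s < enorm (m - z).
  rewrite lt_neqAle ms andbT; apply/eqP => smE; move: G0.
  have := below m; rewrite -smE lexx => /(_ isT).
  have : (1 - s ^+ 2) ^+ q.+2 <= 1.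
    by rewrite exprn_ile1//; [nra|rewrite gerBl sqr_ge0].
  have : 0 < (3 / 4 : R) ^+ q.+2 by rewrite exprn_gt0.
  by rewrite /b /c; nra.
pose x := m - z; have x2 : dot x x = enorm (m - z) ^+ 2 by rewrite sqr_enorm.
have x1 : dot x x < 1 by rewrite x2; have := enorm_ge0 (m - z); nra.
have [r r0 rT] := barrier_taylor q x1.
pose r' := Num.min r (Num.min (1 / 2 - enorm (m - z)) (enorm (m - z) - s)).
exists m, ((- c) *: barrier_grad q 1 x), ((- c) *: barrier_hess q 1 x).
pose u := 1 - dot x x; have u0 : 0 < u by rewrite subr_gt0.
have u1 : u <= 1 by rewrite gerBl dot_ge0.
have u34 : 3 / 4 <= u by rewrite /u x2; have := enorm_ge0 (m - z); nra.
have q2 : 0 < q.+2%:R :> R by []; have q1 : 0 < q.+1%:R :> R by [].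
have uq : 0 < u ^+ q by exact: exprn_gt0.
have k0 : 0 < c * q.+2%:R * u ^+ q by rewrite !mulr_gt0.
exists (c * q.+2%:R * u ^+ q * (4 * u)), r'; split.
- by have := enormD (m - z) z; rewrite subrK; lra.
- split; first by rewrite symmetricZ// barrier_hess_sym.
    by rewrite !lt_min r0 !subr_gt0 mz_lt ms_lt.
  move=> v; rewrite !le_min => /andP[vr /andP[v1 v2]].
  have KV : K (m + v).
    have E : m + v - z = (m - z) + v by rewrite addrAC.
    split; rewrite /cball /= E; first by have := enormD (m - z) v; lra.
    by have := enormD (m - z + v) (- v); rewrite addrK enormN; lra.
  have := mmax _ KV; rewrite /b !sqr_enorm -/x.
  have -> : m + v - z = x + v by rewrite addrAC.
  have := ler_wpM2l (ltW c0) (rT v vr); rewrite (qfZ (- c)) (dotZl (- c)).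
  move: ((1 - dot x x) ^+ q.+2) ((1 - dot (x + v) (x + v)) ^+ q.+2).
  move: ((3 / 4) ^+ q.+2) => a b' d; lra.
- by apply: mulr_ge0; lra.
- move=> v; rewrite qfZ qf_barrier_hess -/u.
  have : 0 <= c * q.+2%:R * u ^+ q * (q.+1%:R * dot x v ^+ 2).
    by apply: mulr_ge0; [exact: ltW|rewrite mulr_ge0 ?sqr_ge0].
  move: (q.+2%:R : R) (q.+1%:R : R) (u ^+ q) => a b' d; lra.
- rewrite mxtraceZ mxtrace_barrier_hess -/u.
  have xs : s ^+ 2 <= dot x x by rewrite x2; nra.
  have bracket : 1 <= q.+1%:R * dot x x - 4 * u * (n%:R + M).
    have : q.+1%:R * s ^+ 2 <= q.+1%:R * dot x x by rewrite ler_wpM2l.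
    have : u * (n%:R + M) <= n%:R + M by rewrite ler_piMl// addr_ge0.
    by lra.
  have : c * (3 / 4) ^+ q <= c * q.+2%:R * u ^+ q.
    rewrite -mulrA ler_pM2l//.
    have : (3 / 4) ^+ q <= u ^+ q by rewrite lerXn2r ?nnegrE//; lra.
    have : 1 <= q.+2%:R :> R by rewrite ler1n.
    by move: uq; move: (q.+2%:R : R) (u ^+ q) ((3 / 4) ^+ q) => a d d' *; nra.
  have := ler_wpM2l (ltW k0) bracket; rewrite mulr1.
  by move: (q.+2%:R : R) (q.+1%:R : R) (u ^+ q) ((3 / 4) ^+ q) => *; lra.
Qed.

End Descent.

(** * Touching paraboloids that almost coincide with a semiconvex function *)

Section AlmostQuadratic.
Context {R : realType} {n : nat}.
Implicit Types (x y z v p : 'rV[R]_n) (A B M : 'M[R]_n) (w : 'rV[R]_n -> R)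
  (r s t d e k : R).

Lemma ler_small_slope (a b k r : R) : 0 < r ->
  (forall s, 0 < s -> s <= r -> a <= b + s * k) -> a <= b.
Proof.
move=> r0 h; apply/ler_addgt0Pr => e e0; have k0 : 0 < `|k| + 1 by rewrite ltr_wpDl.
pose s := Num.min r (e / (`|k| + 1)).
have s0 : 0 < s by rewrite lt_min r0 divr_gt0.
have := h s s0 ltac:(by rewrite ge_min lexx); move=> /le_trans; apply.
rewrite lerD2l; apply: (@le_trans _ _ (s * (`|k| + 1))).
  by rewrite ler_pM2l//; have := ler_norm k; lra.
by rewrite -ler_pdivlMr// ge_min lexx orbT.
Qed.

Lemma touches_above_scale w z p A r v : touches_above w z p A r ->
  exists2 r' : R, 0 < r' & forall s : R, 0 <= s <= r' -> enorm (s *: v) <= r.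
Proof.
move=> [_ r0 _]; have v0 := enorm_ge0 v.
exists (r / (enorm v + 1)); first by rewrite divr_gt0//; lra.
move=> s /andP[s0]; rewrite ler_pdivlMr; last lra.
by rewrite enormZ ger0_norm//; nra.
Qed.

(** [z] is a convex combination of [z + v] and [z - s v]. The paraboloid bounds [w] at the second
    point, and its quadratic term disappears as [s] tends to [0]: the slope [p] also supports [w]
    from below, globally. *)
Lemma semiconvex_support (C : R) w z p A r : semiconvex C w ->
  touches_above w z p A r ->
  forall v, w z + dot p v - C / 2 * dot v v <= w (z + v).
Proof.
move=> scw tw v; have [_ _ up] := tw.
have [r' r'0 sr'] := touches_above_scale (- v) tw.
apply: (@ler_small_slope _ _ (qf A v / 2 + C / 2 * dot v v) r') => // s s0 sr.
have s1 : 0 < 1 + s by lra.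
have := up (s *: - v) (sr' s ltac:(lra)).
rewrite qfvZ qfvN dotZr dotNr => us.
have := scw (z + v) (z + s *: - v) (1 + s)^-1.
have -> : (1 - (1 + s)^-1) *: (z + v) + (1 + s)^-1 *: (z + s *: - v) = z.
  rewrite !scalerDr addrACA -scalerDl subrK scale1r !scalerN scalerA.
  rewrite -scalerBl (_ : _ - _ = 0) ?scale0r ?addr0//.
  by field; lra.
have -> : z + v - (z + s *: - v) = (1 + s) *: v.
  by rewrite scalerN opprD opprK addrACA subrr add0r scalerDl scale1r.
rewrite invr_ge0 ltW//= => /(_ ltac:(by rewrite invf_le1//; lra)).
rewrite dotZl dotZr => ineq.
have : (1 + s) * w z <= s * w (z + v) + w (z + s *: - v) +
    C / 2 * s * (1 + s) * dot v v.
  rewrite -(@ler_pM2l _ (1 + s)) in ineq => //.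
  rewrite (_ : (1 + s) * (_ + _ + _) = s * w (z + v) + w (z + s *: - v) +
    C / 2 * s * (1 + s) * dot v v) in ineq => //.
  by field; lra.
have s2 : s != 0 by rewrite gt_eqF.
move=> h; rewrite -(@ler_pM2l _ s)//. lra.
Qed.

Lemma semiconvex_hess_ge (C : R) w z p A r : semiconvex C w ->
  touches_above w z p A r -> forall v, - (C * dot v v) <= qf A v.
Proof.
move=> scw tw v; have [_ _ up] := tw.
have [r' r'0 sr'] := touches_above_scale v tw.
have := up (r' *: v) (sr' r' ltac:(lra)).
have := semiconvex_support scw tw (r' *: v).
rewrite qfvZ !dotZl !dotZr => h1 h2.
rewrite -(@ler_pM2l _ (r' ^+ 2)) ?exprn_gt0//; lra.
Qed.

(** At [z + v], with [v] of length [d] along [p - p0], the lower support with slope [p] lies under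
    the upper paraboloid with slope [p0]; the mismatch [d |p - p0|] is therefore of second order in
    [d]. *)
Lemma touches_above_grad_close (C L d : R) w z p A r z0 p0 A0 r0 :
  0 <= C -> 0 <= L -> semiconvex C w ->
  touches_above w z p A r -> touches_above w z0 p0 A0 r0 ->
  (forall v, qf A0 v <= L * dot v v) ->
  0 < d -> 2 * d <= r0 -> enorm (z - z0) <= d -> enorm (p - p0) <= (2 * L + C) * d.
Proof.
move=> C0 L0 scw tw tw0 A0L d0 dr zd.
have [->|pp] := eqVneq p p0; first by rewrite subrr enorm0 mulr_ge0//; lra.
have e0 : 0 < enorm (p - p0) by rewrite enorm_gt0 subr_eq0.
pose v := (d / enorm (p - p0)) *: (p - p0).
have vd : enorm v = d.
  by rewrite enormZ gtr0_norm ?divr_gt0// divfK// gt_eqF.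
have vv : dot v v = d ^+ 2 by rewrite -sqr_enorm vd.
have pv : dot (p - p0) v = d * enorm (p - p0).
  by rewrite dotZr -sqr_enorm; field; rewrite gt_eqF.
have [_ _ up] := tw0.
have y2 : enorm (z - z0 + v) <= 2 * d by have := enormD (z - z0) v; lra.
have := up (z - z0 + v) (le_trans y2 dr); have := A0L (z - z0 + v).
have := semiconvex_support scw tw v; have := semiconvex_support scw tw0 (z - z0).
have -> : z0 + (z - z0 + v) = z + v by rewrite addrA [z0 + _]addrC subrK.
have -> : z0 + (z - z0) = z by rewrite addrC subrK.
rewrite (dotDr p0 (z - z0) v).
have zz : dot (z - z0) (z - z0) <= d ^+ 2.
  by rewrite -enorm_ler_sqr// ltW.
have yy : dot (z - z0 + v) (z - z0 + v) <= (2 * d) ^+ 2.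
  by rewrite -enorm_ler_sqr//; lra.
move: pv; rewrite dotBl vv => pv h1 h2 h3 h4.
rewrite -(@ler_pM2l _ d)//.
have := ler_wpM2l C0 zz; have := ler_wpM2l L0 yy; lra.
Qed.

Lemma qf_convex_comb A x y (s : R) : A \is symmetricmx ->
  qf A ((1 - s) *: x + s *: y) =
  (1 - s) * qf A x + s * qf A y - s * (1 - s) * qf A (x - y).
Proof.
move=> sA; rewrite !qfvD// qfvN !qfvZ dotNr -scalemxAl dotZl dotZr.
by ring.
Qed.

(** The excess of [w] over the paraboloid, with second order scaling: a paraboloid of Hessian [B]
    touching the blow-up gives one of Hessian [A + B] touching [w]. *)
Definition blow_up w z p A (r : R) : 'rV[R]_n -> R := fun v =>
  (w (z + r *: v) - w z - r * dot p v - r ^+ 2 * (qf A v / 2)) / r ^+ 2.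

Lemma blow_upK w z p A (r : R) v : r != 0 ->
  w (z + r *: v) = w z + r * dot p v + r ^+ 2 * (qf A v / 2) +
    r ^+ 2 * blow_up w z p A r v.
Proof. by move=> r0; rewrite /blow_up; field. Qed.

Lemma semiconvex_blow_up (C L : R) w z p A r : 0 < r -> semiconvex C w ->
  A \is symmetricmx -> (forall v, qf A v <= L * dot v v) ->
  semiconvex (C + L) (blow_up w z p A r).
Proof.
move=> r0 scw sA AL x y s s01; have r2 : 0 < r ^+ 2 by rewrite exprn_gt0.
have := scw (z + r *: x) (z + r *: y) s s01.
have -> : (1 - s) *: (z + r *: x) + s *: (z + r *: y) =
    z + r *: ((1 - s) *: x + s *: y).
  rewrite !scalerDr addrACA -scalerDl subrK scale1r !scalerA.
  by rewrite (mulrC r) (mulrC r).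
rewrite opprD addrACA subrr add0r -scalerBr dotZl dotZr.
have rn0 : r != 0 by rewrite gt_eqF.
rewrite !(@blow_upK w z p A r _ rn0) qf_convex_comb// (dotDr p) !(dotZr _ p).
have [s0 s1] : 0 <= s /\ 0 <= 1 - s by lra.
have := ler_wpM2l (mulr_ge0 s0 s1) (AL (x - y)) => h1 h2.
rewrite -(@ler_pM2l _ (r ^+ 2))//.
have := ler_wpM2l (ltW r2) h1; lra.
Qed.

Lemma mulmx_bounded M : exists2 k : R, 0 <= k & forall v, enorm (v *m M) <= k * enorm v.
Proof.
pose s := \sum_i \sum_j `|M i j|.
have s0 : 0 <= s by apply: sumr_ge0 => i _; apply: sumr_ge0.
exists (n%:R * s); first by rewrite mulr_ge0.
move=> v; rewrite -mulrA; apply: enorm_le_coord.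
  by rewrite mulr_ge0 ?enorm_ge0.
move=> j; rewrite mxE; apply: le_trans (ler_norm_sum _ _ _) _.
rewrite /s mulr_suml; apply: ler_sum => i _; rewrite normrM mulrC.
apply: ler_pM => //; last exact: coord_le_enorm.
by rewrite (bigD1 j)//= lerDl; apply: sumr_ge0.
Qed.

Lemma cont_on_affine w z (r : R) : 0 < r -> cont_on setT w ->
  cont_on setT (fun v => w (z + r *: v)).
Proof.
move=> r0 cw x _ e e0; have [d d0 dw] := cw (z + r *: x) I e e0.
exists (d / r); first exact: divr_gt0.
move=> y _; rewrite ltr_pdivlMr// => yx; apply: dw => //.
by rewrite opprD addrACA subrr add0r -scalerBr enormZ gtr0_norm// mulrC.
Qed.

Lemma cont_on_qf (c : R) A : cont_on setT (fun v => c * qf A v).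
Proof.
have [k k0 kA] := mulmx_bounded (A + A^T).
move=> x _ e e0; pose L := `|c| * (k * (2 * enorm x + 1)) + 1.
have L0 : 0 < L.
  by rewrite /L ltr_wpDl// mulr_ge0// mulr_ge0//; have := enorm_ge0 x; lra.
exists (Num.min 1 (e / L)); first by rewrite lt_min ltr01 divr_gt0.
move=> y _; rewrite lt_min ltr_pdivlMr// => /andP[y1 yL].
have E : 2 * (qf A y - qf A x) = dot ((x + y) *m (A + A^T)) (y - x).
  rewrite mulmxDr dotDl (dot_mulmxl _ A^T) trmxK !mulmxDl mulNmx !dotS.
  rewrite (dotC x (y *m A)) (dotC x (x *m A)) (dotC y (y *m A)) (dotC y (x *m A)).
  by rewrite /qf; ring.
have b : `|dot ((x + y) *m (A + A^T)) (y - x)| <=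
    k * (2 * enorm x + 1) * enorm (y - x).
  have h : enorm ((x + y) *m (A + A^T)) * enorm (y - x) <=
      k * (2 * enorm x + 1) * enorm (y - x).
    apply: ler_wpM2r; first exact: enorm_ge0.
    apply: le_trans (kA _) _; apply: ler_wpM2l => //.
    have := enormD (x + x) (y - x); rewrite -addrA [x + (y - x)]addrC subrK.
    by have := enormD x x; lra.
  rewrite ler_norml -lerN2 opprK.
  by rewrite (le_trans (cauchy_schwarzN _ _) h) (le_trans (cauchy_schwarz _ _) h).
rewrite -mulrBr normrM.
have -> : qf A y - qf A x = (2 * (qf A y - qf A x)) / 2 by field.
rewrite E normrM (ger0_norm (_ : 0 <= 2^-1))//.
have := ler_wpM2l (normr_ge0 c) b.
move: yL; rewrite /L; have := enorm_ge0 (y - x).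
have : 0 <= `|c| * `|dot ((x + y) *m (A + A^T)) (y - x)| by rewrite mulr_ge0.
lra.
Qed.

Lemma cont_on_dot (c : R) p : cont_on setT (fun v => c * dot p v).
Proof.
apply: (@lipschitz_cont_on _ _ _ _ (enorm (c *: p))) => x y _ _.
by rewrite -mulrBr -dotBr -dotZl cauchy_schwarz.
Qed.

Lemma cont_on_blow_up w z p A (r : R) : 0 < r -> cont_on setT w ->
  cont_on setT (blow_up w z p A r).
Proof.
move=> r0 cw; have r2 : 0 < r ^+ 2 by rewrite exprn_gt0.
have := cont_onB (cont_onB (cont_on_affine z r0 cw) (cont_on_dot r p))
  (cont_on_qf (r ^+ 2 / 2) A).
move=> c0 x _ e e0; have [d d0 dc] := c0 x I (e * r ^+ 2) ltac:(by rewrite mulr_gt0).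
exists d => // y _ yx; rewrite /blow_up -mulrBl normrM (gtr0_norm (_ : 0 < (r ^+ 2)^-1)) ?invr_gt0//.
rewrite ltr_pdivrMr//; apply: le_lt_trans (dc y I yx).
by rewrite le_eqVlt; apply/orP; left; apply/eqP; congr `|_|; field.
Qed.

(* Among the matrices [A] with [A <= A0 + t I] touching [w] from above near
   [z0], nearly minimize [tr A + m t]: at a near minimizer the rescaled
   difference with the touching paraboloid is nonpositive, vanishes at [0] and
   cannot be touched from above by a strict supersolution, so it is almost
   zero. *)
Lemma semiconvex_almost_quadratic (C L e d : R) w z0 p0 A0 r0 :
  0 <= C -> 0 <= L -> 0 < e -> 0 < d -> semiconvex C w -> cont_on setT w ->
  touches_above w z0 p0 A0 r0 -> (forall v, qf A0 v <= L * dot v v) ->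
  exists z p A r, [/\ enorm (z - z0) <= d, touches_above w z p A r,
    forall v, qf A v <= qf A0 v + e * dot v v &
    forall v, enorm v <= r ->
      w z + dot p v + qf A v / 2 - e * r ^+ 2 <= w (z + v)].
Proof.
move=> C0 L0 e0 d0 scw cw tw0 A0L.
pose e' := Num.min e 1; have e'0 : 0 < e' by rewrite lt_min e0 ltr01.
have [e'e e'1] : e' <= e /\ e' <= 1 by rewrite !ge_min !lexx orbT.
(* Semiconvexity gives [tr A >= - n C], so [tr A + m t <= n L] forces [t <= e'] with this weight. As
   [e' <= 1], all blow-ups share one semiconvexity constant and hence one [eta]. *)
pose m := (n%:R * (L + C) + 1) / e'.
have nLC : 0 <= n%:R * (L + C) by rewrite mulr_ge0// addr_ge0.
have m0 : 0 < m by rewrite divr_gt0// ltr_wpDl.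
have [eta eta0 step] := @barrier_descent R n (C + (L + 1)) m (e / 16)
  ltac:(lra) (ltW m0) ltac:(lra).
have trge z p A r : touches_above w z p A r -> - (n%:R * C) <= \tr A.
  move=> tw; rewrite (_ : - _ = \sum_(i < n) - C); last first.
    by rewrite sumr_const card_ord -[RHS]mulr_natl mulrN.
  apply: ler_sum => i _; rewrite -qf_delta.
  apply: le_trans (semiconvex_hess_ge scw tw _).
  by rewrite dot_delta mxE !eqxx mulr1.
(* Each descent lowers [tr A + m t] by at least [eta], and this quantity is at least [- n C]: [k]
   bounds the number of descents left. Halving [d'] at every descent keeps the points within [d] of
   [z0]. *)
have main (k : nat) : forall z p A r t d', 0 < d' -> touches_above w z p A r -> 0 <= t ->
    (forall v, qf A v <= qf A0 v + t * dot v v) ->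
    \tr A + m * t <= n%:R * L -> \tr A + m * t < - (n%:R * C) + k%:R * eta ->
  exists z' p' A' r', [/\ enorm (z' - z) <= d', touches_above w z' p' A' r',
    forall v, qf A' v <= qf A0 v + e * dot v v &
    forall v, enorm v <= r' ->
      w z' + dot p' v + qf A' v / 2 - e * r' ^+ 2 <= w (z' + v)].
  elim: k => [|k IH] z p A r t d' d'0 tw t0 At JL Jk.
    by have := trge _ _ _ _ tw; have := mulr_ge0 (ltW m0) t0; lra.
  have te' : t <= e'.
    have : m * t <= n%:R * (L + C) by have := trge _ _ _ _ tw; lra.
    rewrite /m mulrAC ler_pdivrMr// => h.
    rewrite -(@ler_pM2l _ (n%:R * (L + C) + 1)); last by rewrite ltr_wpDl.
    by apply: le_trans h _; apply: ler_wpM2r; lra.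
  have [sA r_gt0 up] := tw.
  have AL v : qf A v <= (L + 1) * dot v v.
    have := At v; have := A0L v; have := dot_ge0 v; nra.
  pose s := Num.min r (d' / 2); have s0 : 0 < s by rewrite lt_min r_gt0 divr_gt0.
  have [sr sd] : s <= r /\ s <= d' / 2 by rewrite !ge_min !lexx orbT.
  have sn0 : s != 0 by rewrite gt_eqF.
  have s2 : 0 < s ^+ 2 by rewrite exprn_gt0.
  have unscale v : exists v', v = s *: v'.
    by exists (s^-1 *: v); rewrite scalerA divff// scale1r.
  pose W := blow_up w z p A s.
  have WK v := @blow_upK w z p A s v sn0; rewrite -/W in WK.
  have W0 : W 0 = 0.
    rewrite /W /blow_up scaler0 addr0 /qf mul0mx !dot0r; field.
    exact/lt0r_neq0.
  have Wneg v : enorm v <= 1 -> W v <= 0.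
    move=> v1; have := up (s *: v); rewrite enormZ gtr0_norm// => /(_ ltac:(nra)).
    rewrite WK dotZr qfvZ => h; rewrite -(@ler_pM2l _ (s ^+ 2))// mulr0; lra.
  have [bad|good] := pselect (exists2 y, enorm y <= 1 / 4 & W y < - (e / 16)).
    have [y [q [B [tB [r1 [y1 [sB r10 Bup] tB0 BtB Bdec]]]]]] :=
      step _ (semiconvex_blow_up z p s0 scw sA AL)
        (cont_on_blow_up z p A s0 cw) W0 Wneg bad.
    have /IH : touches_above w (z + s *: y) (p + s *: (y *m A) + s *: q) (A + B) (s * r1).
      split; [exact: symmetricD|exact: mulr_gt0|] => v vr.
      have [v' vE] := unscale v.
      have v'r : enorm v' <= r1.
        by move: vr; rewrite vE enormZ gtr0_norm// ler_pM2l.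
      have := Bup v' v'r; rewrite -/W => h.
      rewrite vE -addrA -scalerDr !WK qfvD// dotDr !dotDl !dotZl !dotZr.
      rewrite (qfD A B) !qfvZ; have := ler_wpM2l (ltW s2) h; lra.
    move=> /(_ (t + tB) (d' / 2)) [||v|||z' [p' [A' [r' [z'z tw' A'e low]]]]].
    + lra.
    + lra.
    + by rewrite qfD; have := At v; have := BtB v; lra.
    + by rewrite mxtraceD mulrDr; lra.
    + by rewrite mxtraceD mulrDr; move: Jk; rewrite -natr1; lra.
    exists z', p', A', r'; split=> //.
    have := enormD3 z' (z + s *: y) z; rewrite [z + _ - z]addrC addrA addNr add0r.
    by rewrite enormZ gtr0_norm//; nra.
  (* The blow-up is at least [- e / 16] on the ball of radius [1/4]; in the original scale this
     error is [e (s / 4)^2], that is [e] times the square of the radius. *)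
  exists z, p, A, (s / 4); split.
  - by rewrite subrr enorm0 ltW.
  - split=> //; first by rewrite divr_gt0.
    by move=> v vs; apply: up; lra.
  - by move=> v; have := At v; have := dot_ge0 v; nra.
  - move=> v vs; have [v' vE] := unscale v.
    have v'4 : enorm v' <= 1 / 4.
      rewrite vE enormZ gtr0_norm// in vs.
      by rewrite -(@ler_pM2l _ s)//; lra.
    have We : - (e / 16) <= W v'.
      by rewrite leNgt; apply/negP => h; apply: good; exists v'.
    rewrite vE WK dotZr qfvZ; have := ler_wpM2l (ltW s2) We; lra.
have [k kJ] : exists k : nat, \tr A0 + m * 0 < - (n%:R * C) + k%:R * eta.
  exists (Num.truncn ((\tr A0 + n%:R * C) / eta)).+1.
  have := truncnS_gt ((\tr A0 + n%:R * C) / eta).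
  by rewrite ltr_pdivrMr//; lra.
apply: (main k z0 p0 A0 r0 0 d) => //.
  by move=> v; rewrite mul0r addr0.
rewrite mulr0 addr0 (_ : n%:R * L = \sum_(i < n) L); last first.
  by rewrite sumr_const card_ord -[RHS]mulr_natl.
apply: ler_sum => i _; rewrite -qf_delta; apply: le_trans (A0L _) _.
by rewrite dot_delta mxE !eqxx mulr1.
Qed.

End AlmostQuadratic.

(** * The theorem on sums *)

Section SupConvolution.
Context {R : realType} {n : nat}.
Implicit Types (x y z v p c : 'rV[R]_n) (A B M : 'M[R]_n) (g w : 'rV[R]_n -> R)
  (r s t d e k : R).

(** The selection [h] of maximizers is part of the data because a paraboloid touching [a] at [x] is
    transferred to [g] at [h x]. *)
Definition sup_conv_of g c r e (a : 'rV[R]_n -> R) (h : 'rV[R]_n -> 'rV[R]_n) :=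
  [/\ forall x, cball c r (h x),
      forall x, a x = g (h x) - dot (x - h x) (x - h x) / (2 * e) &
      forall x y, cball c r y -> g y - dot (x - y) (x - y) / (2 * e) <= a x].

Lemma sup_conv_exists g c r e : 0 <= r -> 0 < e -> cont_on (cball c r) g ->
  exists a h, sup_conv_of g c r e a h.
Proof.
move=> r0 e0 cg.
have ex x : exists m, cball c r m /\ forall y, cball c r y ->
    g y - dot (x - y) (x - y) / (2 * e) <= g m - dot (x - m) (x - m) / (2 * e).
  pose b (t : R) := - (t ^+ 2 / (2 * e)).
  have cb : continuous b.
    move=> t; apply: cvgN; apply: cvgM; last exact: cvg_cst.
    exact: exprn_continuous.
  have cgb : cont_on (cball c r) (fun y => g y + b (enorm (y - x))).
    apply: cont_onD => //.
    by apply: (@cont_on_comp _ _ _ (fun y => enorm (y - x)) b cb); exact: cont_on_enormB.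
  have [m Km mmax] := evt_cball r0 cgb; exists m; split=> // y Ky.
  have := mmax y Ky; rewrite /b !sqr_enorm.
  by rewrite -(opprB x y) -(opprB x m) !dotNl !dotNr !opprK.
have [h hP] := choice ex.
exists (fun x => g (h x) - dot (x - h x) (x - h x) / (2 * e)), h.
by split=> // x; [case: (hP x)|move=> y Ky; case: (hP x) => _; exact].
Qed.

Lemma sup_conv_semiconvex g c r e a h : 0 < e -> sup_conv_of g c r e a h ->
  semiconvex e^-1 a.
Proof.
move=> e0 [hK aE aM] x y s s01; set z := _ + _.
have := aM x _ (hK z); have := aM y _ (hK z); rewrite (aE z); set z' := h z.
have [s0 s1] : 0 <= s /\ 0 <= 1 - s by lra.
move=> hy hx; have := ler_wpM2l s0 hy; have := ler_wpM2l s1 hx.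
have -> : dot (z - z') (z - z') = (1 - s) * dot (x - z') (x - z') +
    s * dot (y - z') (y - z') - s * (1 - s) * dot (x - y) (x - y).
  have -> : z - z' = (1 - s) *: (x - z') + s *: (y - z').
    by rewrite !scalerBr addrACA -opprD -scalerDl subrK scale1r.
  have -> : x - y = (x - z') - (y - z') by rewrite opprB addrA subrK.
  by move: (x - z') (y - z') => X Y; rewrite !dotS (dotC Y X); ring.
have -> k : k / (2 * e) = k * (e^-1 / 2) by field; lra.
lra.
Qed.

Lemma sup_conv_cont g c r e a h : 0 <= r -> 0 < e -> sup_conv_of g c r e a h ->
  cont_on setT a.
Proof.
move=> r0 e0 [hK aE aM] x _ k k0; pose L := (enorm (x - c) + r + 1) / e.
have L0 : 0 < L by rewrite divr_gt0//; have := enorm_ge0 (x - c); lra.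
have close y z : enorm (y - z) <= 1 -> enorm (z - x) <= 1 -> enorm (y - x) <= 1 ->
    a y - a z <= L * enorm (y - z).
  move=> yz zx yx; have := aM z _ (hK y); rewrite (aE y); set y' := h y => H.
  suff : dot (z - y') (z - y') - dot (y - y') (y - y') <= 2 * e * L * enorm (y - z).
    move=> h1; have e2 : 0 < 2 * e by lra.
    rewrite -(@ler_pM2l _ (2 * e))// mulrA; apply: le_trans h1.
    rewrite -(@ler_pM2l _ (2 * e)) in H => //; move: H.
    rewrite !mulrBr [2 * e * (dot (z - _) _ / _)]mulrCA divff ?gt_eqF// mulr1.
    rewrite [2 * e * (dot (y - _) _ / _)]mulrCA divff ?gt_eqF// mulr1.
    by lra.
  have -> : dot (z - y') (z - y') - dot (y - y') (y - y') =
      dot (z - y) ((z - y') + (y - y')).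
    have -> : z - y = (z - y') - (y - y') by rewrite opprB addrA subrK.
    by move: (z - y') (y - y') => X Y; rewrite !dotS (dotC Y X); ring.
  apply: le_trans (cauchy_schwarz _ _) _; rewrite mulrC (enormB z).
  apply: ler_wpM2r; first exact: enorm_ge0.
  have -> : 2 * e * L = 2 * (enorm (x - c) + r + 1) by rewrite /L; field; lra.
  have := enormD (z - y') (y - y').
  have := enormD3 z x y'; have := enormD3 y x y'; have := enormD3 x c y'.
  have := hK y; rewrite /cball /= -/y' (enormB c); lra.
exists (Num.min 1 (k / (L + 1))); first by rewrite lt_min ltr01 divr_gt0//; lra.
move=> y _; rewrite lt_min ltr_pdivlMr; last lra.
move=> /andP[y1 yk]; have yx0 := enorm_ge0 (y - x).
have := close y x (ltW y1); have := close x y; rewrite enormB enorm_center.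
move=> /(_ (ltW y1) (ltW y1) ler01) h1 /(_ ler01 (ltW y1)) h2.
by rewrite ltr_norml; apply/andP; split; lra.
Qed.

(** Shifting [x] and [h x] by the same [v] leaves the penalization unchanged, so
    [a (x + v) - a x >= g (h x + v) - g (h x)]: the same [p] and [A] work for [g]. *)
Lemma sup_conv_touches g c r e a h x p A t : sup_conv_of g c r e a h ->
  enorm (h x - c) < r -> touches_above a x p A t ->
  exists2 t', 0 < t' & touches_above g (h x) p A t'.
Proof.
move=> [hK aE aM] xr [sA t0 up]; exists (Num.min t (r - enorm (h x - c))).
  by rewrite lt_min t0 subr_gt0.
split=> //; first by rewrite lt_min t0 subr_gt0.
move=> v; rewrite le_min => /andP[vt vr].
have /(aM (x + v)) : cball c r (h x + v).
  by rewrite /cball /= addrAC; have := enormD (h x - c) v; lra.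
have -> : x + v - (h x + v) = x - h x by rewrite opprD addrACA subrr addr0.
have := up v vt; rewrite (aE x); lra.
Qed.

Lemma touches_above_le g x p A t t' : 0 < t' -> t' <= t ->
  touches_above g x p A t -> touches_above g x p A t'.
Proof. by move=> t'0 tt' [sA t0 up]; split=> // v vt; apply: up; lra. Qed.

Lemma sup_conv_close g c r : 0 <= r -> cont_on (cball c r) g ->
  exists2 S : R, 0 <= S & forall e a h x, 0 < e -> sup_conv_of g c r e a h ->
    cball c r x -> dot (x - h x) (x - h x) <= S * e.
Proof.
move=> r0 cg; have [m Km mmax] := evt_cball r0 cg.
have [m' Km' mmin] := evt_cball r0 (cont_onN cg).
exists (2 * (g m - g m')); first by have := mmax m' Km'; lra.
move=> e a h x e0 [hK aE aM] Kx; have := aM x x Kx; rewrite aE subrr dot0l.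
have := mmax _ (hK x); have := mmin _ Kx.
rewrite mul0r subr0 => h1 h2 h3.
have : dot (x - h x) (x - h x) / (2 * e) <= g m - g m' by lra.
by rewrite ler_pdivrMr; lra.
Qed.

End SupConvolution.

Section TheoremOnSums.
Context {R : realType} {n : nat}.
Implicit Types (x y p q a b : 'rV[R]_n) (z w : 'rV[R]_(n + n)) (A T : 'M[R]_(n + n))
  (u v : 'rV[R]_n -> R) (r s t d e k : R).

Lemma dot_row_mx a b p q : dot (row_mx a b) (row_mx p q) = dot a p + dot b q.
Proof. by rewrite /dot tr_row_mx mul_row_col mxE. Qed.

Lemma dot_hsubmx z w :
  dot z w = dot (lsubmx z) (lsubmx w) + dot (rsubmx z) (rsubmx w).
Proof. by rewrite -dot_row_mx !hsubmxK. Qed.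

Lemma enorm_lsubmx z : enorm (lsubmx z) <= enorm z.
Proof.
by rewrite enorm_ler_sqr ?enorm_ge0// sqr_enorm (dot_hsubmx z) lerDl dot_ge0.
Qed.

Lemma enorm_rsubmx z : enorm (rsubmx z) <= enorm z.
Proof.
by rewrite enorm_ler_sqr ?enorm_ge0// sqr_enorm (dot_hsubmx z) lerDr dot_ge0.
Qed.

Lemma enorm_row_mx a b : enorm (row_mx a b) <= enorm a + enorm b.
Proof.
rewrite enorm_ler_sqr ?addr_ge0 ?enorm_ge0// dot_row_mx -!sqr_enorm.
by have := mulr_ge0 (enorm_ge0 a) (enorm_ge0 b); lra.
Qed.

Lemma qf_row_mx0 A a : qf A (row_mx a 0) = qf (ulsubmx A) a.
Proof.
rewrite /qf -{1}(submxK A) mul_row_block !mul0mx !addr0 dot_row_mx dot0r.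
by rewrite addr0.
Qed.

Lemma qf_row_0mx A a : qf A (row_mx 0 a) = qf (drsubmx A) a.
Proof.
rewrite /qf -{1}(submxK A) mul_row_block !mul0mx !add0r dot_row_mx dot0r.
by rewrite add0r.
Qed.

Lemma symmetric_ulsubmx A : A \is symmetricmx -> ulsubmx A \is symmetricmx.
Proof. by rewrite !symmetricP => AT; rewrite trmx_ulsub AT. Qed.

Lemma symmetric_drsubmx A : A \is symmetricmx -> drsubmx A \is symmetricmx.
Proof. by rewrite !symmetricP => AT; rewrite trmx_drsub AT. Qed.

Definition direct_sum u v : 'rV[R]_(n + n) -> R :=
  fun z => u (lsubmx z) + v (rsubmx z).

Lemma direct_sum_semiconvex (C : R) u v : semiconvex C u -> semiconvex C v ->
  semiconvex C (direct_sum u v).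
Proof.
move=> su sv z w s s01; rewrite /direct_sum dot_hsubmx !raddfB/=.
have := su (lsubmx z) (lsubmx w) s s01; have := sv (rsubmx z) (rsubmx w) s s01.
by rewrite !raddfD/= !linearZ/=; lra.
Qed.

Lemma direct_sum_cont u v : cont_on setT u -> cont_on setT v ->
  cont_on setT (direct_sum u v).
Proof.
move=> cu cv; apply: cont_onD => z _ e e0.
- have [d d0 du] := cu (lsubmx z) I e e0; exists d => // w _ wz; apply: du => //.
  by rewrite -raddfB; exact: le_lt_trans (enorm_lsubmx _) wz.
- have [d d0 du] := cv (rsubmx z) I e e0; exists d => // w _ wz; apply: du => //.
  by rewrite -raddfB; exact: le_lt_trans (enorm_rsubmx _) wz.
Qed.

(** A direct sum has no cross term, though [A] may have one. Comparing the upper bound in the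
    direction [(a, b)] with the lower bounds in [(a, 0)] and [(0, b)] shows that the diagonal blocks
    alone are controlled by [A], up to the defect. *)
Lemma almost_quadratic_direct_sum u v z pz A r e : 0 < e ->
  touches_above (direct_sum u v) z pz A r ->
  (forall w, enorm w <= r -> direct_sum u v z + dot pz w + qf A w / 2 -
     e * r ^+ 2 <= direct_sum u v (z + w)) ->
  [/\ touches_above u (lsubmx z) (lsubmx pz) (ulsubmx A) r,
      touches_above v (rsubmx z) (rsubmx pz) (drsubmx A) r &
      forall a b, qf (ulsubmx A) a + qf (drsubmx A) b <=
        qf A (row_mx a b) + 4 * e * (dot a a + dot b b)].
Proof.
move=> e0 [sA r0 up] low; rewrite /direct_sum in up low.
have el a : enorm (row_mx a (0 : 'rV[R]_n)) = enorm a.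
  by rewrite /enorm dot_row_mx dot0l addr0.
have er a : enorm (row_mx (0 : 'rV[R]_n) a) = enorm a.
  by rewrite /enorm dot_row_mx dot0l add0r.
have dl a : dot pz (row_mx a 0) = dot (lsubmx pz) a.
  by rewrite dot_hsubmx row_mxKl row_mxKr dot0r addr0.
have dr a : dot pz (row_mx 0 a) = dot (rsubmx pz) a.
  by rewrite dot_hsubmx row_mxKl row_mxKr dot0r add0r.
split.
- split=> //; first exact: symmetric_ulsubmx.
  move=> a ar; have := up (row_mx a 0); rewrite el => /(_ ar).
  by rewrite !raddfD/= row_mxKl row_mxKr addr0 dl qf_row_mx0; lra.
- split=> //; first exact: symmetric_drsubmx.
  move=> a ar; have := up (row_mx 0 a); rewrite er => /(_ ar).
  by rewrite !raddfD/= row_mxKl row_mxKr addr0 dr qf_row_0mx; lra.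
- move=> a b; have [ab0|ab0] := eqVneq (row_mx a b) 0.
    have /andP[/eqP -> /eqP ->] : (a == 0) && (b == 0).
      by rewrite -row_mx_eq0 ab0.
    by rewrite row_mx0 /qf !mul0mx !dot0r; lra.
  have N0 : 0 < enorm (row_mx a b) by rewrite enorm_gt0.
  (* The defect [e r^2] is only comparable to the quadratic terms for vectors of length exactly
     [r]. *)
  pose s := r / enorm (row_mx a b); have s0 : 0 < s by rewrite divr_gt0.
  have sr : enorm (s *: row_mx a b) = r by rewrite enormZ gtr0_norm// divfK ?gt_eqF.
  have r2 : r ^+ 2 = s ^+ 2 * (dot a a + dot b b).
    by rewrite -dot_row_mx -sr sqr_enorm dotZl dotZr expr2 mulrA.
  have sa : enorm (s *: a) <= r.
    by rewrite -sr -[s *: a](@row_mxKl _ _ n _ _ (s *: b)) -scale_row_mx enorm_lsubmx.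
  have sb : enorm (s *: b) <= r.
    by rewrite -sr -[s *: b](@row_mxKr _ _ n _ (s *: a)) -scale_row_mx enorm_rsubmx.
  have := up (s *: row_mx a b); rewrite sr lexx => /(_ isT).
  have := low (row_mx (s *: a) 0); rewrite el => /(_ sa).
  have := low (row_mx 0 (s *: b)); rewrite er => /(_ sb).
  rewrite scale_row_mx !raddfD/= !row_mxKl !row_mxKr !addr0 dl dr.
  rewrite qf_row_mx0 qf_row_0mx !qfvZ -scale_row_mx qfvZ (dotZr s pz).
  rewrite (dot_hsubmx pz (row_mx a b)) row_mxKl row_mxKr !dotZr.
  have s2 : 0 < s ^+ 2 by rewrite exprn_gt0.
  rewrite r2 => h1 h2 h3; rewrite -(@ler_pM2l _ (s ^+ 2))//; lra.
Qed.

(* The maximum point of the sum moves little under sup-convolution. *)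
Lemma theorem_on_sums u v (xb yb P Q : 'rV[R]_n) T (r0 eta : R) :
  0 < r0 -> 0 < eta -> T \is symmetricmx ->
  cont_on (cball xb r0) u -> cont_on (cball yb r0) v ->
  (forall x y, enorm x <= r0 -> enorm y <= r0 ->
     u (xb + x) + v (yb + y) <=
       u xb + v yb + dot P x + dot Q y + qf T (row_mx x y) / 2) ->
  exists x y p q X Y r, [/\
    enorm (x - xb) <= eta /\ enorm (y - yb) <= eta,
    enorm (p - P) <= eta /\ enorm (q - Q) <= eta,
    touches_above u x p X r, touches_above v y q Y r &
    forall a b, qf X a + qf Y b <=
      qf T (row_mx a b) + eta * (dot a a + dot b b)].
Proof.
move=> r00 eta0 sT cu cv touch; have r0' := ltW r00.
have [Su Su0 Suc] := sup_conv_close r0' cu; have [Sv Sv0 Svc] := sup_conv_close r0' cv.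
have [eta' eta'E] : exists eta', eta' = eta / 2 by exists (eta / 2).
have eta'0 : 0 < eta' by rewrite eta'E divr_gt0.
(* The added [eta' I] makes the maximum at the base point strict, so that it is displaced by at most
   [d] under a small perturbation. *)
pose T' := T + eta'%:M; have sT' : T' \is symmetricmx.
  by rewrite symmetricD// symmetric_scalar.
have qT' z : qf T' z = qf T z + eta' * dot z z by rewrite qfD qf_scalar.
have [K K0 KT] := mulmx_bounded T.
have KT' z : enorm (z *m T') <= (K + eta') * enorm z.
  rewrite mulmxDr mul_mx_scalar; apply: le_trans (enormD _ _) _.
  by rewrite enormZ gtr0_norm//; have := KT z; lra.
have qK z : qf T' z <= (K + eta') * dot z z.
  apply: le_trans (cauchy_schwarz _ _) _; rewrite -sqr_enorm expr2 mulrA.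
  by rewrite ler_wpM2r ?enorm_ge0.
clearbody T'; pose PQ := row_mx P Q.
have [L LE] : exists L, L = enorm PQ + 2 * K * r0 by exists (enorm PQ + 2 * K * r0).
have L0 : 0 <= L by rewrite LE addr_ge0 ?enorm_ge0// mulr_ge0// mulr_ge0.
have K1 : 0 < 2 * (K + eta' + 1) by rewrite mulr_gt0//; lra.
pose d := Num.min (Num.min r0 eta / 8) (eta / (2 * (K + eta' + 1))).
have d0 : 0 < d by rewrite lt_min !divr_gt0// lt_min r00.
have [dr [deta dK]] : d <= r0 / 8 /\ d <= eta / 8 /\ (K + eta') * d <= eta / 2.
  have : d <= Num.min r0 eta / 8 by rewrite ge_min lexx.
  have : d <= eta / (2 * (K + eta' + 1)) by rewrite ge_min lexx orbT.
  rewrite ler_pdivlMr// => h1 h2.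
  have [m1 m2] : Num.min r0 eta <= r0 /\ Num.min r0 eta <= eta.
    by rewrite !ge_min !lexx orbT.
  by split; [lra|split; lra].
(* [k] bounds the displacement of the maximizers of the sup-convolutions. [L] is a Lipschitz
   constant of the touching paraboloid on the ball of radius [2 r0], so the resulting error, of
   order [L k], is outweighed by [eta' d^2]. *)
clearbody d; pose k := Num.min d (eta' * d ^+ 2 / (8 * (L + 1))).
have d2 : 0 < d ^+ 2 by rewrite exprn_gt0.
have k0 : 0 < k by rewrite lt_min d0 divr_gt0 ?mulr_gt0//; lra.
have [kd kL] : k <= d /\ 8 * L * k <= eta' * d ^+ 2.
  split; first by rewrite ge_min lexx.
  have : k <= eta' * d ^+ 2 / (8 * (L + 1)) by rewrite ge_min lexx orbT.
  by rewrite ler_pdivlMr; lra.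
clearbody k; pose e := k ^+ 2 / (Su + Sv + 1).
have e0 : 0 < e by rewrite divr_gt0 ?exprn_gt0//; lra.
have eS : (Su + Sv) * e <= k ^+ 2.
  have S1 : 0 < Su + Sv + 1 by lra.
  rewrite /e mulrA ler_pdivrMr// mulrC; have := sqr_ge0 k; nra.
clearbody e; have [a [h ah]] := sup_conv_exists r0' e0 cu.
have [b [g bg]] := sup_conv_exists r0' e0 cv.
have hk x : enorm (x - xb) <= r0 -> enorm (x - h x) <= k.
  move=> xr; rewrite enorm_ler_sqr ?(ltW k0)//; apply: le_trans (Suc _ _ _ _ e0 ah xr) _.
  by have := mulr_ge0 Sv0 (ltW e0); lra.
have gk y : enorm (y - yb) <= r0 -> enorm (y - g y) <= k.
  move=> yr; rewrite enorm_ler_sqr ?(ltW k0)//; apply: le_trans (Svc _ _ _ _ e0 bg yr) _.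
  by have := mulr_ge0 Su0 (ltW e0); lra.
have [hK aE aM] := ah; have [gK bE bM] := bg.
pose w := direct_sum a b; pose zb := row_mx xb yb.
have scw : semiconvex e^-1 w.
  apply: direct_sum_semiconvex;
    [exact: sup_conv_semiconvex ah|exact: sup_conv_semiconvex bg].
have cw : cont_on setT w.
  apply: direct_sum_cont;
    [exact: sup_conv_cont r0' e0 ah|exact: sup_conv_cont r0' e0 bg].
have wE z : w (zb + z) = a (xb + lsubmx z) + b (yb + rsubmx z).
  by rewrite /w /direct_sum !raddfD/= row_mxKl row_mxKr.
pose G z := w (zb + z) - (1 * dot PQ z + 2^-1 * qf T' z).
have cG : cont_on (cball 0 r0) G.
  apply: (@cont_onW _ _ setT) => //; apply: cont_onB.
    have := @cont_on_affine _ _ w zb 1 ltr01 cw.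
    by under eq_fun do rewrite scale1r.
  apply: cont_onD; [exact: cont_on_dot|exact: cont_on_qf].
have [m mr mmax] := evt_cball r0' cG.
rewrite /cball /= subr0 in mr.
have ml : enorm (lsubmx m) <= r0 := le_trans (enorm_lsubmx m) mr.
have mr' : enorm (rsubmx m) <= r0 := le_trans (enorm_rsubmx m) mr.
have md : enorm m <= d.
  clear eS kd deta.
  pose x := xb + lsubmx m; pose y := yb + rsubmx m.
  have xxb : enorm (x - xb) <= r0 by rewrite /x addrAC subrr add0r.
  have yyb : enorm (y - yb) <= r0 by rewrite /y addrAC subrr add0r.
  (* Up to nonnegative penalizations, the values of [a] and [b] at [zb + m] are those of [u] and [v]
     at [h x] and [g y]; the hypothesis on [u] and [v] applies to the increment [m'], which is
     [2 k]-close to [m]. *)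
  pose m' := row_mx (h x - xb) (g y - yb).
  have mm' : enorm (m' - m) <= 2 * k.
    have -> : m' - m = row_mx (h x - x) (g y - y).
      rewrite -[m in LHS]hsubmxK /m' opp_row_mx add_row_mx /x /y.
      by rewrite !opprD !addrA.
    apply: le_trans (enorm_row_mx _ _) _; rewrite enormB (enormB (g y)).
    have := hk x xxb; have := gk y yyb; clear; lra.
  have m'r : enorm m' <= 2 * r0.
    apply: le_trans (enorm_row_mx _ _) _; have := hK x; have := gK y.
    rewrite /cball /=; clear; lra.
  have := mmax 0; rewrite /cball /= subrr enorm0 => /(_ r0').
  have := touch (h x - xb) (g y - yb) (hK x) (gK y).
  rewrite !(addrC _ (_ - _)) !subrK -/m' => h1.
  rewrite /G !wE !raddf0 !addr0 dot0r {1}/qf mul0mx dot0l -/x -/y (aE x) (bE y).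
  have := aM xb xb ltac:(by rewrite /cball /= enorm_center).
  have := bM yb yb ltac:(by rewrite /cball /= enorm_center).
  rewrite !subrr !dot0l !mul0r !subr0 => h2 h3 h4.
  have hx0 : 0 <= dot (x - h x) (x - h x) / (2 * e).
    by rewrite divr_ge0 ?dot_ge0// mulr_ge0// ltW.
  have gy0 : 0 <= dot (y - g y) (y - g y) / (2 * e).
    by rewrite divr_ge0 ?dot_ge0// mulr_ge0// ltW.
  have PQ' : dot P (h x - xb) + dot Q (g y - yb) = dot PQ m' by rewrite dot_row_mx.
  have qmm : qf T m' - qf T m = dot ((m' + m) *m T) (m' - m).
    by rewrite mulmxDl !dotS (dot_sym m m' sT) /qf; ring.
  have q1 : dot ((m' + m) *m T) (m' - m) <= 4 * K * r0 * (2 * k) .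
    apply: le_trans (cauchy_schwarz _ _) _; apply: ler_pM; rewrite ?enorm_ge0//.
    apply: le_trans (KT _) _; have := enormD m' m.
    have : enorm m' + enorm m <= 4 * r0 by clear - m'r mr r00; lra.
    clear - K0; nra.
  have q2 : dot PQ (m' - m) <= enorm PQ * (2 * k).
    apply: le_trans (cauchy_schwarz _ _) _.
    by rewrite ler_wpM2l ?enorm_ge0.
  rewrite dotBr in q2; rewrite qT' -(sqr_enorm m) in h4.
  have mL : eta' * enorm m ^+ 2 <= 4 * L * k.
    by rewrite LE; clear - h1 h2 h3 h4 hx0 gy0 PQ' qmm q1 q2; lra.
  have mm : enorm m ^+ 2 <= d ^+ 2.
    rewrite -(@ler_pM2l _ eta')//; have := mulr_ge0 L0 (ltW k0).
    clear - mL kL; lra.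
  by rewrite -ler_sqr// nnegrE ?enorm_ge0 ?ltW.
have tw : touches_above w (zb + m) (PQ + m *m T') T' (r0 / 2).
  split=> //; first by rewrite divr_gt0.
  move=> z zr; have := mmax (m + z); rewrite /cball /= subr0.
  have mz : enorm (m + z) <= r0.
    by apply: le_trans (enormD _ _) _; clear - md dr zr r00; lra.
  move=> /(_ mz); rewrite /G addrA [dot PQ _]dotDr qfvD// dotDl; clear; lra.
pose del := Num.min d (eta / (2 * (2 * (K + eta') + e^-1))).
have e1 : 0 < e^-1 by rewrite invr_gt0.
have Ke0 : 0 < 2 * (2 * (K + eta') + e^-1) by clear - K0 eta'0 e1; lra.
have del0 : 0 < del by rewrite lt_min d0 divr_gt0.
have [deld dele] : del <= d /\ (2 * (K + eta') + e^-1) * del <= eta / 2.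
  split; first by rewrite ge_min lexx.
  have : del <= eta / (2 * (2 * (K + eta') + e^-1)) by rewrite ge_min lexx orbT.
  by rewrite ler_pdivlMr//; clear - Ke0; lra.
clearbody del; have eta10 : 0 < eta / 10 by rewrite divr_gt0.
have Keta0 : 0 <= K + eta' by rewrite addr_ge0// ltW.
have delr : 2 * del <= r0 / 2 by clear - deld dr r00; lra.
have [z [p [A [r [zm tz Ae low]]]]] := @semiconvex_almost_quadratic _ _ e^-1
  (K + eta') (eta / 10) del w _ _ _ _ (ltW e1) Keta0 eta10 del0 scw cw tw qK.
have pclose := @touches_above_grad_close _ _ _ (K + eta') del _ _ _ _ _ _ _ _ _
  (ltW e1) Keta0 scw tz tw qK del0 delr zm.
have [ta tb XY] := almost_quadratic_direct_sum eta10 tz low.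
have zzb : enorm (z - zb) <= 2 * d.
  have -> : z - zb = z - (zb + m) + m by rewrite opprD addrA subrK.
  apply: le_trans (enormD _ _) _; clear - zm md deld; lra.
have zl : enorm (lsubmx z - xb) <= 2 * d.
  have -> : lsubmx z - xb = lsubmx (z - zb) by rewrite raddfB/= row_mxKl.
  exact: le_trans (enorm_lsubmx _) zzb.
have zr : enorm (rsubmx z - yb) <= 2 * d.
  have -> : rsubmx z - yb = rsubmx (z - zb) by rewrite raddfB/= row_mxKr.
  exact: le_trans (enorm_rsubmx _) zzb.
have d2r : 2 * d <= r0 by clear - dr r00; lra.
have hz := hk (lsubmx z) (le_trans zl d2r).
have gz := gk (rsubmx z) (le_trans zr d2r).
have hzb : enorm (h (lsubmx z) - xb) <= 3 * d.
  have := enormD3 (h (lsubmx z)) (lsubmx z) xb; rewrite (enormB (h _) (lsubmx z)).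
  clear - zl hz kd; lra.
have gzb : enorm (g (rsubmx z) - yb) <= 3 * d.
  have := enormD3 (g (rsubmx z)) (rsubmx z) yb; rewrite (enormB (g _) (rsubmx z)).
  clear - zr gz kd; lra.
have d3 : 3 * d < r0 by clear - dr r00; lra.
have [t1 t10 tu] := sup_conv_touches ah (le_lt_trans hzb d3) ta.
have [t2 t20 tv] := sup_conv_touches bg (le_lt_trans gzb d3) tb.
have pPQ : enorm (p - PQ) <= eta.
  have -> : p - PQ = p - (PQ + m *m T') + m *m T' by rewrite opprD addrA subrK.
  apply: le_trans (enormD _ _) _.
  have : (K + eta') * enorm m <= (K + eta') * d by rewrite ler_wpM2l.
  have := KT' m; clear - pclose dele dK; lra.
clear - hzb gzb pPQ tu tv t10 t20 XY Ae qT' eta'E deta eta0.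
exists (h (lsubmx z)), (g (rsubmx z)), (lsubmx p), (rsubmx p), (ulsubmx A),
  (drsubmx A), (Num.min t1 t2); split.
- by split; lra.
- split.
    have -> : lsubmx p - P = lsubmx (p - PQ) by rewrite raddfB/= row_mxKl.
    exact: le_trans (enorm_lsubmx _) pPQ.
  have -> : rsubmx p - Q = rsubmx (p - PQ) by rewrite raddfB/= row_mxKr.
  exact: le_trans (enorm_rsubmx _) pPQ.
- by apply: touches_above_le tu; rewrite ?lt_min ?t10// ge_min lexx.
- by apply: touches_above_le tv; rewrite ?lt_min ?t10// ge_min lexx orbT.
(* The budget is [eta / 2] for the strictness, [eta / 10] for the increase of the Hessian and
   [4 * (eta / 10)] for the splitting into blocks. *)
- move=> x y; have := XY x y; have := Ae (row_mx x y); rewrite qT' dot_row_mx.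
  rewrite eta'E; have := dot_ge0 x; have := dot_ge0 y; lra.
Qed.

End TheoremOnSums.

(** * The free boundary condition *)

Section FreeBoundary.
Context {R : realType} {n : nat}.
Implicit Types (x y z v p c nu : 'rV[R]_n) (u h g : 'rV[R]_n -> R)
  (r s t d e k : R).

Lemma eball_center x e : 0 < e -> eball x e x.
Proof. by rewrite /eball /= subrr enorm0. Qed.

(** The unit vector [v] witnesses that the sphere is nonempty: the infimum of an empty set would be
    the default value [0]. *)
Lemma edistance_sphere y v : enorm y < 1 -> enorm v = 1 ->
  1 - enorm y <= edistance y (boundary (eball 0 1)).
Proof.
move=> y1 v1; apply: lb_le_inf.
  exists (enorm (y - v)); exists v => //; split.
    apply/closure_eball => e e0; exists ((1 - Num.min e 1 / 2) *: v).
      rewrite /eball /= subr0 enormZ v1 mulr1.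
      have m1 : Num.min e 1 <= 1 by rewrite ge_min lexx orbT.
      have m0 : 0 < Num.min e 1 by rewrite lt_min e0 ltr01.
      by rewrite ger0_norm; lra.
    rewrite scalerBl scale1r addrAC subrr add0r enormN enormZ v1 mulr1.
    have m1 : Num.min e 1 <= e by rewrite ge_min lexx.
    have m0 : 0 < Num.min e 1 by rewrite lt_min e0 ltr01.
    by rewrite ger0_norm; lra.
  move=> /interior_eball[e e0 eB].
  have := eB ((1 + e / 2) *: v); rewrite /eball /= subr0 enormZ v1 mulr1.
  rewrite scalerDl scale1r addrAC subrr add0r enormZ v1 mulr1.
  by rewrite !ger0_norm; lra.
move=> _ [z [cz iz] <-]; rewrite leNgt; apply/negP => yz; apply: iz.
apply/interior_eball; exists (1 - enorm z).
  by have := enormD3 z y 0; rewrite !subr0 (enormB z); lra.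
move=> w; rewrite /eball /= subr0; have := enormD (w - z) z; rewrite subrK; lra.
Qed.

Lemma quadratic_sphere c y0 k r y : enorm (y0 - c) = r ->
  k * r ^+ 2 - k * dot (y - c) (y - c) =
  quadratic y0 ((- (2 * k)) *: (y0 - c)) (- (2 * k))%:M y.
Proof.
move=> <-; rewrite sqr_enorm /quadratic qf_scalar dotZl.
have -> : y - c = (y - y0) + (y0 - c) by rewrite addrA subrK.
by move: (y - y0) (y0 - c) => X Y; rewrite !dotS (dotC X Y); field.
Qed.

Section Bump.
Context (c y0 : 'rV[R]_n) (k r d : R).
Context (k0 : 0 < k) (r0 : 0 < r) (yc : enorm (y0 - c) = r) (d0 : 0 < d)
  (dr : d < r).

Let psi y := k * r ^+ 2 - k * dot (y - c) (y - c).
Let phi := psi^\+.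
Let B := eball y0 d.
Let P := positivity_set B phi.
Let S := [set y | enorm (y - c) = r].

Lemma bump_gt0 y : (0 < psi y) = (enorm (y - c) < r).
Proof. by rewrite /psi subr_gt0 ltr_pM2l// enorm_ltr_sqr// ltW. Qed.

Lemma bump_positivity y : P y <-> B y /\ enorm (y - c) < r.
Proof.
by rewrite /P /positivity_set /= /phi /funrpos lt_max ltxx orbF bump_gt0.
Qed.

Lemma open_inter_ball y : B y -> enorm (y - c) < r ->
  exists2 e : R, 0 < e & eball y e `<=` P.
Proof.
move=> By yr; rewrite /B /eball /= in By.
exists (Num.min (d - enorm (y - y0)) (r - enorm (y - c))).
  by rewrite lt_min !subr_gt0 By.
move=> z; rewrite /eball /= lt_min => /andP[zd zr]; apply/bump_positivity; split.
  by rewrite /B /eball /=; have := enormD3 z y y0; lra.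
by have := enormD3 z y c; lra.
Qed.

Lemma bump_interior y : P y -> interior P y.
Proof.
by move=> /bump_positivity[By yr]; apply/interior_eball; exact: open_inter_ball.
Qed.

Lemma bump_free_boundary y : free_boundary B phi y <-> B y /\ S y.
Proof.
split=> [[[cP iP] By]|[By yr]].
  split=> //; rewrite /S /=; case: (ltgtP (enorm (y - c)) r) => // yr.
    by case: iP; apply: bump_interior; apply/bump_positivity.
  move/closure_eball: cP => /(_ (enorm (y - c) - r)).
  rewrite subr_gt0 => /(_ yr)[z /bump_positivity[_ zr]].
  by have := enormD3 y z c; rewrite (enormB y z); lra.
split=> //; split; last first.
  by move=> /interior_subset /bump_positivity[_]; rewrite yr ltxx.
rewrite /S /= in yr.
apply/closure_eball => e e0; rewrite /B /eball /= in By.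
pose t := Num.min (1 / 2) (Num.min e (d - enorm (y - y0)) / (2 * r)).
have r00 : 0 < r := r0; have r2 : 0 < 2 * r by lra.
have m0 : 0 < Num.min e (d - enorm (y - y0)) by rewrite lt_min e0 subr_gt0.
have t0 : 0 < t by rewrite lt_min divr_gt0// divr_gt0.
have [t1 [te td]] : t <= 1 / 2 /\ 2 * r * t <= e /\ 2 * r * t <= d - enorm (y - y0).
  split; first by rewrite ge_min lexx.
  have : t <= Num.min e (d - enorm (y - y0)) / (2 * r) by rewrite ge_min lexx orbT.
  rewrite ler_pdivlMr// mulrC => h.
  by split; apply: (le_trans h); rewrite ge_min lexx ?orbT.
have tr0 := mulr_gt0 t0 r0; exists (y + (- t) *: (y - c)).
  apply/bump_positivity; split.
    rewrite /B /eball /= addrAC; apply: le_lt_trans (enormD _ _) _.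
    by rewrite enormZ normrN gtr0_norm// yr; lra.
  have -> : y + - t *: (y - c) - c = (1 - t) *: (y - c).
    by rewrite addrAC scalerBl scale1r scaleNr.
  by rewrite enormZ yr gtr0_norm; lra.
by rewrite addrAC subrr add0r enormZ normrN gtr0_norm// yr; lra.
Qed.

Let p := (- (2 * k)) *: (y0 - c).
Let X : 'M[R]_n := (- (2 * k))%:M.
(** The affine gradient of [psi] provides the continuous extension required for the gradient of
    [phi], which has a kink on the sphere. *)
Let G y : 'rV[R]_n := p + (y - y0) *m X.

Lemma bump_sym : X \is symmetricmx. Proof. exact: symmetric_scalar. Qed.

Lemma bumpE : psi = quadratic y0 p X.
Proof. by apply/funext => y; exact: quadratic_sphere. Qed.

Lemma bump_gradE y : G y = (- (2 * k)) *: (y - c).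
Proof.
by rewrite /G /p /X mul_mx_scalar -scalerDr addrC addrA subrK.
Qed.

Lemma grad_bump y : grad psi y = G y.
Proof.
apply/rowP => i; rewrite mxE bumpE partial_quadraticE//; exact: bump_sym.
Qed.

Lemma bump_defining : C1_defining_function (free_boundary B phi) y0 psi.
Proof.
exists d; split => //.
- by rewrite bumpE; have [] := C2_quadratic (eball y0 d) y0 p bump_sym.
(* The gradient vanishes at the center [c] only, and [d < r] keeps [c] out of the ball. *)
- move=> y yd; rewrite grad_bump bump_gradE scaler_eq0 oppr_eq0 mulf_eq0.
  rewrite pnatr_eq0 (gt_eqF k0) subr_eq0 /=; apply/eqP => ycE.
  by move: dr yd; rewrite /eball /= ycE enormB yc; lra.
- apply/seteqP; split=> y [].
    move=> /bump_free_boundary[_ yr] yB; split=> //=.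
    by rewrite /psi -sqr_enorm yr subrr.
  move=> /= py yB; split=> //; apply/bump_free_boundary; split=> //.
  have : dot (y - c) (y - c) = r ^+ 2.
    by apply: (@mulfI _ k); [rewrite gt_eqF|move: py; rewrite /psi; lra].
  rewrite -sqr_enorm => /eqP; rewrite eqrXn2 ?enorm_ge0//; last exact: ltW.
  by move/eqP.
Qed.

Lemma bump_near y : P y -> \forall z \near y, psi z = phi z.
Proof.
move=> /bump_positivity[By yr]; have [e e0 eP] := open_inter_ball By yr.
apply/near_eball; exists e => // z /eP /bump_positivity[_ zr].
by rewrite /phi /funrpos max_l// ltW// bump_gt0.
Qed.

Lemma partial_bump i y : P y -> partial i phi y = G y 0 i.
Proof.
move=> Py; rewrite /partial -(near_eq_derive (evec i) (bump_near Py)).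
by rewrite bumpE -/(partial i _ y) partial_quadraticE//; exact: bump_sym.
Qed.

Lemma bump_C1 : C1_up_to P (free_boundary B phi) phi G.
Proof.
split.
- move=> y Py i; split.
    apply: near_eq_derivable (bump_near Py) _; rewrite bumpE.
    by have [] := partial_quadratic y0 p i y bump_sym.
  have [e e0 eP] : exists2 e : R, 0 < e & eball y e `<=` P.
    by move/bump_positivity: Py => [By yr]; exact: open_inter_ball.
  suff h : partial i phi @ y --> partial i phi y by exact: h.
  rewrite partial_bump//.
  apply: (@cvg_trans _ ((fun z => G z 0 i) @ y)); last exact: continuous_affine_coord.
  have E : \forall z \near y, G z 0 i = partial i phi z.
    by apply/near_eball; exists e => // z /eP Pz; rewrite partial_bump.
  exact: near_eq_cvg E.
- by move=> y Py; apply/rowP => i; rewrite [RHS]mxE partial_bump.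
- apply/subspace_continuousP => y _; apply/cvgrPdist_lt => e e0.
  apply: filterS (_ : nbhs y _) => [z h _|]; first exact: h.
  have k2 : 0 < 2 * k by rewrite mulr_gt0.
  apply/near_eball; exists (e / (2 * k)); first exact: divr_gt0.
  move=> z; rewrite /eball /= ltr_pdivlMr// => zy.
  apply: le_lt_trans (mx_norm_le_enorm _) _.
  rewrite -[X in enorm X]/(G y - G z) !bump_gradE -scalerBr.
  by rewrite opprB addrA subrK enormZ normrN gtr0_norm// mulrC enormB.
Qed.

Lemma bump_cont : cont_on B phi.
Proof.
apply: cont_on_max0; apply: (@cont_onW _ _ setT) => //.
have qc : cont_on setT (fun v => 1 * dot p v + 2^-1 * qf X v).
  by apply: cont_onD; [exact: cont_on_dot|exact: cont_on_qf].
have := cont_on_affine (- y0) ltr01 qc; rewrite bumpE.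
rewrite (_ : (fun v => _) = quadratic y0 p X)//; apply/funext => y.
by rewrite /quadratic scale1r [- y0 + y]addrC mul1r [2^-1 * _]mulrC.
Qed.

End Bump.

(* Tested with the truncated paraboloid [k (r^2 - |y - c|^2)^+]. *)
Lemma free_boundary_slope u h c y0 k r :
  visc_free_boundary_le u h -> free_boundary (eball 0 1) u y0 -> u y0 <= 0 ->
  0 < k -> 0 < r -> enorm (y0 - c) = r ->
  (\forall y \near y0, k * r ^+ 2 - k * dot (y - c) (y - c) <= u^\+ y) ->
  2 * k * r <= h y0.
Proof.
move=> fbu Fy uy k0 r0 yc touch.
have y1 : enorm y0 < 1 by case: Fy => _; rewrite /eball /= subr0.
pose d := Num.min (r / 2) ((1 - enorm y0) / 2).
have d0 : 0 < d by rewrite lt_min !divr_gt0// subr_gt0.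
have [dr d1] : d <= r / 2 /\ d <= (1 - enorm y0) / 2.
  by rewrite !ge_min !lexx orbT.
have drr : d < r by lra.
pose nu := r^-1 *: (c - y0).
have cy : enorm (c - y0) = r by rewrite enormB.
have nu1 : enorm nu = 1 by rewrite enormZ gtr0_norm ?invr_gt0// cy mulVf// gt_eqF.
have dist := edistance_sphere y1 nu1.
pose psi y := k * r ^+ 2 - k * dot (y - c) (y - c).
pose G y := (- (2 * k)) *: (y0 - c) + (y - y0) *m (- (2 * k))%:M.
have Gy : G y0 = (2 * k * r) *: nu.
  rewrite /G subrr mul0mx addr0 /nu scalerA mulfK ?gt_eqF//.
  by rewrite -opprB scalerN scaleNr opprK.
have <- : dot (G y0) nu = 2 * k * r by rewrite Gy dotZl -sqr_enorm nu1 expr1n mulr1.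
have phi0 : psi^\+ y0 = 0.
  by rewrite /funrpos /psi -sqr_enorm yc subrr maxxx.
apply: (fbu y0 d psi^\+ G nu) => //.
- by apply/andP; split=> //; lra.
- by apply/cont_onP; exact: bump_cont yc.
- apply/bump_free_boundary => //; split=> //=.
  exact: eball_center.
- by exists psi; exact: bump_defining.
- exact: bump_C1 yc.
- apply: filterS touch => y py; rewrite {1}/funrpos ge_max py.
  exact: funrpos_ge0.
- by rewrite phi0 /funrpos max_r.
- split=> //; exists psi; split; first exact: bump_defining.
  exists (2 * k * r)^-1; rewrite (@grad_bump c y0 k r yc) -/(G y0) Gy scalerA.
  by rewrite mulVf ?scale1r// gt_eqF// !mulr_gt0.
- apply: filterS2 (nbhs_right_gt 0) (nbhs_right_lt d0) => t t0 td.
  apply: bump_interior => //; apply/bump_positivity => //.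
  split; first by rewrite /eball /= addrAC subrr add0r enormZ nu1 mulr1 gtr0_norm.
  have -> : y0 + t *: nu - c = (1 - t / r) *: (y0 - c).
    rewrite addrAC /nu scalerA scalerBl scale1r -(opprB y0 c) scalerN.
    by congr (_ - _).
  have tr : t / r < 1 by rewrite ltr_pdivrMr//; lra.
  have tr0 : 0 < t / r by rewrite divr_gt0.
  by rewrite enormZ yc gtr0_norm; nra.
Qed.

Lemma free_boundaryP g y : cont_on (eball 0 1) g ->
  free_boundary (eball 0 1) g y -> g y <= 0.
Proof.
move=> cg [[_ iy] By]; rewrite leNgt; apply/negP => gy; apply: iy.
apply/interior_eball; have [d d0 dg] := cg y By _ gy.
rewrite /eball /= subr0 in By.
exists (Num.min d (1 - enorm y)); first by rewrite lt_min d0 subr_gt0.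
move=> z; rewrite /eball /= lt_min => /andP[zd z1].
have Bz : eball 0 1 z.
  by rewrite /eball /= subr0; have := enormD (z - y) y; rewrite subrK; lra.
by split=> //; have := dg z Bz zd; rewrite ltr_norml => /andP[]; lra.
Qed.

Lemma free_boundaryI g y : eball 0 1 y -> g y <= 0 ->
  (forall e, 0 < e -> exists z, [/\ eball 0 1 z, 0 < g z & enorm (z - y) < e]) ->
  free_boundary (eball 0 1) g y.
Proof.
move=> By gy cy; split=> //; split; last first.
  by move=> /interior_subset[_]; lra.
apply/closure_eball => e e0; have [z [Bz gz zy]] := cy e e0.
by exists z.
Qed.

End FreeBoundary.

(** * Doubling of variables *)

Section IshiiLions.
Context {R : realType} {n : nat}.
Implicit Types (x y z a b p e c : 'rV[R]_n) (w : 'rV[R]_(n + n)) (M N X Y : 'M[R]_n)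
  (u f h g : 'rV[R]_n -> R) (r s t d k L K S rad : R).

(** The exact second order coefficient of the norm in tangential directions is [1 / (2 r)]; doubling
    it gives an upper bound valid on the whole ball [|a| <= r / 2]. *)
Lemma norm_upper_quadratic z e r a : 0 < r -> dot e e = 1 -> z = r *: e ->
  enorm a <= r / 2 ->
  enorm (z + a) <= r + dot e a + (dot a a - dot e a ^+ 2) / r.
Proof.
move=> r0 e1 -> ar; have en : enorm e = 1 by rewrite /enorm e1 sqrtr1.
have c1 := cauchy_schwarz e a; have c2 := cauchy_schwarzN e a.
rewrite en mul1r in c1 c2; have a0 := enorm_ge0 a.
have w0 : 0 <= dot a a - dot e a ^+ 2 by rewrite -sqr_enorm; nra.
set w := dot a a - _ in w0 *; have wr : 0 <= w / r by rewrite divr_ge0// ltW.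
rewrite enorm_ler_sqr; last lra.
have -> : dot (r *: e + a) (r *: e + a) = (r + dot e a) ^+ 2 + w.
  by rewrite !dotS (dotC a e) e1 /w; ring.
have s2 : r / 2 <= r + dot e a by lra.
have -> : (r + dot e a + w / r) ^+ 2 =
    (r + dot e a) ^+ 2 + 2 * (r + dot e a) * (w / r) + (w / r) ^+ 2 by ring.
have -> : w = r * (w / r) by field; lra.
rewrite [r * (_ / r) / r]mulrAC divff ?gt_eqF// mul1r.
by have := sqr_ge0 (w / r); nra.
Qed.

(** This block matrix is the Hessian of a function of [x - y] with Hessian [M], plus a function of
    [x] with Hessian [N]. *)
Lemma qf_diff_block M N a b : M \is symmetricmx ->
  qf (block_mx (M + N) (- M) (- M) M) (row_mx a b) = qf M (a - b) + qf N a.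
Proof.
move=> sM; rewrite /qf mul_row_block dot_row_mx.
rewrite mulmxDr !mulmxN mulmxBl !dotS (dot_sym a b sM); ring.
Qed.

Lemma symmetric_diff_block M N : M \is symmetricmx -> N \is symmetricmx ->
  block_mx (M + N) (- M) (- M) M \is symmetricmx.
Proof.
rewrite !symmetricP tr_block_mx !raddfD/= !raddfN/= => -> -> //.
Qed.

Lemma cont_on_lsubmx (A : set 'rV[R]_n) (B : set 'rV[R]_(n + n)) g :
  cont_on A g -> (forall w, B w -> A (lsubmx w)) ->
  cont_on B (fun w => g (lsubmx w)).
Proof.
move=> cg BA w Bw t t0; have [d d0 dg] := cg _ (BA _ Bw) t t0.
exists d => // w' Bw' wz; apply: dg; first exact: BA.
by rewrite -raddfB; exact: le_lt_trans (enorm_lsubmx _) wz.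
Qed.

Lemma cont_on_rsubmx (A : set 'rV[R]_n) (B : set 'rV[R]_(n + n)) g :
  cont_on A g -> (forall w, B w -> A (rsubmx w)) ->
  cont_on B (fun w => g (rsubmx w)).
Proof.
move=> cg BA w Bw t t0; have [d d0 dg] := cg _ (BA _ Bw) t t0.
exists d => // w' Bw' wz; apply: dg; first exact: BA.
by rewrite -raddfB; exact: le_lt_trans (enorm_rsubmx _) wz.
Qed.

Lemma evt_pair c rad (G : 'rV[R]_(n + n) -> R) : 0 <= rad ->
  (let B := [set w | cball c rad (lsubmx w) /\ cball c rad (rsubmx w)] in
   cont_on B G -> exists2 m, B m & forall w, B w -> G w <= G m).
Proof.
move=> r0 B cG.
have E : B = cball (row_mx c c) (2 * rad) `&`
    [set w | - rad <= - enorm (lsubmx w - c)] `&`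
    [set w | - rad <= - enorm (rsubmx w - c)].
  apply/seteqP; split=> z.
    move=> [lz rz]; split; [split|]; rewrite /= ?lerN2//.
    rewrite /cball /= -[z]hsubmxK opp_row_mx add_row_mx.
    by apply: le_trans (enorm_row_mx _ _) _; rewrite /cball /= in lz rz; lra.
  by move=> [[_ lz] rz]; move: lz rz; rewrite /= !lerN2.
apply: (@evt_max _ _ B G (row_mx c c) (2 * rad)) => //.
- by exists (row_mx c c); split; rewrite ?row_mxKl ?row_mxKr /cball /= enorm_center.
- rewrite E; apply: closed_superlevel; first apply: closed_superlevel.
  + exact: closed_cball.
  + apply: cont_onN; apply: (@cont_on_lsubmx setT _ (fun x => enorm (x - c))) => //.
    exact: cont_on_enormB.
  + apply: cont_onN; apply: (@cont_on_rsubmx setT _ (fun x => enorm (x - c))) => //.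
    exact: cont_on_enormB.
- by rewrite E => z [[]].
Qed.

Lemma cont_on_locally_pos (A : set 'rV[R]_n) u x d : cont_on A u -> 0 < u x ->
  0 < d -> cball x d `<=` A ->
  exists2 d', 0 < d' <= d & forall y, cball x d' y -> 0 < u y.
Proof.
move=> cu ux d0 dA; have Ax : A x by apply: dA; rewrite /cball /= enorm_center ltW.
have [d1 d10 h] := cu x Ax _ ux; exists (Num.min d (d1 / 2)).
  by rewrite lt_min d0 divr_gt0//= ge_min lexx.
move=> y; rewrite /cball /= le_min => /andP[yd yd1].
by have := h y (dA _ yd) ltac:(lra); rewrite ltr_norml => /andP[]; lra.
Qed.

(* The final contradiction of the doubling argument, at points where [u] is
   touched by paraboloids with gradients of size at least [L / 4]. *)
Lemma elliptic_gap (lam Lam alpha : R) (F : 'M[R]_n -> R) X Y p (q0 : 'rV[R]_n) e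
    (fx fy Ph L k C0 : R) :
  uniformly_elliptic lam Lam F -> 0 <= lam -> 0 <= alpha -> 0 <= Ph -> 0 < L ->
  4 <= C0 -> C0 * Ph <= L ->
  X \is symmetricmx -> Y \is symmetricmx -> 0 <= k ->
  (forall v, qf X v + qf Y v <= k * dot v v) -> dot e e = 1 ->
  L / 4 <= enorm p -> L / 4 <= enorm q0 ->
  fx <= enorm p `^ alpha * F X -> enorm q0 `^ alpha * F (- Y) <= fy ->
  `|fx| <= Ph `^ (1 + alpha) -> `|fy| <= Ph `^ (1 + alpha) ->
  lam * (k - (qf X e + qf Y e)) <= n%:R * Lam * k + 2 * L / C0.
Proof.
move=> eF lam0 al0 Ph0 L0 C4 CP sX sY k0 XY e1 pL qL subx supy fxP fyP.
have C00 : 0 < C0 by clear - C4; lra.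
have := @elliptic_diff _ _ _ _ F X (- Y) k e eF lam0 sX (symmetricN sY) k0.
rewrite qfN opprK => /(_ _ e1) H; have {}H := H ltac:(by move=> v; rewrite qfN opprK; exact: XY).
suff : - (2 * L / C0) <= F X - F (- Y) by clear - H; lra.
(* [N] is a lower bound for both gradient weights. Since [Ph <= L / C0 <= L / 4], dividing the
   equation by the weight leaves a right-hand side of size at most [L / C0] at each of the two
   points. *)
set N := (L / 4) `^ alpha; have N0 : 0 < N by rewrite powR_gt0// divr_gt0.
have mN : Ph `^ (1 + alpha) <= N * (L / C0).
  have PL : Ph <= L / C0 by rewrite ler_pdivlMr// mulrC.
  have LC0 : 0 < L / C0 by rewrite divr_gt0.
  apply: (@le_trans _ _ ((L / C0) `^ (1 + alpha))).
    by apply: ge0_ler_powR; rewrite ?nnegrE ?addr_ge0// ltW.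
  rewrite powRD; last by rewrite (gt_eqF LC0) implybT.
  rewrite powRr1 ?(ltW LC0)// mulrC ler_pM2r//.
  apply: ge0_ler_powR; rewrite ?nnegrE ?divr_ge0 ?(ltW L0) ?(ltW C00)//.
  by rewrite ler_pM2l// lef_pV2 ?posrE.
have pN : N <= enorm p `^ alpha.
  by apply: ge0_ler_powR; rewrite ?nnegrE ?enorm_ge0 ?divr_ge0// ltW.
have qN : N <= enorm q0 `^ alpha.
  by apply: ge0_ler_powR; rewrite ?nnegrE ?enorm_ge0 ?divr_ge0// ltW.
have LC : 0 < L / C0 by rewrite divr_gt0.
have FX : - (L / C0) <= F X.
  case: (lerP 0 (F X)) => FX0; first by clear - FX0 LC; lra.
  rewrite -(@ler_pM2l _ N)//; move: fxP; rewrite ler_norml => /andP[f1 _].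
  have : enorm p `^ alpha * F X <= N * F X by rewrite ler_nM2r.
  clear - f1 subx mN; lra.
have FY : F (- Y) <= L / C0.
  case: (lerP (F (- Y)) 0) => FY0; first by clear - FY0 LC; lra.
  rewrite -(@ler_pM2l _ N)//; move: fyP; rewrite ler_norml => /andP[_ f1].
  have : N * F (- Y) <= enorm q0 `^ alpha * F (- Y) by rewrite ler_pM2r.
  clear - f1 supy mN; lra.
clear - FX FY; lra.
Qed.

(** Its slope stays between [L / 2] and [L] for [0 <= r <= 2 rad], the possible distances in a ball
    of radius [rad], while its second derivative [- L / (4 rad)] provides the gain in
    ellipticity. *)
Definition doubling_weight L rad r := L * (r - r ^+ 2 / (8 * rad)).

(** Between the radii [t] and [r] the weight grows with slope at least [L / 2], while the paraboloid
    [L / (4 r) (r^2 - t^2)] decreases with mean slope at most [L / 2]. The truncated paraboloid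
    centered at [x] thus stays under [u^+] near [y]. The same inequality makes [u] positive on the
    segment from [y] towards [x]. *)
Lemma doubling_free_boundary u h x y L rad r :
  cont_on (eball 0 1) u -> visc_free_boundary_le u h ->
  0 < L -> 0 < r -> r <= rad -> enorm (y - x) = r -> eball 0 1 y -> u y <= 0 ->
  (\forall z \near y, eball 0 1 z /\
     doubling_weight L rad r - doubling_weight L rad (enorm (z - x)) <= u^\+ z) ->
  free_boundary (eball 0 1) u y /\ L / 2 <= h y.
Proof.
move=> cu fbu L0 r0 rrad yx By uy /near_eball[d d0 touch].
have rad0 : 0 < rad by lra.
have low t : 0 <= t -> t <= r ->
    L / (4 * r) * (r ^+ 2 - t ^+ 2) <=
    doubling_weight L rad r - doubling_weight L rad t.
  move=> t0 tr; rewrite /doubling_weight -mulrBr -mulrA ler_pM2l//.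
  have rr : (r + t) / (8 * rad) <= 1 / 2 by rewrite ler_pdivrMr; lra.
  have -> : r - r ^+ 2 / (8 * rad) - (t - t ^+ 2 / (8 * rad)) =
      (r - t) * (1 - (r + t) / (8 * rad)) by field; lra.
  rewrite (_ : _^-1 * _ = (r - t) * ((r + t) / (4 * r))); last by field; lra.
  have : (r + t) / (4 * r) <= 1 / 2 by rewrite ler_pdivrMr; lra.
  by move: ((r + t) / (4 * r)) ((r + t) / (8 * rad)) rr => A B; nra.
have fb : free_boundary (eball 0 1) u y.
  apply: free_boundaryI => // s s0.
  pose t := Num.min (1 / 2) (Num.min d s / (2 * r)).
  have r2 : 0 < 2 * r by lra.
  have m0 : 0 < Num.min d s by rewrite lt_min d0.
  have t0 : 0 < t by rewrite lt_min !divr_gt0.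
  have [t1 [td ts]] : t <= 1 / 2 /\ 2 * r * t <= d /\ 2 * r * t <= s.
    split; first by rewrite ge_min lexx.
    have : t <= Num.min d s / (2 * r) by rewrite ge_min lexx orbT.
    rewrite ler_pdivlMr// mulrC => h0.
    by split; apply: (le_trans h0); rewrite ge_min lexx ?orbT.
  have tr0 := mulr_gt0 t0 r0; pose z := y + (- t) *: (y - x).
  have zy : enorm (z - y) = t * r.
    by rewrite /z addrAC subrr add0r enormZ normrN gtr0_norm// yx.
  have zx : enorm (z - x) = (1 - t) * r.
    have -> : z - x = (1 - t) *: (y - x) by rewrite /z addrAC scalerBl scale1r scaleNr.
    by rewrite enormZ gtr0_norm ?yx//; lra.
  have [] := touch z ltac:(by rewrite /eball /= zy; lra) => Bz; rewrite zx => uz.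
  exists z; split=> //; last by rewrite zy; lra.
  have := low ((1 - t) * r) ltac:(nra) ltac:(nra).
  have : 0 < L / (4 * r) * (r ^+ 2 - ((1 - t) * r) ^+ 2).
    by rewrite mulr_gt0 ?divr_gt0//; nra.
  move=> h1 h2; have : 0 < u^\+ z by clear - h1 h2 uz; lra.
  by rewrite /funrpos lt_max ltxx orbF.
split=> //; have := @free_boundary_slope _ _ u h x y (L / (4 * r)) r fbu fb uy.
rewrite (_ : 2 * (L / (4 * r)) * r = L / 2); last by field; lra.
apply=> //; first by rewrite divr_gt0// mulr_gt0.
apply/near_eball; exists d => // z zy; have [_ tz] := touch z zy.
rewrite -mulrBr -sqr_enorm; case: (lerP (enorm (z - x)) r) => zr.
  by apply: le_trans tz; apply: low; rewrite ?enorm_ge0.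
apply: (@le_trans _ _ 0); last exact: funrpos_ge0.
by rewrite pmulr_rle0 ?divr_gt0// ?mulr_gt0//; have := enorm_ge0 (z - x); nra.
Qed.

(** The slopes at the maximum point have size about [L], the penalization contributing at most
    [L / 8]. The strict concavity of the weight yields a gain [lam L / rad], and [elliptic_gap]
    bounds it by errors that [C0] and [eta] make too small. *)
Lemma doubling_interior (lam Lam alpha : R) (F : 'M[R]_n -> R) u f O
    x0 x y (L S rad Ph C0 d : R) :
  0 <= lam -> 0 <= n%:R * Lam -> 0 <= alpha ->
  32 <= C0 -> 32 * (n%:R * Lam) <= lam * C0 -> 8 <= lam * C0 ->
  uniformly_elliptic lam Lam F -> visc_solution O alpha F f u ->
  0 < L -> 0 < lam -> 0 < rad <= 1 -> 0 <= S -> C0 * S <= L * rad -> 0 <= Ph -> C0 * Ph <= L ->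
  0 < d -> cball x d `<=` O -> cball y d `<=` O ->
  (forall z, O z -> `|f z| <= Ph `^ (1 + alpha)) ->
  enorm (x - x0) <= rad / 2 -> x != y -> enorm (x - y) <= rad / 4 ->
  cont_on (cball x d) u -> cont_on (cball y d) u ->
  (forall a b, enorm a <= d -> enorm b <= d ->
     u (x + a) - u (y + b) - doubling_weight L rad (enorm (x + a - (y + b))) -
       4 * S / rad ^+ 2 * dot (x + a - x0) (x + a - x0) <=
     u x - u y - doubling_weight L rad (enorm (x - y)) -
       4 * S / rad ^+ 2 * dot (x - x0) (x - x0)) -> False.
Proof.
move=> lam0' nL0 al0 C32 C0n C08 eF [sub sup] L0 lam0 /andP[rad0 rad1] S0 CS Ph0 CP
  d0 dxO dyO fP xx0 xy xyr cux cuy max.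
pose r := enorm (x - y); have r0 : 0 < r by rewrite enorm_gt0 subr_eq0.
pose e := r^-1 *: (x - y).
have e1 : dot e e = 1.
  rewrite -sqr_enorm enormZ gtr0_norm ?invr_gt0// mulVf ?expr1n//.
  by rewrite gt_eqF.
have xyE : x - y = r *: e by rewrite /e scalerA divff ?scale1r// gt_eqF.
clearbody e; pose K := 4 * S / rad ^+ 2; have K0 : 0 <= K by apply: divr_ge0; [exact: mulr_ge0|exact: sqr_ge0].
have KR : K * rad ^+ 2 = 4 * S by rewrite divfK// gt_eqF// exprn_gt0.
(* The tangential part [2 L / r] comes from the upper expansion of the norm; [- L / (4 rad)] is the
   exact contribution of [- r^2 / (8 rad)]. *)
pose M : 'M[R]_n := (2 * L / r - L / (4 * rad))%:M - (2 * L / r) *: (e^T *m e).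
have sM : M \is symmetricmx.
  by rewrite symmetricD ?symmetric_scalar// symmetricN// symmetricZ// symmetric_outer.
have qM a : qf M a = (2 * L / r) * (dot a a - dot e a ^+ 2) -
    L / (4 * rad) * dot a a.
  by rewrite qfD qfN qfZ qf_scalar qf_outer; ring.
clearbody M; pose T := block_mx (M + (2 * K)%:M) (- M) (- M) M.
have sT : T \is symmetricmx by rewrite symmetric_diff_block// symmetric_scalar.
have qT a b : qf T (row_mx a b) = qf M (a - b) + 2 * K * dot a a.
  by rewrite qf_diff_block// qf_scalar.
(* [t] is the derivative of the weight at [r]. *)
clearbody T; pose t := L * (1 - r / (4 * rad)).
pose P := t *: e + (2 * K) *: (x - x0); pose Q := (- t) *: e.
pose r0' := Num.min d (r / 4).
have r0'0 : 0 < r0' by rewrite lt_min d0 divr_gt0.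
have [r0d r0r] : r0' <= d /\ r0' <= r / 4 by rewrite !ge_min !lexx orbT.
pose A := n%:R * Lam; rewrite -/A in nL0 C0n.
pose eta := Num.min (Num.min (L / 8) d) (lam * L / (8 * rad * (A + 1))).
have A1 : 0 < 8 * rad * (A + 1) by rewrite !mulr_gt0//; lra.
have eta0 : 0 < eta by rewrite !lt_min d0 !divr_gt0// mulr_gt0.
have [etaL [etad etaA]] : eta <= L / 8 /\ eta <= d /\ 8 * rad * A * eta <= lam * L.
  split; first by rewrite !ge_min lexx.
  split; first by rewrite !ge_min lexx orbT.
  have : eta <= lam * L / (8 * rad * (A + 1)) by rewrite !ge_min lexx !orbT.
  rewrite ler_pdivlMr//; have := mulr_gt0 rad0 eta0; lra.
have touch a b : enorm a <= r0' -> enorm b <= r0' ->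
    u (x + a) + - u (y + b) <=
      u x + - u y + dot P a + dot Q b + qf T (row_mx a b) / 2.
  move=> ar br; have := max a b (le_trans ar r0d) (le_trans br r0d).
  have zE : x + a - (y + b) = (x - y) + (a - b) by rewrite opprD addrACA.
  have ab : enorm (a - b) <= r / 2.
    have := enormD a (- b); rewrite enormN; clear - ar br r0r; lra.
  have nq := norm_upper_quadratic r0 e1 xyE ab; rewrite -zE in nq.
  have n2 : enorm (x + a - (y + b)) ^+ 2 = r ^+ 2 + 2 * r * dot e (a - b) + dot (a - b) (a - b).
    rewrite sqr_enorm zE xyE; move: (a - b) => c.
    by rewrite !dotS e1 (dotC c e); ring.
  have x2 : dot (x + a - x0) (x + a - x0) =
      dot (x - x0) (x - x0) + 2 * dot (x - x0) a + dot a a.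
    have -> : x + a - x0 = (x - x0) + a by rewrite addrAC.
    by move: (x - x0) => c; rewrite !dotS (dotC a c); ring.
  rewrite /doubling_weight -/r -/K n2 x2 qT qM /P /Q (dotDl (t *: e)).
  rewrite (dotZl t) (dotZl (2 * K)) (dotZl (- t)) => h.
  have := ler_wpM2l (ltW L0) nq; rewrite !(dotBr e a b) in h * => {}nq.
  move: nq h; rewrite /t; move: (enorm (x + a - (y + b))) (dot (a - b) (a - b)) (dot (x - x0) (x - x0)).
  move: (dot e a) (dot e b) (dot (x - x0) a) (dot a a) => c1 c2 c3 c4 N c6 c7.
  move=> nq h; apply: (@le_trans _ _ (u x - u y + (L * (r + (c1 - c2) +
    (c6 - (c1 - c2) ^+ 2) / r) -
    L * ((r ^+ 2 + 2 * r * (c1 - c2) + c6) / (8 * rad)) -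
    L * (r - r ^+ 2 / (8 * rad))) + K * (2 * c3 + c4))).
    by clear - nq h; lra.
  rewrite le_eqVlt; apply/orP; left; apply/eqP.
  by clear - r0 rad0; field; lra.
have cux' : cont_on (cball x r0') u.
  by apply: cont_onW cux => z; rewrite /cball /= => /le_trans; apply.
have cuy' : cont_on (cball y r0') (fun z => - u z).
  by apply: cont_onN; apply: cont_onW cuy => z; rewrite /cball /= => /le_trans; apply.
have [x' [y' [p [q [X [Y [r' [[x'x y'y] [pP qQ] tx ty XY]]]]]]]] :=
  theorem_on_sums r0'0 eta0 sT cux' cuy' touch.
have [sX r'0 upx] := tx; have [sY _ upy] := ty.
have Ox' : O x' by apply: dxO; exact: le_trans x'x etad.
have Oy' : O y' by apply: dyO; exact: le_trans y'y etad.
have en : enorm e = 1 by rewrite /enorm e1 sqrtr1.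
have xyr' : r <= rad / 4 := xyr.
have t1 : 15 / 16 * L <= t.
  have : r / (4 * rad) <= 1 / 16 by rewrite ler_pdivrMr; clear - xyr' rad0; lra.
  rewrite /t; clear - L0; nra.
have t0 : 0 < t by clear - t1 L0; lra.
have KL : 2 * K * enorm (x - x0) <= L / 8.
  have h1 : 2 * K * enorm (x - x0) <= 2 * K * (rad / 2).
    by rewrite ler_wpM2l// mulr_ge0.
  have h2 : K * rad <= L / 8.
    rewrite -(@ler_pM2l _ rad)// mulrCA -expr2 KR.
    clear - CS C32 S0 L0 rad0; nra.
  clear - h1 h2; lra.
have PL : L / 2 <= enorm P.
  have := enormD P (- ((2 * K) *: (x - x0))); rewrite addrK enormN !enormZ en mulr1.
  have -> : `|2 * K| = 2 * K by rewrite ger0_norm// mulr_ge0.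
  rewrite (gtr0_norm t0); clear - t1 KL L0; lra.
have QL : L / 2 <= enorm Q by rewrite enormZ normrN gtr0_norm// en; clear - t1 L0; lra.
have pL : L / 4 <= enorm p.
  have := enormD p (P - p); rewrite addrC subrK enormB; clear - PL pP etaL L0; lra.
have qL : L / 4 <= enorm (- q).
  rewrite enormN; have := enormD q (Q - q); rewrite addrC subrK enormB.
  clear - QL qQ etaL L0; lra.
have L4 : 0 < L / 4 by clear - L0; lra.
have p0 : p != 0 by rewrite -enorm_gt0; exact: lt_le_trans pL.
have q0 : - q != 0 by rewrite -enorm_gt0; exact: lt_le_trans qL.
have Hx := visc_sub_quadratic sub Ox' sX p0 r'0 upx.
have Hy := @visc_super_quadratic _ _ _ _ _ _ _ y' (- q) (- Y) r' sup Oy' (symmetricN sY) q0 r'0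
  ltac:(by move=> v /upy; rewrite dotNl qfN; clear; lra).
have C4 : 4 <= C0 by clear - C32; lra.
pose k := 2 * K + 2 * eta.
have k0 : 0 <= k by clear - K0 eta0; rewrite /k; lra.
(* On the diagonal [(v, v)] the block [M] cancels; only the penalization and the error remain. *)
have XYk v : qf X v + qf Y v <= k * dot v v.
  apply: le_trans (XY v v) _; rewrite qT subrr /k qM dot0l dot0r; clear; lra.
have gap := elliptic_gap eF lam0' al0 Ph0 L0 C4 CP sX sY k0 XYk e1 pL qL Hx Hy
  (fP _ Ox') (fP _ Oy').
(* In the directions [(e, - e)] the matrix [M] is tested on [2 e], where its tangential part
   vanishes: its value there is [- L / rad]. *)
have := XY e (- e); rewrite qT qM opprK qfvN !dotDr !dotDl !dotNr !dotNl e1 => XYe.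
have XYe' : L / rad <= k - (qf X e + qf Y e).
  have E : L / rad = L / (4 * rad) * (1 + 1 + (1 + 1)) by field; clear - rad0; lra.
  rewrite E /k; clear - XYe; lra.
rewrite -/A in gap; clear - gap XYe' lam0 etaA KR CS C32 C0n C08 L0 S0 rad0 rad1 nL0 K0 eta0.
have C00 : 0 < C0 by lra.
have g1 : lam * (L / rad) <= A * k + 2 * L / C0.
  by apply: le_trans gap; rewrite ler_wpM2l// ltW.
have : C0 * (lam * L) * rad <= C0 * (A * k) * rad ^+ 2 + 2 * L * rad ^+ 2.
  have h : 0 <= C0 * rad ^+ 2 by rewrite mulr_ge0 ?sqr_ge0// ltW.
  have := ler_wpM2l h g1.
  have -> : C0 * rad ^+ 2 * (lam * (L / rad)) = C0 * (lam * L) * rad by field; lra.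
  by have -> : C0 * rad ^+ 2 * (A * k + 2 * L / C0) =
    C0 * (A * k) * rad ^+ 2 + 2 * L * rad ^+ 2 by field; lra.
have -> : C0 * (A * k) * rad ^+ 2 = A * (8 * (C0 * S)) + 2 * C0 * rad * (A * rad * eta).
  have -> : C0 * (A * k) * rad ^+ 2 = C0 * A * 2 * (K * rad ^+ 2) + 2 * C0 * rad * (A * rad * eta).
    by rewrite /k; ring.
  by rewrite KR; ring.
have Lrad : 0 < L * rad by rewrite mulr_gt0.
(* Each of the three error terms is at most a quarter of the left-hand side, which is positive. *)
have b1 : A * (8 * (C0 * S)) <= lam * C0 / 4 * (L * rad).
  have : A * (C0 * S) <= A * (L * rad) by rewrite ler_wpM2l.
  have : 32 * A * (L * rad) <= lam * C0 * (L * rad) by rewrite ler_wpM2r// ltW.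
  by lra.
have b2 : 2 * C0 * rad * (A * rad * eta) <= lam * C0 / 4 * (L * rad).
  have : C0 * rad * (8 * rad * A * eta) <= C0 * rad * (lam * L).
    by rewrite ler_wpM2l// mulr_ge0// ltW.
  by lra.
have b3 : 2 * L * rad ^+ 2 <= lam * C0 / 4 * (L * rad).
  have : 8 * (L * rad) <= lam * C0 * (L * rad) by rewrite ler_wpM2r// ltW.
  have : L * rad * rad <= L * rad * 1 by rewrite ler_wpM2l// ltW.
  by lra.
have : 0 < lam * C0 * (L * rad) by rewrite !mulr_gt0.
by lra.
Qed.

End IshiiLions.

(** * The Lipschitz estimate at the center of a ball *)

Section LipschitzPoint.
Context {R : realType} {n : nat}.
Implicit Types (x y z c : 'rV[R]_n) (w : 'rV[R]_(n + n)) (u f h g : 'rV[R]_n -> R)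
  (r s t d k L K S rad Ph : R).

Lemma continuous_doubling_weight L rad : continuous (doubling_weight L rad).
Proof.
move=> t; rewrite /doubling_weight; apply: cvgM; first exact: cvg_cst.
apply: cvgB; first exact: cvg_id.
by apply: cvgM; [exact: exprn_continuous|exact: cvg_cst].
Qed.

Lemma cont_on_doubling (g : 'rV[R]_n -> R) c rad L K :
  cont_on (cball c rad) g ->
  cont_on [set w | cball c rad (lsubmx w) /\ cball c rad (rsubmx w)]
    (fun w => g (lsubmx w) - g (rsubmx w) -
       doubling_weight L rad (enorm (lsubmx w - rsubmx w)) -
       K * dot (lsubmx w - c) (lsubmx w - c)).
Proof.
move=> cg; apply: cont_onB; first apply: cont_onB; first apply: cont_onB.
- by apply: cont_on_lsubmx cg _ => w [].
- by apply: cont_on_rsubmx cg _ => w [].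
- apply: (@cont_on_comp _ _ _ (fun w => enorm (lsubmx w - rsubmx w))).
    exact: continuous_doubling_weight.
  apply: (@lipschitz_cont_on _ _ _ _ 2) => w w' _ _.
  have E : lsubmx w' - rsubmx w' = (lsubmx w - rsubmx w) +
      (lsubmx (w' - w) - rsubmx (w' - w)).
    have -> : lsubmx (w' - w) = lsubmx w' - lsubmx w by rewrite raddfB.
    have -> : rsubmx (w' - w) = rsubmx w' - rsubmx w by rewrite raddfB.
    by rewrite [X in _ + (_ - X)]addrC opprD opprK addrACA (addrC (lsubmx w)) subrK addKr.
  rewrite E; have := enormD (lsubmx w - rsubmx w) (lsubmx (w' - w) - rsubmx (w' - w)).
  have := enormD (lsubmx (w' - w)) (- rsubmx (w' - w)); rewrite enormN.
  by have := enorm_lsubmx (w' - w); have := enorm_rsubmx (w' - w); lra.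
- have ck : continuous (fun t : R => K * t ^+ 2).
    by move=> t; apply: cvgM; [exact: cvg_cst|exact: exprn_continuous].
  have -> : (fun w => K * dot (lsubmx w - c) (lsubmx w - c)) =
      (fun w => (fun t => K * t ^+ 2) (enorm (lsubmx w - c))).
    by apply/funext => w; rewrite sqr_enorm.
  apply: (@cont_on_comp _ _ _ (fun w => enorm (lsubmx w - c)) (fun t => K * t ^+ 2)) => //.
  apply: (@cont_on_lsubmx _ _ setT _ (fun x => enorm (x - c))) => //.
  exact: cont_on_enormB.
Qed.

Lemma doubling_weight_bounds L rad t : 0 < L -> 0 < rad -> 0 <= t -> t <= 2 * rad ->
  L * t / 2 <= doubling_weight L rad t <= L * t.
Proof.
move=> L0 rad0 t0 tr; rewrite /doubling_weight -mulrA !ler_pM2l//.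
have t2 : 0 <= t ^+ 2 / (8 * rad) by rewrite divr_ge0 ?sqr_ge0//; lra.
have : t ^+ 2 / (8 * rad) <= t / 2 by rewrite ler_pdivrMr; nra.
by move=> h; apply/andP; split; lra.
Qed.

(** Only the first variable is penalized, since the weight itself keeps the second one close to it.
    The bound on [h] concerns the free boundary points of the given ball, and so it holds vacuously
    in a ball where [u > 0]. *)
Lemma lipschitz_at_center (lam Lam alpha : R) : 0 < lam -> lam <= Lam -> 0 <= alpha ->
  exists2 C0 : R, 1 <= C0 &
  forall (F : 'M[R]_n -> R) u f h x0 rad S Ph L,
    uniformly_elliptic lam Lam F -> cont_on (eball 0 1) u ->
    visc_solution (positivity_set (eball 0 1) u) alpha F f u ->
    visc_free_boundary_le u h ->
    0 < rad <= 1 -> cball x0 rad `<=` eball 0 1 ->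
    (forall x, cball x0 rad x -> u x <= S) ->
    0 <= Ph -> (forall x, eball 0 1 x -> `|f x| <= Ph `^ (1 + alpha)) ->
    0 < L -> C0 * S <= L * rad -> C0 * Ph <= L ->
    (forall y, free_boundary (eball 0 1) u y -> cball x0 rad y -> h y < L / 2) ->
    forall y, cball x0 rad y -> u^\+ x0 - u^\+ y <= L * enorm (x0 - y).
Proof.
move=> lam0 lamLam al0; have Lam0 : 0 < Lam := lt_le_trans lam0 lamLam.
pose A := n%:R * Lam; have A0 : 0 <= A by rewrite mulr_ge0// ltW.
(* [32] keeps the maximum point well inside the ball and the slopes of size [L]; the multiples of
   [1 / lam] beat the errors in the ellipticity inequality. *)
pose C0 := 32 + (32 * A + 8) / lam.
have C32 : 32 <= C0 by rewrite lerDl divr_ge0 ?(ltW lam0)//; clear - A0; lra.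
have lC : lam * C0 = 32 * lam + (32 * A + 8).
  by rewrite /C0 mulrDr mulrCA divff ?gt_eqF// mulr1 (mulrC lam).
exists C0; first by clear - C32; lra.
move=> F u f h x0 rad S Ph L eF cu vs fbu /andP[rad0 rad1] ballB uS Ph0 fP L0 CS CP
  hL y0 y0r.
rewrite leNgt; apply/negP => bad.
(* The penalization reaches [S] at distance [rad / 2] from [x0], which confines the first variable
   to the half ball. *)
pose K := 4 * S / rad ^+ 2.
pose G w := u^\+ (lsubmx w) - u^\+ (rsubmx w) -
  doubling_weight L rad (enorm (lsubmx w - rsubmx w)) -
  K * dot (lsubmx w - x0) (lsubmx w - x0).
have cub : cont_on (cball x0 rad) u^\+.
  by apply: cont_on_max0; exact: cont_onW cu.
have [m [mx my] mmax] := evt_pair (ltW rad0) (@cont_on_doubling _ _ _ L K cub).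
rewrite -/(G m) in mmax.
have x0r : cball x0 rad x0 by rewrite /cball /= enorm_center ltW.
have diam x y : cball x0 rad x -> cball x0 rad y -> enorm (x - y) <= 2 * rad.
  rewrite /cball /= => xr yr; have := enormD3 x x0 y; rewrite (enormB x0).
  by clear - xr yr; lra.
have wb x y : cball x0 rad x -> cball x0 rad y ->
    L * enorm (x - y) / 2 <= doubling_weight L rad (enorm (x - y)) <= L * enorm (x - y).
  by move=> xr yr; apply: doubling_weight_bounds => //; [exact: enorm_ge0|exact: diam].
have pair x y : cball x0 rad x -> cball x0 rad y ->
    u^\+ x - u^\+ y - doubling_weight L rad (enorm (x - y)) -
    K * dot (x - x0) (x - x0) <= G m.
  move=> xr yr; have := mmax (row_mx x y).
  by rewrite /= row_mxKl row_mxKr; apply.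
have G0 : 0 < G m.
  apply: lt_le_trans (pair x0 y0 x0r y0r); rewrite subrr dot0l mulr0.
  by have /andP[_] := wb x0 y0 x0r y0r; clear - bad; lra.
move: mx my G0 pair; rewrite /G; move: (lsubmx m) (rsubmx m) => x y xr yr G0 pair.
clear mmax G cub.
have uy0 : 0 <= u^\+ y := funrpos_ge0 u y.
have /andP[w1 w2] := wb x y xr yr; have e0 := enorm_ge0 (x - y).
have S0 : 0 <= S.
  rewrite leNgt; apply/negP => Sn.
  have ux0 : u^\+ x0 = 0 by rewrite /funrpos max_r//; have := uS _ x0r; clear - Sn; lra.
  have := funrpos_ge0 u y0; rewrite ux0 in bad; move: bad.
  have : 0 <= L * enorm (x0 - y0) by rewrite mulr_ge0 ?enorm_ge0// ltW.
  by clear; lra.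
have K0 : 0 <= K by apply: divr_ge0; [exact: mulr_ge0|exact: sqr_ge0].
have Kd0 : 0 <= K * dot (x - x0) (x - x0) by rewrite mulr_ge0// dot_ge0.
have Lw0 : 0 <= L * enorm (x - y) / 2 by rewrite divr_ge0// mulr_ge0// ltW.
have uxp : 0 < u^\+ x by clear - G0 uy0 w1 Kd0 Lw0; lra.
have ux : 0 < u x by move: uxp; rewrite /funrpos lt_max ltxx orbF.
have uxE : u^\+ x = u x by rewrite /funrpos max_l// ltW.
have uxS := uS _ xr; rewrite uxE in G0.
have Sp : 0 < S := lt_le_trans ux uxS.
have xx0 : enorm (x - x0) <= rad / 2.
  rewrite enorm_ler_sqr ?divr_ge0 ?(ltW rad0)//.
  have r2 : 0 < rad ^+ 2 by rewrite exprn_gt0.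
  have : K * dot (x - x0) (x - x0) <= S by clear - G0 uy0 w1 Lw0 uxS; lra.
  rewrite /K mulrAC ler_pdivrMr// => h1.
  by rewrite -(@ler_pM2l _ S)//; clear - h1; lra.
have xy4 : enorm (x - y) <= rad / 4.
  rewrite -(@ler_pM2l _ L)//.
  have : L * enorm (x - y) / 2 <= S by clear - G0 uy0 w1 Kd0 uxS; lra.
  have : 32 * S <= C0 * S by rewrite ler_wpM2r.
  by clear - CS S0; lra.
have xy : x != y.
  apply/eqP => xyE; move: G0; rewrite -xyE uxE (subrr x) enorm0 /doubling_weight.
  by rewrite expr0n mul0r subr0 mulr0; clear - Kd0; lra.
have r0 : 0 < enorm (x - y) by rewrite enorm_gt0 subr_eq0.
have xball a : enorm a <= rad / 4 -> cball x0 rad (x + a).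
  move=> ar; rewrite /cball /= addrAC; apply: le_trans (enormD _ _) _.
  by clear - xx0 ar rad0; lra.
have yball b : enorm b <= rad / 4 -> cball x0 rad (y + b).
  move=> br; rewrite /cball /= addrAC; apply: le_trans (enormD _ _) _.
  by have := enormD3 y x x0; rewrite (enormB y x); clear - xx0 br rad0 xy4; lra.
have rad4 : 0 < rad / 4 by rewrite divr_gt0.
have [uy|uy] := lerP (u y) 0.
  have uyE : u^\+ y = 0 by rewrite /funrpos max_r.
  have [] := @doubling_free_boundary _ _ u h x y L rad (enorm (x - y)) cu fbu L0 r0.
  - by clear - xy4 rad0; lra.
  - exact: enormB.
  - exact: ballB.
  - by [].
  - apply/near_eball; exists (rad / 4) => // z zy.
    have zr : cball x0 rad z.
      by have := yball (z - y) (ltW zy); rewrite addrC subrK.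
    split; first exact: ballB.
    have := pair x z xr zr; rewrite uyE uxE (enormB z x).
    by clear; lra.
  move=> fb hy; have := hL y fb yr; clear - hy; lra.
have uyE : u^\+ y = u y by rewrite /funrpos max_l// ltW.
have cur : cont_on (cball x0 rad) u by exact: cont_onW cu.
have subx : cball x (rad / 4) `<=` cball x0 rad.
  by move=> z zx; have := xball (z - x) zx; rewrite addrC subrK.
have suby : cball y (rad / 4) `<=` cball x0 rad.
  by move=> z zy; have := yball (z - y) zy; rewrite addrC subrK.
have [d1 /andP[d10 d1r] ux1] := cont_on_locally_pos cur ux rad4 subx.
have [d2 /andP[d20 d2r] uy2] := cont_on_locally_pos cur uy rad4 suby.
pose d := Num.min d1 d2; have d0 : 0 < d by rewrite lt_min d10.
have [dd1 dd2] : d <= d1 /\ d <= d2 by rewrite !ge_min !lexx orbT.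
have Ox : cball x d `<=` positivity_set (eball 0 1) u.
  move=> z zx; split; last by apply: ux1; exact: le_trans zx dd1.
  by apply: ballB; apply: subx; apply: le_trans zx _; exact: le_trans dd1 d1r.
have Oy : cball y d `<=` positivity_set (eball 0 1) u.
  move=> z zy; split; last by apply: uy2; exact: le_trans zy dd2.
  by apply: ballB; apply: suby; apply: le_trans zy _; exact: le_trans dd2 d2r.
apply: (@doubling_interior _ _ lam Lam alpha F u f _ x0 x y L S rad Ph C0 d
  (ltW lam0) A0 al0 C32 _ _ eF vs L0 lam0 _ S0 CS Ph0 CP d0 Ox Oy _ xx0 xy xy4).
- by rewrite lC -/A; clear - lam0; lra.
- by rewrite lC; clear - lam0 A0; lra.
- by rewrite rad0.
- by move=> z [Bz _]; exact: fP.
- by apply: cont_onW cu => z /Ox[].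
- by apply: cont_onW cu => z /Oy[].
- move=> a b ar br.
  have ax : cball x d (x + a) by rewrite /cball /= addrAC subrr add0r.
  have by' : cball y d (y + b) by rewrite /cball /= addrAC subrr add0r.
  have [_ uax] := Ox _ ax; have [_ uby] := Oy _ by'.
  have := pair (x + a) (y + b).
  rewrite uxE uyE /funrpos !(max_l (ltW _))//; apply.
    by apply: xball; apply: le_trans ar _; exact: le_trans dd1 d1r.
  by apply: yball; apply: le_trans br _; exact: le_trans dd2 d2r.
Qed.

End LipschitzPoint.

(** * Harnack inequality and linear growth *)

Section Harnack.
Context {R : realType} {n : nat}.
Implicit Types (x y z c v : 'rV[R]_n) (r s t d k m L S rad : R).
Implicit Types (lam Lam alpha Ph : R) (F : 'M[R]_n -> R) (u f : 'rV[R]_n -> R)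
  (q : nat).

(** [f] is bounded through [Ph^(1+alpha)] so that [Ph] can be compared directly with slopes. *)
Record viscosity_data lam Lam alpha F u f Ph : Prop := {
  vd_lam0 : 0 < lam;
  vd_lamLam : lam <= Lam;
  vd_alpha0 : 0 <= alpha;
  vd_elliptic : uniformly_elliptic lam Lam F;
  vd_F0 : F 0 = 0;
  vd_cont : cont_on (eball 0 1) u;
  vd_solution : visc_solution (positivity_set (eball 0 1) u) alpha F f u;
  vd_Ph0 : 0 <= Ph;
  vd_f : forall x, eball 0 1 x -> `|f x| <= Ph `^ (1 + alpha) }.

Lemma positive_ball_closure u z r x : cont_on (eball 0 1) u -> 0 < r -> cball z r `<=` eball 0 1 ->
  (forall y, enorm (y - z) < r -> 0 < u y) -> cball z r x -> 0 <= u x.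
Proof.
move=> cu r0 zB upos xr; rewrite leNgt; apply/negP => ux.
have ux' : 0 < - u x by rewrite oppr_gt0.
have [d d0 du] := cu _ (zB _ xr) _ ux'.
pose t := Num.min 1 (d / (2 * (r + 1))).
have r1 : 0 < 2 * (r + 1) by clear - r0; lra.
have t0 : 0 < t by rewrite lt_min ltr01 divr_gt0.
have [t1 td] : t <= 1 /\ 2 * (r + 1) * t <= d.
  split; first by rewrite ge_min lexx.
  have : t <= d / (2 * (r + 1)) by rewrite ge_min lexx orbT.
  by rewrite ler_pdivlMr// mulrC.
have tr0 := mulr_gt0 t0 r0.
pose y := x + (- t) *: (x - z); rewrite /cball /= in xr.
have yz : enorm (y - z) < r.
  have -> : y - z = (1 - t) *: (x - z) by rewrite /y addrAC scalerBl scale1r scaleNr.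
  rewrite enormZ ger0_norm; last by clear - t1; lra.
  have : (1 - t) * enorm (x - z) <= (1 - t) * r.
    by rewrite ler_wpM2l//; clear - t1; lra.
  by clear - tr0; lra.
have yx : enorm (y - x) < d.
  rewrite /y addrAC subrr add0r enormZ normrN gtr0_norm//.
  have : t * enorm (x - z) <= t * r by rewrite ler_pM2l.
  by clear - td tr0 t0; lra.
have := du y (zB _ (ltW yz)) yx; have := upos y yz.
by rewrite ltr_norml => h1 /andP[_]; clear - h1; lra.
Qed.

(** The value of [(17 - |y|^2)^(q+2)] on the inner sphere [|y| = 1]. With [17 = 4^2 + 1] the base
    lies in [[1, 16]] on the annulus [1 <= |y| <= 4], so its powers do not degenerate; subtracting
    [1] makes the barrier vanish on the outer sphere. *)
Definition barrier_scale q : R := 16 ^+ q.+2.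

Lemma barrier_scale_gt0 q : 0 < barrier_scale q.
Proof. exact: exprn_gt0. Qed.

(** The rescaled barrier is a strict subsolution: on the annulus its slope and [F] of its Hessian
    are both at least [m / barrier_scale q / s], a number exceeding [Ph]. The factor [64 = 4 * 16]
    bounds the identity part of the Hessian; [s <= 1] lets second derivatives dominate first
    ones. *)
Lemma barrier_rescaled_bounds lam Lam alpha F u f Ph q z s m x :
  viscosity_data lam Lam alpha F u f Ph -> 64 * (n%:R * Lam) + 1 <= lam * q.+1%:R ->
  0 < s -> s <= 1 -> 0 < m ->
  Ph < m / barrier_scale q / s -> s <= enorm (x - z) -> enorm (x - z) <= 4 * s ->
  let y := s^-1 *: (x - z) in
  let p := (m / barrier_scale q / s) *: barrier_grad q 17 y in
  let X := (m / barrier_scale q / s ^+ 2) *: barrier_hess q 17 y in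
  p != 0 /\ Ph `^ (1 + alpha) < enorm p `^ alpha * F X.
Proof.
move=> [lam0 lamLam al0 eF F0 _ _ Ph0 _] qlam s0 s1 m0 Pm xs xs4 y p X.
have Q0 := barrier_scale_gt0 q.
rewrite /p /X; set Q := barrier_scale q in Q0 Pm *; clear p X.
have k0 : 0 < m / Q / s by rewrite !divr_gt0.
have ye : enorm y = enorm (x - z) / s by rewrite enormZ gtr0_norm ?invr_gt0// mulrC.
have y1 : 1 <= enorm y by rewrite ye ler_pdivlMr// mul1r.
have y4 : enorm y <= 4 by rewrite ye ler_pdivrMr.
have yy : dot y y = enorm y ^+ 2 by rewrite sqr_enorm.
clearbody y.
have t1 : 1 <= 17 - dot y y by rewrite yy; clear - y1 y4; nra.
have t16 : 17 - dot y y <= 16 by rewrite yy; clear - y1; nra.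
have yy1 : 1 <= dot y y by rewrite yy; clear - y1; nra.
rewrite /barrier_grad /barrier_hess; set t := 17 - dot y y in t1 t16 *.
have tq1 : 1 <= t ^+ q by exact: exprn_ege1.
have tq2 : 1 <= t ^+ q.+1 by exact: exprn_ege1.
have q2 : 1 <= q.+2%:R :> R by rewrite ler1n.
have pe : m / Q / s <= enorm ((m / Q / s) *: (- (2 * q.+2%:R * t ^+ q.+1) *: y)).
  rewrite !enormZ gtr0_norm// ler_peMr ?(ltW k0)// normrN ger0_norm; last first.
    by rewrite mulr_ge0 ?(le_trans ler01 tq2)// mulr_ge0.
  have h1 : 1 <= q.+2%:R * t ^+ q.+1 by rewrite -[leLHS]mulr1 ler_pM.
  have : 1 <= q.+2%:R * t ^+ q.+1 * enorm y by rewrite -[leLHS]mulr1 ler_pM.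
  by move: (q.+2%:R : R) (t ^+ q.+1 : R) (enorm y) => a b E; clear; lra.
split; first by rewrite -enorm_gt0; exact: lt_le_trans pe.
have ks : m / Q / s <= m / Q / s ^+ 2.
  have -> : m / Q / s ^+ 2 = m / Q / s * s^-1.
    by field; rewrite (gt_eqF Q0) (gt_eqF s0).
  by rewrite ler_peMr ?(ltW k0)// invf_ge1.
have FX : m / Q / s <= F ((m / Q / s ^+ 2) *:
    ((q.+2%:R * t ^+ q) *: (q.+1%:R *: (y^T *m y) - (4 * t)%:M))).
  apply: le_trans ks _; set k := m / Q / s ^+ 2.
  have kk0 : 0 < k by rewrite /k !divr_gt0// exprn_gt0.
  pose B := q.+2%:R * t ^+ q : R.
  have B1 : 1 <= B by rewrite /B -[leLHS]mulr1 ler_pM.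
  have -> : k *: (B *: (q.+1%:R *: (y^T *m y) - (4 * t)%:M)) =
      (k * B * q.+1%:R) *: (y^T *m y) - (k * B * (4 * t))%:M.
    by rewrite scalerA scalerBr scalerA scale_scalar_mx.
  have c1 : 0 <= k * B * (4 * t).
    by apply: mulr_ge0; [exact: mulr_ge0 (ltW kk0) (le_trans ler01 B1)|exact: mulr_ge0 (ler0n _ 4) (le_trans ler01 t1)].
  have c2 : 0 <= k * B * q.+1%:R.
    by rewrite mulr_ge0//; exact: mulr_ge0 (ltW kk0) (le_trans ler01 B1).
  have := elliptic_rank_one y eF F0 c1 c2; apply: le_trans.
  have nL0 : 0 <= n%:R * Lam by rewrite mulr_ge0// (le_trans (ltW lam0)).
  have -> : lam * (k * B * q.+1%:R * dot y y) - n%:R * Lam * (k * B * (4 * t)) =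
    k * B * (lam * q.+1%:R * dot y y - n%:R * Lam * (4 * t)) by ring.
  rewrite -[leLHS]mulr1 -mulrA ler_pM2l//.
  have h1 : 1 <= lam * q.+1%:R * dot y y - n%:R * Lam * (4 * t).
    have := qlam; move: (lam * q.+1%:R) (n%:R * Lam) nL0 t16 yy1 => a b b0 t16 yy1 ab.
    have : b * t <= b * 16 by rewrite ler_wpM2l.
    have : a * 1 <= a * dot y y by rewrite ler_wpM2l//; clear - b0 ab; lra.
    by clear - ab; lra.
  by rewrite -[leLHS]mulr1 ler_pM.
have P1 : Ph `^ (1 + alpha) < (m / Q / s) `^ (1 + alpha).
  by apply: gt0_ltr_powR; rewrite ?nnegrE ?(ltW k0)//; apply: ltr_pwDl.
apply: (lt_le_trans P1); rewrite powRD; last by rewrite (gt_eqF k0) implybT.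
rewrite powRr1 ?(ltW k0)// mulrC; apply: ler_pM => //; rewrite ?powR_ge0 ?(ltW k0)//.
by apply: ge0_ler_powR; rewrite ?nnegrE ?(ltW k0) ?enorm_ge0.
Qed.

(** A positive maximum of the barrier minus [u] cannot lie on the inner sphere, where the barrier is
    less than [m], nor on the outer one, where it vanishes and [u >= 0] by continuity. In between
    the supersolution [u] would be touched from below by a strict subsolution. *)
Lemma barrier_below lam Lam alpha F u f Ph q z s m :
  viscosity_data lam Lam alpha F u f Ph -> 64 * (n%:R * Lam) + 1 <= lam * q.+1%:R ->
  0 < s -> s <= 1 -> 0 < m ->
  cball z (4 * s) `<=` eball 0 1 ->
  (forall x, enorm (x - z) < 4 * s -> 0 < u x) ->
  (forall x, cball z s x -> m <= u x) -> Ph < m / barrier_scale q / s ->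
  forall x, s <= enorm (x - z) -> enorm (x - z) <= 4 * s ->
    m / barrier_scale q * ((17 - (enorm (x - z) / s) ^+ 2) ^+ q.+2 - 1) <= u x.
Proof.
move=> vd qlam s0 s1 m0 zB upos um Pm x0 x0s x0s4; rewrite leNgt; apply/negP => bad.
have cu := vd_cont vd.
have bounds := barrier_rescaled_bounds vd qlam s0 s1 m0 Pm.
have Q0 := barrier_scale_gt0 q; set Q := barrier_scale q in Q0 bad bounds *.
have mQ : 0 < m / Q by rewrite divr_gt0.
pose b (t : R) := m / Q * ((17 - (t / s) ^+ 2) ^+ q.+2 - 1).
have cb : continuous b.
  move=> t; apply: cvgM; first exact: cvg_cst.
  apply: cvgB; last exact: cvg_cst.
  apply: (@continuous_comp _ _ _ (fun t : R => 17 - (t / s) ^+ 2) (@GRing.exp R ^~ q.+2)).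
    apply: cvgB; first exact: cvg_cst.
    apply: (@continuous_comp _ _ _ (fun t : R => t / s) (@GRing.exp R ^~ 2)).
      by apply: cvgM; [exact: cvg_id|exact: cvg_cst].
    exact: exprn_continuous.
  exact: exprn_continuous.
pose K : set 'rV[R]_n := cball z (4 * s) `&` [set y | s <= enorm (y - z)].
have KB : K `<=` eball 0 1 by move=> y [yz _]; exact: zB.
have cG : cont_on K (fun y => b (enorm (y - z)) - u y).
  apply: cont_onB; last exact: cont_onW cu.
  by apply: (@cont_on_comp _ _ K (fun y => enorm (y - z)) b cb); exact: cont_on_enormB.
have cK : closed K.
  by apply: closed_superlevel; [exact: closed_cball|exact: cont_on_enormB].
have K0 : K x0 by [].
have [x [xz xs] xmax] := evt_max (ex_intro _ x0 K0) cK (@subIsetl _ _ _) cG.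
have G0 : 0 < b (enorm (x - z)) - u x.
  by apply: lt_le_trans (xmax _ K0); rewrite subr_gt0.
rewrite /= in xs; rewrite /cball /= in xz.
have x4 : enorm (x - z) < 4 * s.
  rewrite lt_neqAle xz andbT; apply/eqP => xE; move: G0.
  rewrite xE /b mulfK ?gt_eqF// (_ : 17 - 4 ^+ 2 = 1); last by ring.
  rewrite expr1n subrr mulr0 sub0r oppr_gt0 ltNge.
  by rewrite (positive_ball_closure cu (_ : 0 < 4 * s) zB upos)// mulr_gt0.
have x1 : s < enorm (x - z).
  rewrite lt_neqAle xs andbT; apply/eqP => xE; move: G0.
  rewrite -xE /b divff ?gt_eqF// expr1n (_ : 17 - 1 = 16); last by ring.
  rewrite -[16 ^+ _]/Q mulrBr mulr1 divfK ?gt_eqF//.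
  have := um x; rewrite /cball /= -xE lexx => /(_ isT); clear - mQ; lra.
have ux := upos x x4.
have [] := bounds z x xs xz.
set y := s^-1 *: (x - z); set p := _ *: barrier_grad _ _ _; set X := _ *: _ => p0 big.
have yy : dot y y < 17.
  have -> : dot y y = (enorm (x - z) / s) ^+ 2.
    by rewrite -sqr_enorm enormZ gtr0_norm ?invr_gt0// mulrC.
  have : enorm (x - z) / s < 4 by rewrite ltr_pdivrMr.
  have : 0 <= enorm (x - z) / s by rewrite divr_ge0 ?enorm_ge0// ltW.
  by move: (enorm (x - z) / s) => t t0 t4; clear - t0 t4; nra.
have [r r0 rT] := barrier_taylor q yy.
pose r' := Num.min (s * r) (Num.min (4 * s - enorm (x - z)) (enorm (x - z) - s)).
have r'0 : 0 < r' by rewrite !lt_min mulr_gt0// !subr_gt0 x4 x1.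
have Px : positivity_set (eball 0 1) u x by split=> //; exact: zB.
have sX : X \is symmetricmx by rewrite symmetricZ// barrier_hess_sym.
have := @visc_super_quadratic _ _ _ _ _ _ _ x p X r' (vd_solution vd).2 Px sX p0 r'0.
have fx := le_trans (ler_norm (f x)) (vd_f vd (zB _ xz)).
move=> H; have /H : forall v, enorm v <= r' -> u x + dot p v + qf X v / 2 <= u (x + v).
  move=> v; rewrite !le_min => /andP[vr /andP[v1 v2]].
  have E : x + v - z = (x - z) + v by rewrite addrAC.
  have Kv : K (x + v).
    split; rewrite /cball /= E.
      by apply: le_trans (enormD _ _) _; clear - v1; lra.
    by have := enormD (x - z + v) (- v); rewrite addrK enormN; clear - v2; lra.
  have := xmax _ Kv; rewrite /b.
  have bE w : (17 - (enorm (w - z) / s) ^+ 2) = 17 - dot (s^-1 *: (w - z)) (s^-1 *: (w - z)).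
    by rewrite -sqr_enorm enormZ gtr0_norm ?invr_gt0// mulrC.
  rewrite !bE -/y (_ : s^-1 *: (x + v - z) = y + s^-1 *: v); last first.
    by rewrite E scalerDr.
  have sv : enorm (s^-1 *: v) <= r.
    by rewrite enormZ gtr0_norm ?invr_gt0// mulrC ler_pdivrMr// mulrC.
  have := ler_wpM2l (ltW mQ) (rT _ sv).
  rewrite (dotZr s^-1 _ v) (qfvZ _ s^-1 v) /p /X (dotZl _ _ v) qfZ => h1 h2.
  have -> : m / Q / s * dot (barrier_grad q 17 y) v =
      m / Q * (s^-1 * dot (barrier_grad q 17 y) v) by ring.
  have -> : m / Q / s ^+ 2 * qf (barrier_hess q 17 y) v =
      m / Q * (s^-1 ^+ 2 * qf (barrier_hess q 17 y) v).
    by rewrite exprVn; ring.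
  move: h1 h2; clear; move: ((17 - dot y y) ^+ q.+2) (_ ^+ q.+2) => a b; lra.
by move: big fx; clear; lra.
Qed.

(** The normalized barrier at [|y| = 2], where [17 - 4 = 13]: the factor lost by a lower bound when
    the radius of its ball is doubled. *)
Definition barrier_ratio q : R := (13 ^+ q.+2 - 1) / barrier_scale q.

Lemma barrier_ratioP q : 0 < barrier_ratio q /\ barrier_ratio q <= 1.
Proof.
have Q0 := barrier_scale_gt0 q; set Q := barrier_scale q in Q0 *.
rewrite /barrier_ratio; have h1 : 1 < 13 ^+ q.+2 :> R by rewrite exprn_egt1// ltr1n.
have h2 : 13 ^+ q.+2 <= Q by rewrite lerXn2r ?nnegrE// ler_nat.
by split; [rewrite divr_gt0// subr_gt0|rewrite ler_pdivrMr// mul1r lerBlDr (le_trans h2)// lerDl].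
Qed.

Lemma positivity_spread lam Lam alpha F u f Ph q z s m :
  viscosity_data lam Lam alpha F u f Ph -> 64 * (n%:R * Lam) + 1 <= lam * q.+1%:R ->
  0 < s -> s <= 1 -> 0 < m ->
  cball z (4 * s) `<=` eball 0 1 ->
  (forall x, enorm (x - z) < 4 * s -> 0 < u x) ->
  (forall x, cball z s x -> m <= u x) -> Ph < m / barrier_scale q / s ->
  forall x, cball z (2 * s) x -> barrier_ratio q * m <= u x.
Proof.
move=> vd qlam s0 s1 m0 zB upos um Pm x xs2; have [th0 th1] := barrier_ratioP q.
have [xs|xs] := lerP (enorm (x - z)) s.
  by apply: le_trans (um x xs); rewrite ler_piMl// ltW.
rewrite /cball /= in xs2.
have xs4 : enorm (x - z) <= 4 * s by clear - xs2 s0; lra.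
apply: le_trans (barrier_below vd qlam s0 s1 m0 zB upos um Pm (ltW xs) xs4).
rewrite /barrier_ratio; have Q0 := barrier_scale_gt0 q.
set Q := barrier_scale q in Q0 *.
rewrite mulrAC [(_ - 1) * m]mulrC mulrAC ler_pM2l ?divr_gt0//.
rewrite lerD2r lerXn2r ?nnegrE//.
  have : enorm (x - z) / s <= 2 by rewrite ler_pdivrMr.
  have : 0 <= enorm (x - z) / s by rewrite divr_ge0 ?enorm_ge0// ltW.
  by move: (enorm (x - z) / s) => t t0 t4; clear - t0 t4; nra.
have : enorm (x - z) / s <= 2 by rewrite ler_pdivrMr.
have : 0 <= enorm (x - z) / s by rewrite divr_ge0 ?enorm_ge0// ltW.
by move: (enorm (x - z) / s) => t t0 t4; clear - t0 t4; nra.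
Qed.

(** The base [17 - |y|^2] is at least [1] on the annulus, so its power dominates it. This replaces
    the barrier by a paraboloid, the shape that [free_boundary_slope] tests with. *)
Lemma barrier_paraboloid lam Lam alpha F u f Ph q z s m :
  viscosity_data lam Lam alpha F u f Ph -> 64 * (n%:R * Lam) + 1 <= lam * q.+1%:R ->
  0 < s -> s <= 1 -> 0 < m ->
  cball z (4 * s) `<=` eball 0 1 ->
  (forall x, enorm (x - z) < 4 * s -> 0 < u x) ->
  (forall x, cball z s x -> m <= u x) -> Ph < m / barrier_scale q / s ->
  forall x, s <= enorm (x - z) -> enorm (x - z) <= 4 * s ->
    m / barrier_scale q / s ^+ 2 * ((4 * s) ^+ 2 - dot (x - z) (x - z)) <= u x.
Proof.
move=> vd qlam s0 s1 m0 zB upos um Pm x xs xs4.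
have Q0 := barrier_scale_gt0 q.
apply: le_trans (barrier_below vd qlam s0 s1 m0 zB upos um Pm xs xs4).
rewrite -sqr_enorm -mulrA ler_pM2l ?divr_gt0//.
have -> : (s ^+ 2)^-1 * ((4 * s) ^+ 2 - enorm (x - z) ^+ 2) =
    (17 - (enorm (x - z) / s) ^+ 2) - 1.
  by field; rewrite gt_eqF.
rewrite lerD2r; apply: ler_eXnr => //.
have : enorm (x - z) / s <= 4 by rewrite ler_pdivrMr.
have : 0 <= enorm (x - z) / s by rewrite divr_ge0 ?enorm_ge0// ltW.
by move: (enorm (x - z) / s) => t t0 t4; clear - t0 t4; nra.
Qed.

End Harnack.

Section HarnackInequality.
Context {R : realType} {n : nat}.
Implicit Types (x y z c v : 'rV[R]_n) (r s t d m L S rad rho A H : R)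
  (lam Lam alpha Ph : R) (F : 'M[R]_n -> R) (u f h : 'rV[R]_n -> R) (q k l j : nat).

(** Otherwise each [z] would be followed by a point within [rho / 2^k] where [u] is more than [A]
    times larger. The steps sum to less than [2 rho], so [u] would be unbounded on a compact
    ball. *)
Lemma exists_doubling_point u x0 rho A : 2 <= A -> 0 < rho ->
  cont_on (cball x0 (2 * rho)) u -> 0 < u x0 ->
  exists k z, [/\ enorm (z - x0) <= 2 * rho, A ^+ k * u x0 <= u z &
    forall y, cball z (rho / 2 ^+ k) y -> u y <= A * u z].
Proof.
move=> A2 rho0 cu ux0; apply: contrapT => none.
have step k : exists2 z, enorm (z - x0) <= 2 * rho * (1 - (2 ^+ k)^-1) &
    A ^+ k * u x0 <= u z.
  elim: k => [|k [z zx uz]].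
    by exists x0; rewrite ?enorm_center expr0 ?invr1 ?subrr ?mulr0 ?mul1r.
  have p0 : 0 < (2 ^+ k)^-1 :> R by rewrite invr_gt0 exprn_gt0.
  have [[y [yz uy]]|good] := pselect (exists y, cball z (rho / 2 ^+ k) y /\ A * u z < u y).
    exists y.
      have := enormD3 y z x0; rewrite exprS invfM; rewrite /cball /= in yz.
      by clear - yz zx p0; lra.
    rewrite exprS -mulrA; apply: le_trans (ltW uy).
    by rewrite ler_wpM2l//; clear - A2; lra.
  case: none; exists k, z; split=> //.
    have := mulr_gt0 rho0 p0; clear - zx; lra.
  by move=> y yz; rewrite leNgt; apply/negP => uy; apply: good; exists y.
have r0 : 0 <= 2 * rho by clear - rho0; lra.
have [m _ um] := evt_cball r0 cu.
(* For this [k] the maximum satisfies [u m < (k + 1) u x0 <= 2^(k+1) u x0 <= A^(k+1) u x0]. *)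
pose k := Num.truncn (u m / u x0); have [z zx uz] := step k.+1.
have zr : cball x0 (2 * rho) z.
  have p0 : 0 < (2 ^+ k.+1)^-1 :> R by rewrite invr_gt0 exprn_gt0.
  have := mulr_gt0 rho0 p0; rewrite /cball /=; clear - zx; lra.
have := um z zr; apply/negP; rewrite -ltNge; apply: lt_le_trans uz.
have kl : u m < k.+1%:R * u x0 by rewrite -ltr_pdivrMr// /k truncnS_gt.
apply: (lt_le_trans kl); rewrite ler_pM2r//.
apply: (@le_trans _ _ (2 ^+ k.+1)).
  by rewrite -natrX ler_nat; exact: ltnW (ltn_expl _ _).
by rewrite lerXn2r ?nnegrE//; clear - A2; lra.
Qed.

(** Iterates [positivity_spread]. The last doubling starts from the radius [2^(J-1) s] and uses a
    ball four times as large; the smallness of [Ph] is asked there, where the radius is largest and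
    the bound weakest, and covers the earlier doublings. *)
Lemma positivity_chain lam Lam alpha F u f Ph q z s m J :
  viscosity_data lam Lam alpha F u f Ph -> 64 * (n%:R * Lam) + 1 <= lam * q.+1%:R ->
  0 < s -> 0 < m -> (forall x, cball z s x -> m <= u x) ->
  (0 < J)%N -> 2 ^+ J.-1 * s <= 1 ->
  cball z (4 * (2 ^+ J.-1 * s)) `<=` eball 0 1 ->
  (forall x, enorm (x - z) < 4 * (2 ^+ J.-1 * s) -> 0 < u x) ->
  Ph < barrier_ratio q ^+ J * m / barrier_scale q / (2 ^+ J.-1 * s) ->
  forall j, (j <= J)%N -> forall x, cball z (2 ^+ j * s) x ->
    barrier_ratio q ^+ j * m <= u x.
Proof.
move=> vd qlam s0 m0 um J0 s1 zB upos Pm; have [th0 th1] := @barrier_ratioP R q.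
have Q0 := @barrier_scale_gt0 R q.
elim=> [|j IH] jJ x; first by rewrite expr0 !mul1r; exact: um.
have sj0 : 0 < 2 ^+ j * s :> R by rewrite mulr_gt0// exprn_gt0.
have sJ : 2 ^+ j * s <= 2 ^+ J.-1 * s :> R.
  by rewrite ler_pM2r// ler_weXn2l ?ler1n// -ltnS prednK.
have mj0 : 0 < barrier_ratio q ^+ j * m by rewrite mulr_gt0// exprn_gt0.
rewrite exprS -mulrA (exprS _ j) -mulrA.
apply: (positivity_spread vd qlam sj0 (le_trans sJ s1) mj0).
- move=> y yz; apply: zB; apply: le_trans yz _; clear - sJ; lra.
- move=> y yz; apply: upos; apply: lt_le_trans yz _; clear - sJ; lra.
- by apply: IH; exact: ltnW.
- apply: lt_le_trans Pm _; apply: ler_pM.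
  + by rewrite !mulr_ge0 ?invr_ge0 ?exprn_ge0 ?(ltW th0) ?(ltW m0) ?(ltW Q0).
  + by rewrite invr_ge0 mulr_ge0 ?exprn_ge0 ?(ltW s0).
  + rewrite ler_pM2r ?invr_gt0// ler_pM2r//.
    by rewrite ler_wiXn2l ?(ltW th0)// ltnW.
  + by rewrite lef_pV2 ?posrE ?mulr_gt0 ?exprn_gt0.
Qed.

Lemma exists_barrier_exponent lam Lam : 0 < lam ->
  exists q, 64 * (n%:R * Lam) + 1 <= lam * q.+1%:R.
Proof.
move=> lam0; exists (Num.truncn ((64 * (n%:R * Lam) + 1) / lam)).
by rewrite [leRHS]mulrC -ler_pdivrMr//; exact: ltW (truncnS_gt _).
Qed.

Lemma exists_dyadic_above (a : R) : exists l, a <= 2 ^+ l.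
Proof.
exists (Num.truncn a).+1; apply: le_trans (ltW (truncnS_gt a)) _.
by rewrite -natrX ler_nat; exact: ltnW (ltn_expl _ _).
Qed.

(* No weak Harnack inequality is needed: near a point where [u] is at most
   [A] times its value in a ball, the Lipschitz estimate makes [u] comparable
   to its value in a fraction of that ball, and barriers propagate the lower
   bound. Since [A] exceeds the inverse of the loss of one doubling step of the
   barrier, it does not matter how small the ball is. *)
Lemma harnack lam Lam alpha : 0 < lam -> lam <= Lam -> 0 <= alpha ->
  exists c C1 : R, [/\ 0 < c, c <= 1, 0 <= C1 &
  forall F u f h Ph x0 d,
    viscosity_data lam Lam alpha F u f Ph -> visc_free_boundary_le u h ->
    0 < d <= 1 -> cball x0 d `<=` eball 0 1 ->
    (forall x, enorm (x - x0) < d -> 0 < u x) ->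
    forall x, enorm (x - x0) <= 5 / 16 * d -> c * u x0 <= u x + C1 * d * Ph].
Proof.
move=> lam0 lamLam al0.
have [C0 C01 lipC] := @lipschitz_at_center R n lam Lam alpha lam0 lamLam al0.
have [q qlam] := exists_barrier_exponent Lam lam0.
have [th0 th1] := @barrier_ratioP R q; have Q0 := @barrier_scale_gt0 R q.
set th := barrier_ratio q in th0 th1; set Q := barrier_scale q in Q0.
pose A := 2 / th; have A2 : 2 <= A by rewrite ler_pdivlMr// ler_piMr.
have Ath : A * th = 2 by rewrite divfK// gt_eqF.
have [l lC] := exists_dyadic_above (2 * (C0 * (A + 1))).
pose c := th ^+ (l + 4) / 2.
have c0 : 0 < c by rewrite divr_gt0// exprn_gt0.
have c1 : c <= 1.
  rewrite ler_pdivrMr// mul1r; apply: le_trans (_ : 1 <= 2); last by rewrite ler1n.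
  by rewrite exprn_ile1// ltW.
have C10 : 0 < Q / c by rewrite divr_gt0.
exists c, (Q / c); split=> //; first exact: ltW.
move=> F u f h Ph x0 d vd fbu /andP[d0 d1] xB upos x xd.
have Ph0 := vd_Ph0 vd; have cu := vd_cont vd.
have ux0 : 0 < u x0 by apply: upos; rewrite enorm_center.
have ux : 0 < u x by apply: upos; clear - xd d0; lra.
have CdP : 0 <= Q / c * d * Ph by rewrite mulr_ge0// ltW// mulr_gt0.
(* Below the threshold the term in [Ph] alone dominates [c * u x0]. Above it [Ph] is small enough
   for all the barriers of the chain to be strict subsolutions. *)
have [small|large] := lerP (u x0) (Q / c * d * Ph).
  have : c * u x0 <= u x0 by rewrite ler_piMl// ltW.
  by clear - small ux; lra.
have Pc : Ph < c * u x0 / Q / d.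
  rewrite ltr_pdivlMr// ltr_pdivlMr// -ltr_pdivrMl//.
  by rewrite (_ : c^-1 * _ = Q / c * d * Ph)//; ring.
(* The chain ends with the ball of radius [16 rho = 3/8 d] around some [z] with
   [|z - x0| <= 2 rho = 3/64 d]. It covers the radius [5/16 d] around [x0], while the largest ball
   used by the barriers, of radius [32 rho = 3/4 d], stays in the given one. *)
pose rho := 3 / 128 * d; have rho0 : 0 < rho by rewrite mulr_gt0// divr_gt0.
have rhoE : rho = 3 / 128 * d by [].
have cr : cont_on (cball x0 (2 * rho)) u.
  apply: cont_onW cu => y yx; apply: xB; apply: le_trans yx _.
  by clear - d0 rhoE; lra.
have [k [z [zx uz uA]]] := exists_doubling_point A2 rho0 cr ux0.
clearbody rho; pose rk := rho / 2 ^+ k; have k2 : 0 < 2 ^+ k :> R by rewrite exprn_gt0.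
have rk0 : 0 < rk by rewrite divr_gt0.
have rkr : rk <= rho by rewrite ler_pdivrMr// ler_peMr ?(ltW rho0)// exprn_ege1// ler1n.
have Ak1 : 1 <= A ^+ k by rewrite exprn_ege1//; clear - A2; lra.
have uzx : u x0 <= u z by apply: le_trans uz; rewrite ler_peMl// ltW.
have m0 : 0 < u z := lt_le_trans ux0 uzx.
have ball_in y t : enorm (y - z) <= t -> t <= 7 / 8 * d -> enorm (y - x0) < d.
  by move=> yz td; have := enormD3 y z x0; clear - yz td zx rhoE d0; lra.
have ballB y t : enorm (y - z) <= t -> t <= 7 / 8 * d -> eball 0 1 y.
  by move=> yz td; apply: xB; rewrite /cball /=; exact: ltW (ball_in _ _ yz td).
have rk7 : rk <= 7 / 8 * d by clear - rkr rhoE d0; lra.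
pose L := C0 * (A * u z / rk + Ph).
have A0 : 0 < A by clear - A2; lra.
have C00 : 0 < C0 by clear - C01; lra.
have Lz : 0 < A * u z / rk by rewrite divr_gt0// mulr_gt0.
have L0 : 0 < L by rewrite mulr_gt0//; clear - Lz Ph0; lra.
have PhL : Ph <= u z / rk.
  apply: (le_trans (ltW Pc)); rewrite ler_pM ?invr_ge0 ?(ltW d0)//.
  - by rewrite mulr_ge0 ?invr_ge0 ?(ltW Q0)// mulr_ge0// ltW.
  - apply: le_trans uzx; rewrite ler_pdivrMr//.
    have Q1 : 1 <= Q by rewrite exprn_ege1// ler1n.
    have : c * u x0 <= 1 * u x0 by rewrite ler_pM2r.
    have : u x0 * 1 <= u x0 * Q by rewrite ler_pM2l.
    by clear; lra.
  - by rewrite lef_pV2 ?posrE//; clear - rkr rhoE d0; lra.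
(* The Lipschitz constant on the ball of radius [rk] is at most [C0 (A + 1) u z / rk]; over a
   distance [rk / 2^l] it costs no more than half of [u z]. *)
have lower y : cball z (rk / 2 ^+ l) y -> u z / 2 <= u y.
  move=> yz; have l2 : 0 < 2 ^+ l :> R by rewrite exprn_gt0.
  have rkl : rk / 2 ^+ l <= rk.
    by rewrite ler_pdivrMr// ler_peMr ?(ltW rk0)// exprn_ege1// ler1n.
  have yrk : cball z rk y by apply: le_trans yz rkl.
  have rk1 : 0 < rk <= 1 by rewrite rk0; clear - rkr rhoE d0 d1; lra.
  have := lipC F u f h z rk (A * u z) Ph L (vd_elliptic vd) cu (vd_solution vd) fbu rk1.
  move=> /(_ (fun y yr => ballB y rk yr rk7) uA Ph0 (vd_f vd) L0).
  have h1 : C0 * (A * u z) <= L * rk.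
    rewrite /L -[leRHS]mulrA ler_pM2l// mulrDl divfK ?gt_eqF// lerDl.
    by rewrite mulr_ge0// ltW.
  have h2 : C0 * Ph <= L by rewrite /L ler_pM2l//; clear - Lz; lra.
  have h3 w : free_boundary (eball 0 1) u w -> cball z rk w -> h w < L / 2.
    move=> /(free_boundaryP cu) uw wz; have := upos w (ball_in _ _ wz rk7).
    by rewrite ltNge uw.
  move=> /(_ h1 h2 h3 y yrk).
  have uy : 0 < u y := upos y (ball_in _ _ yrk rk7).
  rewrite {1 2}/funrpos !max_l ?(ltW m0) ?(ltW uy)// enormB => uzy.
  have LL : L <= C0 * (A + 1) * (u z / rk).
    rewrite /L -[leRHS]mulrA ler_pM2l// mulrDl mul1r -mulrA.
    by clear - PhL; lra.
  have : L * enorm (y - z) <= C0 * (A + 1) * (u z / rk) * (rk / 2 ^+ l).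
    apply: ler_pM => //; [exact: ltW|exact: enorm_ge0].
  have -> : C0 * (A + 1) * (u z / rk) * (rk / 2 ^+ l) = C0 * (A + 1) * u z / 2 ^+ l.
    by field; rewrite (gt_eqF l2) (gt_eqF rk0).
  have : C0 * (A + 1) * u z / 2 ^+ l <= u z / 2.
    rewrite ler_pdivrMr//; have : 2 * (C0 * (A + 1)) * u z <= 2 ^+ l * u z.
      by rewrite ler_pM2r.
    by clear; lra.
  by clear - uzy; lra.
(* [k + l] doublings lead from [rk / 2^l] back to [rho], and four more to [16 rho]. *)
pose J := (k + l + 4)%N.
have J0 : (0 < J)%N by rewrite /J addnS.
have sJ : 2 ^+ J.-1 * (rk / 2 ^+ l) = 8 * rho.
  have -> : J.-1 = (k + l + 3)%N by rewrite /J addnS.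
  by rewrite !exprD /rk; field; rewrite !expf_neq0.
have m2 : 0 < u z / 2 by rewrite divr_gt0.
have s0 : 0 < rk / 2 ^+ l by rewrite divr_gt0// exprn_gt0.
(* The growth [A^k] in [u z] pays for [k] of the factors [th], as [A * th = 2]; the other [l + 4]
   factors and the [1/2] make up [c], which does not depend on [k]. *)
have thJ : c * u x0 <= th ^+ J * (u z / 2).
  have e1 : th ^+ k * (A ^+ k * u x0) <= th ^+ k * u z by rewrite ler_pM2l// exprn_gt0.
  have e2 : 1 <= th ^+ k * A ^+ k.
    by rewrite -exprMn mulrC Ath exprn_ege1// ler1n.
  have e3 : u x0 <= th ^+ k * u z.
    by apply: le_trans e1; rewrite mulrA ler_peMl// ltW.
  rewrite /c /J -addnA (exprD _ k).
  have tl : 0 < th ^+ (l + 4) by rewrite exprn_gt0.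
  have := ler_wpM2l (ltW tl) e3; move: (th ^+ (l + 4)) (th ^+ k) => a b.
  by clear; lra.
have chain := @positivity_chain lam Lam alpha F u f Ph q z _ _ J vd qlam s0 m2 lower J0.
rewrite sJ in chain.
have := chain _ _ _ _ J (leqnn J) x.
have -> : 2 ^+ J * (rk / 2 ^+ l) = 16 * rho.
  by rewrite -(prednK J0) exprS -mulrA sJ; ring.
move=> /(_ _ _ _ _ _); rewrite -/th => concl.
suff : th ^+ J * (u z / 2) <= u x by clear - thJ CdP; lra.
apply: concl.
- by clear - rhoE d0 d1; lra.
- by move=> y yz; apply: ballB yz _; clear - rhoE d0; lra.
- by move=> y yz; apply: upos; apply: ball_in (ltW yz) _; clear - rhoE d0; lra.
- apply: (lt_le_trans Pc); apply: ler_pM.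
  + by rewrite mulr_ge0 ?invr_ge0 ?(ltW Q0)// mulr_ge0// ltW.
  + by rewrite invr_ge0 ltW.
  + by rewrite ler_pM2r ?invr_gt0.
  + by rewrite lef_pV2 ?posrE; clear - rhoE d0; lra.
- have := enormD3 x x0 z; rewrite (enormB x0 z) /cball /=.
  by clear - xd zx rhoE d0; lra.
Qed.

End HarnackInequality.

(** * Growth from the free boundary and one-sided Lipschitz bounds *)

Section OneSidedBounds.
Context {R : realType} {n : nat}.
Implicit Types (x y z v : 'rV[R]_n) (r s t d m L S rad H : R)
  (lam Lam alpha Ph : R) (F : 'M[R]_n -> R) (u f h : 'rV[R]_n -> R) (q : nat).

(** Since [0] competes in the minimization, the distance is at most [|x0| < 1/2], which keeps the
    ball inside the unit ball. *)
Lemma nearest_zero u x0 : cont_on (eball 0 1) u -> u 0 <= 0 ->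
  enorm x0 < 1 / 2 -> 0 < u x0 ->
  exists y0 d, [/\ 0 < d <= enorm x0, enorm (y0 - x0) = d, u y0 <= 0,
    cball x0 d `<=` eball 0 1 & forall x, enorm (x - x0) < d -> 0 < u x].
Proof.
move=> cu u00 x02 ux0.
have ballB d : d <= enorm x0 -> cball x0 d `<=` eball 0 1.
  move=> dx x; rewrite /cball /eball /= subr0 => xx; have := enormD (x - x0) x0.
  by rewrite subrK; clear - xx dx x02; lra.
pose K := cball x0 (enorm x0) `&` [set x | 0 <= - u x].
have cK : closed K.
  apply: closed_superlevel; first exact: closed_cball.
  by apply: cont_onN; apply: cont_onW cu; exact: ballB.
have K0 : K 0 by split; rewrite /cball /= ?sub0r ?enormN// oppr_ge0.
have cd : cont_on K (fun x => - enorm (x - x0)).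
  by apply: cont_onN; exact: cont_on_enormB.
have [y0 [y0r y0u] ymax] := evt_max (ex_intro _ 0 K0) cK (@subIsetl _ _ _) cd.
rewrite /= oppr_ge0 in y0u; rewrite /cball /= in y0r.
exists y0, (enorm (y0 - x0)); split=> //; last 1 first.
- move=> x xd; rewrite ltNge; apply/negP => ux.
  have Kx : K x by split; [exact: le_trans (ltW xd) y0r|rewrite /= oppr_ge0].
  by have := ymax x Kx; rewrite lerN2 leNgt xd.
- rewrite y0r andbT enorm_gt0 subr_eq0; apply/eqP => y0E.
  by move: y0u; rewrite y0E leNgt ux0.
- exact: ballB.
Qed.

Lemma nearest_zero_free_boundary u x0 y0 d : 0 < d -> enorm (y0 - x0) = d ->
  u y0 <= 0 -> cball x0 d `<=` eball 0 1 ->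
  (forall x, enorm (x - x0) < d -> 0 < u x) ->
  free_boundary (eball 0 1) u y0.
Proof.
move=> d0 y0d uy0 xB upos; apply: free_boundaryI => //.
  by apply: xB; rewrite /cball /= y0d.
move=> e e0; pose t := Num.min (1 / 2) (e / (2 * d)).
have t0 : 0 < t by rewrite lt_min !divr_gt0// mulr_gt0.
have [t2 te] : t <= 1 / 2 /\ t * (2 * d) <= e.
  split; first by rewrite ge_min lexx.
  have : t <= e / (2 * d) by rewrite ge_min lexx orbT.
  by rewrite ler_pdivlMr// mulr_gt0.
have td0 := mulr_gt0 t0 d0.
pose z := y0 + (- t) *: (y0 - x0).
have zx : enorm (z - x0) < d.
  have -> : z - x0 = (1 - t) *: (y0 - x0) by rewrite /z addrAC scalerBl scale1r scaleNr.
  by rewrite enormZ gtr0_norm ?y0d; clear - t2 td0; lra.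
exists z; split; [by apply: xB; exact: ltW|exact: upos|].
by rewrite /z addrAC subrr add0r enormZ normrN gtr0_norm// y0d; clear - te td0; lra.
Qed.

Lemma linear_growth lam Lam alpha : 0 < lam -> lam <= Lam -> 0 <= alpha ->
  exists2 C2 : R, 0 <= C2 & forall F u f h Ph H x0 y0 d,
    viscosity_data lam Lam alpha F u f Ph -> visc_free_boundary_le u h ->
    0 <= H -> (forall x, free_boundary (eball 0 1) u x -> h x <= H) ->
    0 < d <= 1 -> enorm (y0 - x0) = d -> u y0 <= 0 ->
    cball x0 d `<=` eball 0 1 -> (forall x, enorm (x - x0) < d -> 0 < u x) ->
    u x0 <= C2 * d * (H + Ph).
Proof.
move=> lam0 lamLam al0.
have [c [C1 [c0 c1 C10 har]]] := @harnack R n lam Lam alpha lam0 lamLam al0.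
have [q qlam] := @exists_barrier_exponent R n lam Lam lam0.
have Q0 := @barrier_scale_gt0 R q; set Q := barrier_scale q in Q0.
exists ((C1 + Q) / c); first by rewrite divr_ge0 ?(ltW c0)// addr_ge0// ltW.
move=> F u f h Ph H x0 y0 d vd fbu H0 hH d01 y0d uy0 xB upos.
have /andP[d0 d1] := d01; have Ph0 := vd_Ph0 vd.
pose m := c * u x0 - C1 * d * Ph.
(* [d / 4] is within the range [5/16 d] of the Harnack inequality, and a barrier starting at radius
   [d / 4] vanishes on the sphere of radius [d], which contains [y0]. *)
have um x : cball x0 (d / 4) x -> m <= u x.
  move=> xd; have := har F u f h Ph x0 d vd fbu d01 xB upos x.
  rewrite /cball /= in xd; have xd' : enorm (x - x0) <= 5 / 16 * d.
    by clear - xd d0; lra.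
  by move=> /(_ xd'); rewrite /m; clear; lra.
suff mQ : m <= Q * d * (H + Ph).
  rewrite -(@ler_pM2l _ c)//.
  have -> : c * ((C1 + Q) / c * d * (H + Ph)) = (C1 + Q) * d * (H + Ph).
    by field; rewrite gt_eqF.
  have : 0 <= C1 * d * H by rewrite !mulr_ge0// ltW.
  by move: mQ; rewrite /m; clear; lra.
have QH : 0 <= Q * d * H := mulr_ge0 (ltW (mulr_gt0 Q0 d0)) H0.
have QP : 0 <= Q * d * Ph := mulr_ge0 (ltW (mulr_gt0 Q0 d0)) Ph0.
have s0 : 0 < d / 4 by rewrite divr_gt0.
(* When the slope of the barrier does not exceed [Ph], this already bounds [m] by a multiple of
   [d * Ph]. *)
have [mP|mP] := lerP (m / Q / (d / 4)) Ph.
  move: mP; rewrite !ler_pdivrMr// => mP.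
  by clear - mP QH QP; lra.
have m0 : 0 < m.
  have : 0 < m / Q / (d / 4) := le_lt_trans Ph0 mP.
  by rewrite !pmulr_lgt0 ?invr_gt0.
have d4 : 4 * (d / 4) = d by field.
have s1 : d / 4 <= 1 by clear - d0 d1; lra.
have := @barrier_paraboloid _ _ lam Lam alpha F u f Ph q x0 (d / 4) m vd qlam s0 s1 m0.
rewrite d4 => /(_ xB upos um mP) para.
have fy0 := nearest_zero_free_boundary d0 y0d uy0 xB upos.
have k0 : 0 < m / Q / (d / 4) ^+ 2 by rewrite !divr_gt0// exprn_gt0.
have := free_boundary_slope fbu fy0 uy0 k0 d0 y0d.
have touch : \forall y \near y0, m / Q / (d / 4) ^+ 2 * d ^+ 2 -
    m / Q / (d / 4) ^+ 2 * dot (y - x0) (y - x0) <= u^\+ y.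
  apply/near_eball; exists (3 / 4 * d); first by rewrite mulr_gt0// divr_gt0.
  move=> y yy; rewrite /eball /= in yy; rewrite -mulrBr.
  have [yd|yd] := lerP (enorm (y - x0)) d.
    have ys : d / 4 <= enorm (y - x0).
      by have := enormD3 y0 y x0; rewrite y0d (enormB y0 y); clear - yy; lra.
    apply: le_trans (para y ys yd) _; by rewrite /funrpos le_max lexx.
  apply: (@le_trans _ _ 0); last exact: funrpos_ge0.
  rewrite pmulr_rle0// -sqr_enorm subr_le0 lerXn2r ?nnegrE ?enorm_ge0 ?(ltW d0)//.
  exact: ltW.
move=> /(_ touch) slope; have := le_trans slope (hH _ fy0).
have -> : 2 * (m / Q / (d / 4) ^+ 2) * d = m * 32 / (Q * d).
  by field; rewrite (gt_eqF d0) (gt_eqF Q0).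
rewrite ler_pdivrMr; last exact: mulr_gt0 Q0 d0.
move=> mH.
by clear - mH QH QP; lra.
Qed.

(** [linear_growth] bounds [u] at the single point [x0], whereas [lipschitz_at_center] needs a bound
    on a ball. The Harnack inequality supplies it, used in balls centered at the nearby points [x]
    and evaluated at [x0]. *)
Lemma lipschitz_from_free_boundary lam Lam alpha :
  0 < lam -> lam <= Lam -> 0 <= alpha ->
  exists2 C : R, 0 <= C & forall F u f h Ph H x0,
    viscosity_data lam Lam alpha F u f Ph -> visc_free_boundary_le u h ->
    0 <= H -> (forall x, free_boundary (eball 0 1) u x -> h x <= H) ->
    u 0 <= 0 -> eball 0 (1 / 2) x0 -> 0 < u x0 ->
    exists2 r : R, 0 < r & forall y, cball x0 r y ->
      u^\+ x0 - u^\+ y <= C * (H + Ph) * enorm (x0 - y).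
Proof.
move=> lam0 lamLam al0.
have [c [C1 [c0 c1 C10 har]]] := @harnack R n lam Lam alpha lam0 lamLam al0.
have [C2 C20 growth] := linear_growth lam0 lamLam al0.
have [C0 C01 lipC] := @lipschitz_at_center R n lam Lam alpha lam0 lamLam al0.
have C00 : 0 < C0 by clear - C01; lra.
pose B := (C1 + C2) / c; have B0 : 0 <= B by rewrite divr_ge0 ?addr_ge0// ltW.
exists (C0 * (6 * B + 1)); first by rewrite mulr_ge0 ?(ltW C00)//; clear - B0; lra.
move=> F u f h Ph H x0 vd fbu H0 hH u00; rewrite /eball /= subr0 => x02 ux0.
have cu := vd_cont vd; have Ph0 := vd_Ph0 vd.
have [y0 [d [/andP[d0 dx] y0d uy0 xB upos]]] := nearest_zero cu u00 x02 ux0.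
have d1 : d <= 1 by clear - dx x02; lra.
have ux0S : u x0 <= C2 * d * (H + Ph).
  by apply: (growth F u f h Ph H x0 y0 d) => //; rewrite d0.
have HP0 : 0 < H + Ph.
  rewrite lt0r addr_ge0// andbT; apply/eqP => HP; move: ux0S.
  by rewrite HP mulr0 leNgt ux0.
(* For [|x - x0| <= rad], the ball of radius [3/4 d] around [x] stays where [u > 0], and [x0] lies
   within [5/16] of that radius from [x]. *)
pose rad := 3 / 16 * d; have rad0 : 0 < rad by rewrite mulr_gt0// divr_gt0.
have radE : rad = 3 / 16 * d by [].
clearbody rad; exists rad => //.
have rad01 : 0 < rad <= 1 by rewrite rad0; clear - radE d0 d1; lra.
have ball_in x t : enorm (x - x0) <= t -> t < d -> enorm (x - x0) < d.
  exact: le_lt_trans.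
have radd : rad < d by clear - radE d0; lra.
have radB : cball x0 rad `<=` eball 0 1.
  by move=> x xr; apply: xB; rewrite /cball /=; exact: le_trans xr (ltW radd).
have uS x : cball x0 rad x -> u x <= B * d * (H + Ph).
  move=> xr; rewrite /cball /= in xr; pose d' := 3 / 4 * d.
  have d'0 : 0 < d' <= 1 by rewrite /d'; apply/andP; split; clear - d0 d1; lra.
  have near y t : enorm (y - x) <= t -> enorm (y - x0) <= t + rad.
    by move=> yx; have := enormD3 y x x0; clear - yx xr; lra.
  have d'rad : d' + rad < d by rewrite /d'; clear - radE d0; lra.
  have xB' : cball x d' `<=` eball 0 1.
    move=> y yx; apply: xB; rewrite /cball /=.
    exact: le_trans (near _ _ yx) (ltW d'rad).
  have upos' y : enorm (y - x) < d' -> 0 < u y.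
    by move=> yx; apply: upos; exact: le_lt_trans (near _ _ (ltW yx)) d'rad.
  have xx0 : enorm (x0 - x) <= 5 / 16 * d'.
    by rewrite enormB /d'; clear - xr radE d0; lra.
  have := har F u f h Ph x d' vd fbu d'0 xB' upos' x0 xx0.
  have : C1 * d' * Ph <= C1 * d * (H + Ph).
    have C1d : 0 <= C1 * d by rewrite mulr_ge0// ltW.
    by have := mulr_ge0 C1d H0; have := mulr_ge0 C1d Ph0; rewrite /d'; clear; lra.
  move=> h1 h2; rewrite -(@ler_pM2l _ c)//.
  have -> : c * (B * d * (H + Ph)) = (C1 + C2) * d * (H + Ph).
    by rewrite /B; field; rewrite gt_eqF.
  by clear - h1 h2 ux0S; lra.
(* Since [6 * rad >= d], the part with [6 * B] handles the bound of [u] on the ball; the [1] handles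
   [Ph]. *)
clearbody B; pose L := C0 * (6 * B + 1) * (H + Ph).
have B6 : 0 < 6 * B + 1 by clear - B0; lra.
have L0 : 0 < L by rewrite !mulr_gt0.
have BHP : 0 <= B * (H + Ph) by rewrite mulr_ge0// ltW.
apply: (lipC F u f h x0 rad (B * d * (H + Ph)) Ph L) => //.
- exact: vd_elliptic vd.
- exact: vd_solution vd.
- exact: vd_f vd.
- rewrite /L -!mulrA ler_pM2l// radE.
  by have := mulr_ge0 BHP (ltW d0); have := mulr_gt0 HP0 d0; clear; lra.
- rewrite /L -mulrA ler_pM2l//; clear - BHP H0 Ph0; lra.
- move=> w /(free_boundaryP cu) uw wr; have := upos w (le_lt_trans wr radd).
  by rewrite ltNge uw.
Qed.

Lemma lipschitz_with_sup lam Lam alpha :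
  0 < lam -> lam <= Lam -> 0 <= alpha ->
  exists2 C : R, 0 <= C & forall F u f h Ph H S x0,
    viscosity_data lam Lam alpha F u f Ph -> visc_free_boundary_le u h ->
    0 <= H -> (forall x, free_boundary (eball 0 1) u x -> h x <= H) ->
    0 <= S -> cball x0 (1 / 4) `<=` eball 0 1 ->
    (forall x, cball x0 (1 / 4) x -> u x <= S) ->
    forall y, cball x0 (1 / 4) y ->
      u^\+ x0 - u^\+ y <= C * (H + S + Ph) * enorm (x0 - y).
Proof.
move=> lam0 lamLam al0.
have [C0 C01 lipC] := @lipschitz_at_center R n lam Lam alpha lam0 lamLam al0.
have C00 : 0 < C0 by clear - C01; lra.
exists (4 * C0); first by rewrite mulr_ge0// ltW.
move=> F u f h Ph H S x0 vd fbu H0 hH S0 xB uS y yr.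
have Ph0 := vd_Ph0 vd; have HSP : 0 <= H + S + Ph by rewrite !addr_ge0.
(* [lipschitz_at_center] asks for a positive slope; in the degenerate case [u^+] vanishes at
   [x0]. *)
have [E0|N0] := eqVneq (H + S + Ph) 0.
  have S00 : S = 0 by clear - E0 H0 S0 Ph0; lra.
  have : u^\+ x0 <= 0.
    by rewrite /funrpos ge_max lexx andbT -S00 uS// /cball /= enorm_center divr_ge0.
  by rewrite E0 mulr0 mul0r; have := funrpos_ge0 u y; clear; lra.
have HSP0 : 0 < H + S + Ph by rewrite lt0r N0.
have CHS : H + S + Ph <= C0 * (H + S + Ph) by rewrite ler_peMl// ltW.
have L0 : 0 < 4 * C0 * (H + S + Ph) by rewrite !mulr_gt0.
have r1 : 0 < (1 / 4 : R) <= 1 by apply/andP; split; clear; lra.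
apply: (lipC F u f h x0 (1 / 4) S Ph) => //.
- exact: vd_elliptic vd.
- exact: vd_cont vd.
- exact: vd_solution vd.
- exact: vd_f vd.
- have : C0 * S <= C0 * (H + S + Ph) by rewrite ler_pM2l//; clear - H0 Ph0; lra.
  by clear; lra.
- have : C0 * Ph <= C0 * (H + S + Ph) by rewrite ler_pM2l//; clear - H0 S0; lra.
  by clear - CHS HSP; lra.
- move=> w fw _; have := hH w fw.
  by clear - CHS HSP0 S0 Ph0; lra.
Qed.

End OneSidedBounds.

(** * Null sets and norms *)

Section NullSets.
Context {R : realType}.
Implicit Types (a b : nat -> nat -> R) (lo x : nat -> R) (s : R) (D : pred nat).

Let mu := @lebesgue_measure R.

(* Fubini by hand: integrate the covering property of the slices. *)
Lemma cube_volume_le_cover a b lo s : 0 < s -> (forall k i, a k i <= b k i) ->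
  forall n D,
  (forall x, (forall i, (i < n)%N -> lo i <= x i <= lo i + s) ->
     exists2 k, D k & forall i, (i < n)%N -> a k i <= x i <= b k i) ->
  ((s ^+ n)%:E <= \sum_(0 <= k <oo) ((D k)%:R * \prod_(i < n) (b k i - a k i))%:E)%E.
Proof.
move=> s0 ab; elim=> [|n IH] D cover.
  (* In dimension [0] the covering still provides an index [k] with [D k], and its empty product
     contributes [1]. *)
  have [k Dk _] := cover (fun=> 0) (fun i i0 => False_ind _ (notF i0)).
  apply: le_trans (nneseries_lim_ge k.+1 _) => [|j _ _]; last first.
    by rewrite big_ord0 mulr1 lee_fin.
  rewrite big_nat_recr//= Dk big_ord0 mulr1 expr0 leeDr//.
  by apply: sume_ge0 => j _; rewrite big_ord0 mulr1 lee_fin.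
pose V k := \prod_(i < n) (b k i - a k i); pose w k := (D k)%:R * V k.
have V0 k : 0 <= V k by apply: prodr_ge0 => i _; rewrite subr_ge0.
have w0 k : 0 <= w k by rewrite mulr_ge0.
pose I := `[lo n, lo n + s]%classic : set R; pose J k := `[a k n, b k n]%classic : set R.
have muI : mu I = s%:E.
  by rewrite /mu /I lebesgue_measure_itv /= lte_fin ltrDl s0 -EFinB addrAC subrr add0r.
have mJ k : measurable (J k) by exact: measurable_itv.
have mI : measurable I by exact: measurable_itv.
have slice t : I t -> ((s ^+ n)%:E <= \sum_(0 <= k <oo) (w k * \1_(J k) t)%:E)%E.
  (* [D] records the boxes that meet the coordinates fixed so far: on the slice at height [t] only
     those with [t] in [J k] remain. *)
  move=> It; have := IH (fun k => D k && (t \in J k)).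
  have -> : (\sum_(0 <= k <oo) ((D k && (t \in J k))%:R * V k)%:E =
      \sum_(0 <= k <oo) (w k * \1_(J k) t)%:E)%E.
    by apply: eq_eseriesr => k _; rewrite /w indicE; case: (D k); case: (t \in J k);
      rewrite /= ?(mul1r, mul0r, mulr1, mulr0).
  apply => x xc; have [|k Dk kx] := cover (fun i => if i == n then t else x i).
    move=> i; rewrite ltnS leq_eqVlt; case: eqP => [->|_] /=; last exact: xc.
    by move=> _; move: It; rewrite /I /= in_itv.
  exists k => [|i i_n].
    by have := kx n (ltnSn n); rewrite eqxx Dk /J inE /= in_itv.
  by have := kx i (ltnW i_n); rewrite (ltn_eqF i_n).
have mf k : measurable_fun I (EFin \o (fun t => w k * \1_(J k) t)).
  apply/measurable_EFinP; apply: measurable_funM; first exact: measurable_cst.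
  exact: measurable_indic.
have f0 (k : nat) (t : R) : I t -> (0 <= (w k * \1_(J k) t)%:E)%E by rewrite lee_fin mulr_ge0.
have -> : ((s ^+ n.+1)%:E = \int[mu]_(t in I) (s ^+ n)%:E)%E.
  by rewrite integral_cst// [X in (_ * X)%E]muI -EFinM exprSr.
apply: (@le_trans _ _ (\int[mu]_(t in I) (\sum_(0 <= k <oo) (w k * \1_(J k) t)%:E))%E).
  apply: ge0_le_integral => //.
    by move=> t _; rewrite lee_fin; exact: (exprn_ge0 _ (ltW s0)).
  apply: (@ge0_emeasurable_sum _ _ _ I (fun k (t : R) => (w k * \1_(J k) t)%:E) xpredT).
    by move=> k t It _; exact: f0.
  by move=> k _; exact: mf.
rewrite integral_nneseries//; apply: lee_nneseries => [k _ _|k _].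
  by apply: integral_ge0 => t It; exact: f0.
under eq_integral do rewrite EFinM.
have mJI : measurable_fun I (EFin \o (fun t => \1_(J k) t : R)).
  by apply/measurable_EFinP; exact: measurable_indic.
rewrite ge0_integralZl_EFin//.
rewrite integral_indic//; last exact: mJ.
rewrite big_ord_recr /= mulrA -/(V k) -/(w k) [X in (_ <= X)%E]EFinM.
apply: lee_wpmul2l; first by rewrite lee_fin.
apply: (@le_trans _ _ (mu (J k))).
  by apply: le_measure; rewrite ?inE;
    [exact: (measurableI _ _ (mJ k) mI)|exact: mJ|exact: subIsetl].
rewrite /mu /J lebesgue_measure_itv /= lte_fin; case: ifPn => // _.
by rewrite lee_fin subr_ge0.
Qed.

Lemma eball_not_null n (z : 'rV[R]_n) r : 0 < r -> ~ lebesgue_null (eball z r).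
Proof.
case: n z => [|n] z r0 null.
  (* In dimension [0] every box has volume [1], more than the allowed [1 / 2]. *)
  have [a [b [_ _]]] := null (1 / 2) ltac:(by rewrite divr_gt0).
  have : ((\prod_(i < 0) (b 0%N 0 i - a 0%N 0 i))%:E <=
    \sum_(0 <= k <oo) (\prod_(i < 0) (b k 0 i - a k 0 i))%:E)%E.
    apply: le_trans (nneseries_lim_ge 1 _); first by rewrite big_nat1.
    by move=> k _ _; rewrite big_ord0 lee_fin.
  by move=> h1 h2; have := le_trans h1 h2; rewrite big_ord0 lee_fin; lra.
(* The dimension is [n + 1] and [(n + 1) s < r], so that the cube of side [s] with corner [z] lies
   in the open ball. *)
pose s := r / n.+2%:R; have s0 : 0 < s by rewrite divr_gt0.
have [a [b [ab cover vol]]] := null (s ^+ n.+1 / 2) ltac:(by rewrite divr_gt0// exprn_gt0).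
pose a' k i := a k 0 (inord i : 'I_n.+1); pose b' k i := b k 0 (inord i : 'I_n.+1).
have := @cube_volume_le_cover a' b' (fun i => z 0 (inord i)) s s0
  (fun k i => ab k _) n.+1 predT.
have -> : (\sum_(0 <= k <oo) ((predT k)%:R * \prod_(i < n.+1) (b' k i - a' k i))%:E =
    \sum_(0 <= k <oo) (\prod_i (b k 0 i - a k 0 i))%:E)%E.
  apply: eq_eseriesr => k _; rewrite mul1r; congr (_%:E).
  by apply: eq_bigr => i _; rewrite /a' /b' !inord_val.
move=> h; have := le_trans (h _) vol; rewrite lee_fin.
have sn0 : 0 < s ^+ n.+1 by rewrite exprn_gt0.
suff c : forall x : nat -> R,
    (forall i, (i < n.+1)%N -> z 0 (inord i) <= x i <= z 0 (inord i) + s) ->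
    exists2 k, predT k & forall i, (i < n.+1)%N -> a' k i <= x i <= b' k i.
  by move=> /(_ c); move: (s ^+ n.+1) sn0 => t; clear; lra.
move=> x xz; pose y := \row_(i < n.+1) x i : 'rV[R]_n.+1.
have yz : eball z r y.
  rewrite /eball /=; apply: le_lt_trans (@enorm_le_coord _ _ _ s (ltW s0) _) _.
    move=> i; rewrite !mxE; have := xz i (ltn_ord i); rewrite inord_val.
    by move=> /andP[x1 x2]; rewrite ger0_norm; lra.
  by rewrite /s mulrCA gtr_pMr// ltr_pdivrMr// mul1r ltr_nat.
have [k _ kx] := cover y yz; exists k => // i i_n.
by have := kx (inord i); rewrite mxE inordK.
Qed.

End NullSets.

Section EssentialNorms.
Context {R : realType} {n : nat}.
Implicit Types (A B : set 'rV[R]_n) (g : 'rV[R]_n -> R) (x : 'rV[R]_n).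

Lemma lebesgue_null_sub A B : A `<=` B -> lebesgue_null B -> lebesgue_null A.
Proof.
move=> AB nB e e0; have [a [b [ab cB vol]]] := nB e e0.
by exists a, b; split=> //; exact: subset_trans cB.
Qed.

Lemma lebesgue_null0 : (0 < n)%N -> lebesgue_null (set0 : set 'rV[R]_n).
Proof.
move=> n0 e e0; exists (fun=> 0), (fun=> 0); split=> [k i//|x//|].
rewrite eseries0 ?lee_fin ?ltW// => k _ _.
by rewrite (bigD1 (Ordinal n0))//= subrr mul0r.
Qed.

Lemma Linfty_norm_ge A g x : (forall y, A y -> exists2 r : R, 0 < r & eball y r `<=` A) ->
  cont_on A g -> A x -> (`|g x|%:E <= Linfty_norm A g)%E.
Proof.
move=> oA cg Ax; apply: le_ereal_inf_tmp => _ [M [_ null] <-].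
rewrite lee_fin leNgt; apply/negP => Mg.
have [r r0 rA] := oA _ Ax; have [d d0 dg] := cg _ Ax (`|g x| - M) ltac:(by rewrite subr_gt0).
have m0 : 0 < Num.min r d by rewrite lt_min r0.
apply: (@eball_not_null R n x _ m0); apply: lebesgue_null_sub null => y.
rewrite /eball /= lt_min => /andP[yr yd]; have Ay : A y by exact: rA.
split=> //; have := dg y Ay yd; have := ler_distD (g y) (g x) 0.
by rewrite !subr0 (distrC (g x)); lra.
Qed.

Lemma Linfty_norm_le A g (M : R) : (0 < n)%N -> 0 <= M ->
  (forall x, A x -> `|g x| <= M) -> (Linfty_norm A g <= M%:E)%E.
Proof.
move=> n0 M0 gM; apply: ereal_inf_lbound; exists M => //; split=> //.
apply: lebesgue_null_sub (lebesgue_null0 n0) => x [Ax].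
by rewrite ltNge gM.
Qed.

Lemma Linfty_norm_ge0 A g : (0 <= Linfty_norm A g)%E.
Proof. by apply: le_ereal_inf_tmp => _ [M [M0 _] <-]; rewrite lee_fin. Qed.

Lemma sup_norm_ge0 A g : (0 <= sup_norm A g)%E.
Proof. by apply: le_ereal_inf_tmp => _ [M [M0 _] <-]; rewrite lee_fin. Qed.

Lemma sup_norm_ge A g x : A x -> (`|g x|%:E <= sup_norm A g)%E.
Proof.
by move=> Ax; apply: le_ereal_inf_tmp => _ [M [_ gM] <-]; rewrite lee_fin gM.
Qed.

Lemma ge0_lty_EFin (a : \bar R) : (0 <= a)%E -> (a < +oo)%E -> exists2 r : R, 0 <= r & a = r%:E.
Proof. by case: a => [r| |] // r0 _; exists r. Qed.

Lemma partial_le g x (r L : R) i : 0 < r -> 0 <= L ->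
  (forall y, cball x r y -> g x - g y <= L * enorm (x - y)) -> `|partial i g x| <= L.
Proof.
move=> r0 L0 gL; rewrite /partial /derive.
set q := (fun h : R => _).
(* Where the derivative does not exist, the limit is the default value [0] and the bound is
   trivial. *)
have [cv|/dvgP ->] := pselect (cvg (q h @[h --> 0^'])); last by rewrite normr0.
set l := lim _ in cv *; rewrite leNgt; apply/negP => Ll.
have e0 : 0 < `|l| - L by rewrite subr_gt0.
have : \forall h \near 0^', `|l - q h| < `|l| - L by move/cvgrPdist_lt : cv; apply.
move=> /nbhs_ballP[d /= d0 dq].
pose t := Num.min r (d / 2); have t0 : 0 < t by rewrite lt_min r0 divr_gt0.
have tr : t <= r by rewrite ge_min lexx.
have td : t < d by rewrite gt_min [d / 2 < d](_ : _ = true) ?orbT//; clear - d0; lra.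
have ev1 : enorm (evec i : 'rV[R]_n) = 1.
  by rewrite /enorm dotE (bigD1 i)//= big1 ?addr0 ?mxE ?eqxx ?mulr1 ?sqrtr1// => j ji;
    rewrite /evec mxE (negPf ji) andbF mul0r.
have slope a : `|a| = t -> g x - g (a *: evec i + x) <= L * t.
  move=> at_; have := gL (a *: evec i + x); rewrite /cball /= addrK enormB addrK enormZ ev1 mulr1 at_.
  by apply.
have qE a : q a = a^-1 * (g (a *: evec i + x) - g x) by [].
have tl : t * L < t * `|l| by rewrite ltr_pM2l.
(* The hypothesis controls decreases of [g] away from [x]: they are sought along [- evec i] when the
   derivative is nonnegative, along [evec i] otherwise. *)
have [l0|l0] := leP 0 l.
  have := dq (- t); rewrite /ball /= sub0r opprK gtr0_norm// => /(_ td).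
  rewrite oppr_eq0 gt_eqF// => /(_ isT); rewrite qE (ger0_norm l0) => qt.
  have := slope (- t); rewrite normrN gtr0_norm// => /(_ erefl).
  move: (g _) qt => gy qt gyL.
  have : (- t)^-1 * (gy - g x) <= L by rewrite invrN mulNr -mulrN mulrC ler_pdivrMr// opprB.
  by move: qt => /ltr_distlBl; clear; lra.
have := dq t; rewrite /ball /= sub0r normrN gtr0_norm// => /(_ td).
rewrite gt_eqF// => /(_ isT); rewrite qE (ltr0_norm l0) => qt.
have := slope t; rewrite gtr0_norm// => /(_ erefl).
move: (g _) qt => gy qt gyL.
have : - L <= t^-1 * (gy - g x) by rewrite mulrC ler_pdivlMr//; clear - gyL; lra.
by move: qt; rewrite distrC => /ltr_distlDr; clear; lra.
Qed.

Lemma enorm_grad_le g x (r L : R) : 0 < r -> 0 <= L ->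
  (forall y, cball x r y -> g x - g y <= L * enorm (x - y)) ->
  enorm (grad g x) <= n%:R * L.
Proof.
by move=> r0 L0 gL; apply: enorm_le_coord => // i; rewrite mxE; exact: partial_le gL.
Qed.

End EssentialNorms.

(** * Proof of the theorem *)

Section Assembly.
Context {R : realType} {n : nat}.
Implicit Types (u f h : 'rV[R]_n -> R) (x y : 'rV[R]_n).

Lemma cball_sub_eball x y (r s t : R) : eball x r y -> r + s <= t -> cball y s `<=` eball x t.
Proof.
move=> xy rst z; rewrite /cball /eball /= in xy * => zy.
by have := enormD3 z y x; clear - xy rst zy; lra.
Qed.

Lemma eball_open x (r : R) y : eball x r y -> exists2 s : R, 0 < s & eball y s `<=` eball x r.
Proof.
rewrite /eball /= => yx; exists (r - enorm (y - x)); first by rewrite subr_gt0.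
by move=> z /= zy; have := enormD3 z y x; clear - zy; lra.
Qed.

Lemma positivity_set_open u y : cont_on (eball 0 1) u -> positivity_set (eball 0 1) u y ->
  exists2 s : R, 0 < s & eball y s `<=` positivity_set (eball 0 1) u.
Proof.
move=> cu [By uy]; have [s s0 sB] := eball_open By; have [d d0 du] := cu _ By _ uy.
exists (Num.min s d); first by rewrite lt_min s0.
move=> z; rewrite /eball /= lt_min => /andP[zs zd]; have Bz : eball 0 1 z by exact: sB.
by split=> //; have := du z Bz zd; rewrite ltr_distlC => /andP[_]; clear; lra.
Qed.

(** This is qualitative: the constant involves the maximum [S] of [u^+] on the closed ball of radius
    [3/4], finite by compactness even if [u] is unbounded near the unit sphere. Points more than
    [1/4] apart are handled by [u^+ <= S <= 4 S |x - y|]. *)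
Lemma lipschitz_in_half lam Lam alpha F u f h (Ph H : R) :
  viscosity_data lam Lam alpha F u f Ph -> visc_free_boundary_le u h ->
  0 <= H -> (forall x, free_boundary (eball 0 1) u x -> h x <= H) ->
  lipschitz_in (eball 0 (1 / 2)) u^\+.
Proof.
move=> vd fbu H0 hH.
have [C C0 lipC] := @lipschitz_with_sup R n lam Lam alpha (vd_lam0 vd) (vd_lamLam vd) (vd_alpha0 vd).
have c34 : cball (0 : 'rV[R]_n) (3 / 4) `<=` eball 0 1.
  by move=> x; rewrite /cball /eball /=; clear; lra.
have cu : cont_on (cball 0 (3 / 4)) u^\+ by apply: cont_on_max0; apply: cont_onW c34 (vd_cont vd).
have [m _ um] := evt_cball (divr_ge0 (ler0n R 3) (ler0n R 4)) cu.
set S := u^\+ m in um; have S0 : 0 <= S by exact: funrpos_ge0.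
have half34 x : eball 0 (1 / 2) x -> cball x (1 / 4) `<=` cball 0 (3 / 4).
  move=> hx y; rewrite /eball /cball /= in hx * => yx.
  by have := enormD3 y x 0; clear - hx yx; lra.
have close x y : eball 0 (1 / 2) x -> cball x (1 / 4) y ->
    u^\+ x - u^\+ y <= C * (H + S + Ph) * enorm (x - y).
  move=> hx; apply: (lipC F u f h Ph H S x) => //; first exact: subset_trans (half34 _ hx) c34.
  by move=> z /(half34 _ hx) /um; apply: le_trans; rewrite /funrpos le_max lexx.
have CH0 : 0 <= C * (H + S + Ph) by rewrite mulr_ge0// !addr_ge0// (vd_Ph0 vd).
have oneside x y : eball 0 (1 / 2) x -> eball 0 (1 / 2) y ->
    u^\+ x - u^\+ y <= (C * (H + S + Ph) + 4 * S) * enorm (x - y).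
  move=> hx hy; have xy0 := enorm_ge0 (x - y).
  have [yx|yx] := leP (enorm (y - x)) (1 / 4).
    apply: le_trans (close x y hx yx) _; rewrite mulrDl lerDl mulr_ge0//.
    by rewrite mulr_ge0.
  have : u^\+ x <= S by apply: um; apply: half34 hx _ _; rewrite /cball /= enorm_center divr_ge0.
  have uy0 : 0 <= u^\+ y by exact: funrpos_ge0.
  have := mulr_ge0 CH0 xy0; move: yx; rewrite mulrDl enormB.
  by move: (u^\+ x) (u^\+ y) (C * _) (enorm _) uy0 S0 => a b c e; clear; nra.
exists (C * (H + S + Ph) + 4 * S) => x y hx hy; rewrite ler_norml oneside// andbT.
by rewrite -lerN2 opprK opprB enormB oneside.
Qed.

End Assembly.

Unset Implicit Arguments.
Set Strict Implicit.
Set Printing Implicit Defensive.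

Theorem theorem2p3 (R : realType) (n : nat) (alpha lam Lam : R) :
  (2 <= n)%N -> 0 <= alpha -> 0 < lam <= Lam ->
  exists C : R, 0 < C /\
    forall (F : 'M[R]_n -> R) (u f h : 'rV[R]_n -> R),
      let B1 := eball (0 : 'rV[R]_n) 1 in
      let Bhalf := eball (0 : 'rV[R]_n) (1 / 2) in
      let B1pos := positivity_set B1 u in
      let FBu := free_boundary B1 u in
      let uplus := u^\+ in
      uniformly_elliptic lam Lam F -> F 0 = 0 ->
      {within B1, continuous u} ->
      {within B1, continuous f} -> (Linfty_norm B1 f < +oo)%E ->
      {within FBu, continuous h} -> (sup_norm FBu h < +oo)%E ->
      visc_solution B1pos alpha F f u ->
      visc_free_boundary_le u h ->
      [/\ lipschitz_in Bhalf uplus,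
          (Linfty_norm Bhalf (fun x => enorm (grad uplus x)) <=
             C%:E * (sup_norm FBu h + Linfty_norm B1pos u +
                     Linfty_norm B1 f `^ (1 + alpha)^-1%R))%E &
          FBu 0 ->
          (Linfty_norm Bhalf (fun x => enorm (grad uplus x)) <=
             C%:E * (sup_norm FBu h +
                     Linfty_norm B1 f `^ (1 + alpha)^-1%R))%E].
Proof.
move=> n2 al0 /andP[lam0 lamLam]; have n0 : (0 < n)%N by exact: ltnW.
have [Cs Cs0 lip_sup] := @lipschitz_with_sup R n lam Lam alpha lam0 lamLam al0.
have [Cb Cb0 lip_fb] := @lipschitz_from_free_boundary R n lam Lam alpha lam0 lamLam al0.
(* The factor [n] is the cost of passing from partial derivatives to the Euclidean norm of the
   gradient; the [1] ensures positivity. *)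
pose C := n%:R * (Cs + Cb) + 1.
have nC0 : 0 <= n%:R * (Cs + Cb) by rewrite mulr_ge0// addr_ge0.
have C0 : 0 < C by rewrite ltr_wpDl.
exists C; split=> // F u f h B1 Bhalf B1pos FBu uplus ellF F0 /cont_onP cu /cont_onP cf f_fin _ h_fin
  sol fbu.
have [H H0 hE] := ge0_lty_EFin (sup_norm_ge0 FBu h) h_fin.
have [M M0 fE] := ge0_lty_EFin (Linfty_norm_ge0 B1 f) f_fin.
have hH x : FBu x -> h x <= H.
  by move=> /(sup_norm_ge h); rewrite hE lee_fin; apply: le_trans; exact: ler_norm.
pose Ph := M `^ (1 + alpha)^-1; have Ph0 : 0 <= Ph by exact: powR_ge0.
have al1 : 0 < 1 + alpha by rewrite ltr_wpDr.
have vd : viscosity_data lam Lam alpha F u f Ph.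
  split=> // x Bx; rewrite /Ph -powRrM mulVf ?gt_eqF// powRr1//.
  by rewrite -lee_fin -fE; apply: Linfty_norm_ge => // y; exact: eball_open.
have le_C (c T : R) : 0 <= T -> 0 <= c -> c <= Cs + Cb -> n%:R * (c * T) <= C * T.
  move=> T0 c0 cC; rewrite mulrA ler_wpM2r// /C -[leLHS]addr0 lerD// ler_wpM2l//.
have half_sub x : Bhalf x -> cball x (1 / 4) `<=` B1.
  by move=> hx; apply: cball_sub_eball hx _; clear; lra.
split.
- exact: lipschitz_in_half vd fbu H0 hH.
- rewrite hE fE poweR_EFin -/Ph.
  have : (0 <= Linfty_norm B1pos u)%E by exact: Linfty_norm_ge0.
  (* If the norm of [u] is infinite the right-hand side is [+oo], because [C] is positive. *)
  case uE : (Linfty_norm B1pos u) => [S| |]// S0; last first.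
    by rewrite addey// addye// gt0_muley ?lte_fin// leey.
  rewrite lee_fin in S0.
  apply: Linfty_norm_le => //; first by rewrite mulr_ge0 ?(ltW C0)// !addr_ge0.
  move=> x hx; rewrite ger0_norm ?enorm_ge0//.
  have HSP : 0 <= H + S + Ph by rewrite !addr_ge0.
  apply: le_trans (le_C Cs _ HSP Cs0 _); last by rewrite lerDl.
  apply: (@enorm_grad_le _ _ _ _ (1 / 4)); [by rewrite divr_gt0|by rewrite mulr_ge0|].
  apply: (lip_sup F u f h Ph H S x) => //; first exact: half_sub.
  move=> y /(half_sub _ hx) By; have [uy|uy] := leP (u y) 0; first exact: le_trans uy S0.
  rewrite -lee_fin -uE; apply: le_trans (_ : `|u y|%:E <= _)%E; first by rewrite lee_fin ler_norm.
  apply: Linfty_norm_ge => //; first by move=> z; exact: positivity_set_open.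
  by apply: cont_onW cu => z [].
- move=> FB0; rewrite hE fE poweR_EFin -/Ph.
  have u0 : u 0 <= 0 by exact: free_boundaryP FB0.
  have HP : 0 <= H + Ph by rewrite addr_ge0.
  apply: Linfty_norm_le => //; first by rewrite mulr_ge0 ?(ltW C0).
  move=> x hx; rewrite ger0_norm ?enorm_ge0//.
  apply: le_trans (le_C Cb _ HP Cb0 _); last by rewrite lerDr.
  (* Where [u x <= 0], the function [u^+] attains its minimum at [x], so the one-sided bound holds
     on any ball; the radius [1] is arbitrary. *)
  have [ux|ux] := leP (u x) 0.
    apply: (@enorm_grad_le _ _ _ _ 1) => //; first by rewrite mulr_ge0.
    move=> y _; rewrite {1}/uplus /funrpos (max_idPr ux) sub0r.
    apply: (@le_trans _ _ 0); first by rewrite oppr_le0 funrpos_ge0.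
    by rewrite !mulr_ge0// enorm_ge0.
  have [r r0 ur] := lip_fb F u f h Ph H x vd fbu H0 hH u0 hx ux.
  by apply: enorm_grad_le r0 _ ur; rewrite mulr_ge0.
Qed.
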